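(* Let $(S_n)_{n\ge 0}$ be the minimal random walk with parameters $p,q,s\in[0,1]$, and let $a=p-q$. Assume $a<1/2$ (diffusive regime), and let $$\sigma^2=\frac{q}{1-a}\Big(1-\frac{q}{1-a}\Big)=\frac{q(1-p)}{(1-a)^2}.$$ Then we have the almost sure convergence $$\lim_{n\to\infty}\frac{S_n}{n}=\frac{q}{1-a}\qquad\text{a.s.}$$ In addition, we have the law of iterated logarithm $$\limsup_{n\to\infty}\Big(\frac{n}{2\log\log n}\Big)^{1/2}\Big(\frac{S_n}{n}-\frac{q}{1-a}\Big)=-\liminf_{n\to\infty}\Big(\frac{n}{2\log\log n}\Big)^{1/2}\Big(\frac{S_n}{n}-\frac{q}{1-a}\Big)=\frac{\sigma}{\sqrt{1-2a}}\qquad\text{a.s.}$$ In particular, $$\limsup_{n\to\infty}\Big(\frac{n}{2\log\log n}\Big)\Big(\frac{S_n}{n}-\frac{q}{1-a}\Big)^2=\frac{\sigma^2}{1-2a}\qquad\text{a.s.}$$ Moreover, we have the quadratic strong law $$\lim_{n\to\infty}\frac{1}{\log n}\sum_{k=1}^n\Big(\frac{S_k}{k}-\frac{q}{1-a}\Big)^2=\frac{\sigma^2}{1-2a}\qquad\text{a.s.}$$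
   Context: Minimal random walk (MRW) with parameters $p,q,s\in[0,1]$: $S_0=0$, $S_1=X_1$ where $X_1$ has the Bernoulli distribution with success probability $s$. For every $n\ge1$, $$X_{n+1}=\alpha_{n+1}X_{U_n}+\beta_{n+1}(1-X_{U_n}),\qquad S_{n+1}=S_n+X_{n+1},$$ where $\alpha_{n+1}\sim$ Bernoulli$(p)$, $\beta_{n+1}\sim$ Bernoulli$(q)$, $U_n$ is uniform on $\{1,\dots,n\}$, and $\alpha_{n+1},\beta_{n+1},U_n$ are mutually independent and independent of $(X_1,\dots,X_n)$. Standing assumption: $a=p-q<1$, i.e. $(p,q)\ne(1,0)$. *)

(* Defs.v *)
From HB Require Import structures.
From mathcomp Require Export all_boot all_order all_algebra.
From mathcomp Require Export all_classical all_reals all_analysis.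

Set Implicit Arguments.
Unset Strict Implicit.
Unset Printing Implicit Defensive.

Export Order.TTheory GRing.Theory Num.Theory.
Export numFieldNormedType.Exports.

Local Open Scope classical_set_scope.
Local Open Scope ring_scope.

Definition sigma_rv (d d' : measure_display) (T : measurableType d)
    (T' : measurableType d') (Y : T -> T') : set (set T) :=
  preimage_set_system setT Y measurable.

Definition mutually_independent (R : realType) (d : measure_display)
    (T : measurableType d) (P : probability T R) (G : seq (set (set T))) : Prop :=
  forall (J : {set 'I_(size G)}) (A : 'I_(size G) -> set T),
    (forall i, i \in J -> nth set0 G i (A i)) ->
    P (\bigcap_(i in [set` J]) A i) = (\prod_(i in J) P (A i))%E.

Definition uniform_1_to (R : realType) (d : measure_display)
    (T : measurableType d) (P : probability T R) (n : nat)
    (V : {RV P >-> nat}) : Prop :=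
  forall k : nat, distribution P V [set k] =
    (if (1 <= k <= n)%N then n%:R^-1 else 0)%:E.

(* The steps are the X n with n >= 1; X 0, alpha 0, alpha 1, beta 0, beta 1 and
   U 0 are unused, up to the null events where U n falls outside {1,...,n}.
   Bernoulli variables are bool-valued and cast to R by %:R. *)
Record minimal_random_walk (R : realType) (d : measure_display)
    (T : measurableType d) (P : probability T R) (p q s : R)
    (X alpha beta : nat -> {RV P >-> bool}) (U : nat -> {RV P >-> nat}) : Prop := {
  mrw_X1 : distribution P (X 1%N) =1 bernoulli_prob s;
  mrw_alpha : forall n, (1 <= n)%N ->
    distribution P (alpha n.+1) =1 bernoulli_prob p;
  mrw_beta : forall n, (1 <= n)%N ->
    distribution P (beta n.+1) =1 bernoulli_prob q;
  mrw_U : forall n, (1 <= n)%N -> uniform_1_to n (U n);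
  mrw_step : forall n w, (1 <= n)%N ->
    (X n.+1 w)%:R = (alpha n.+1 w)%:R * (X (U n w) w)%:R
                    + (beta n.+1 w)%:R * (1 - (X (U n w) w)%:R) :> R;
  mrw_indep : forall n, (1 <= n)%N ->
    mutually_independent P
      [:: sigma_rv (alpha n.+1); sigma_rv (beta n.+1); sigma_rv (U n)];
  mrw_indep_past : forall n, (1 <= n)%N ->
    mutually_independent P
      [:: <<s sigma_rv (alpha n.+1) `|` sigma_rv (beta n.+1) `|` sigma_rv (U n) >>;
          <<s \bigcup_(k in [set k | (1 <= k <= n)%N]) sigma_rv (X k) >>]
}.

Definition position (R : realType) (d : measure_display)
    (T : measurableType d) (P : probability T R)
    (X : nat -> {RV P >-> bool}) (n : nat) (w : T) : R :=
  \sum_(1 <= k < n.+1) (X k w)%:R.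

(* Main.v *)
(* Given the past, the next step is a Bernoulli variable of parameter
   m + a Y_n / n, where Y_n = S_n - m n; hence Y_{n+1} = (1 + a/n) Y_n + eps_{n+1}
   with bounded martingale differences eps, and Y_n / gam_n is a martingale for
   gam_n = prod (1 + a/k). Only the finite-dimensional law matters, so conditional
   expectations are computed by iterating a two-point averaging operator on
   functions of the history.

   Upper bound: E exp(l eps) is at most exp(l^2 sigma^2 (1 + o(1)) / 2), so Ville's
   inequality for the exponential supermartingale bounds the maximum of the
   martingale over geometric blocks; Borel-Cantelli concludes. A first pass with the
   crude variance 1 gives |Y_n| = O(sqrt(n log log n)), hence the strong law and the
   convergence of the conditional variances, which makes a second pass sharp.

   Lower bound: matching lower bounds for E exp(l eps) force, by a Cramer-type
   comparison of three exponential moments, a block of the form [K^k, K^(k+1)) to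
   contribute nearly sqrt(2 V log log n) with conditional probability at least
   c / k, and the conditional Borel-Cantelli lemma applies. The contribution of
   the past of the block is negligible for large K because a < 1/2.

   Quadratic strong law: expanding Y_n^2 / n expresses (1 - 2a) sum (Y_k / k)^2 as
   sum of conditional variances / (k + 1), plus a martingale with second moment
   O(log n), plus negligible terms; since the sum is monotone in n, Chebyshev along
   n = 2^(j^2) suffices. *)
Require Import Defs.
From mathcomp Require Import ring lra.

Set Implicit Arguments.
Unset Strict Implicit.
Unset Printing Implicit Defensive.
Local Open Scope classical_set_scope.
Local Open Scope ring_scope.

(** * Conditional means of binary processes *)

(** Exponential moments carry both halves of the iterated logarithm; no central limit theorem is
    involved. The obstacle is that the conditional variance is close to [m * (1 - m)] only on
    histories where [dev] is small, while a moment bound has to hold after every history. Hence a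
    predicate [G] of good histories: the weights vanish outside [G], so the one-step bounds become
    unconditional, and almost every path, being eventually good, sees the true weights up to a
    constant fixed by finitely many steps. In the upper half vanishing weights do no harm. In the
    lower half they would destroy the moments of a block, so a bad step is replaced by the
    deterministic variance that it lacks. If [m * (1 - m) = 0], this tilting argument has nothing to
    work with, but then the limit is 0 and the lower bound is the upper bound for the opposite
    sign. *)

Section binary_process.
Variables (R : realType) (pi : seq bool -> R).

(* Histories are listed newest step first; [pi h] is the probability that the
   step following [h] is [true]. *)
Definition step_mean (f : seq bool -> R) (h : seq bool) : R :=
  pi h * f (true :: h) + (1 - pi h) * f (false :: h).

Definition mean (n : nat) : (seq bool -> R) -> seq bool -> R :=
  iter n step_mean.

(* A martingale transform: [c] is predictable, being evaluated before the step. *)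
Fixpoint lin_process (c : seq bool -> R) (h : seq bool) : R :=
  if h is x :: h' then lin_process c h' + c h' * (x%:R - pi h') else 0.

Fixpoint past_sum (d : seq bool -> R) (h : seq bool) : R :=
  if h is x :: h' then past_sum d h' + d h' else 0.

(** The suffixes of a history are its earlier states, so this says that [B] has held at some time up
    to now, time 0 included. *)
Fixpoint hit (B : pred (seq bool)) (h : seq bool) : bool :=
  B h || (if h is x :: h' then hit B h' else false).

(** Moment generating function of a Bernoulli variable of parameter [p] minus its mean. *)
Definition mgf (p l : R) : R := p * expR (l * (1 - p)) + (1 - p) * expR (- (l * p)).

Arguments mean : simpl never.

Lemma mgf0 p : mgf p 0 = 1.
Proof. by rewrite /mgf !mul0r oppr0 expR0; ring. Qed.

Lemma step_meanD f g h :
  step_mean (fun h => f h + g h) h = step_mean f h + step_mean g h.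
Proof. rewrite /step_mean; ring. Qed.

Lemma step_meanZ k f h : step_mean (fun h => k * f h) h = k * step_mean f h.
Proof. rewrite /step_mean; ring. Qed.

Lemma meanS n f h : mean n.+1 f h = step_mean (mean n f) h.
Proof. by []. Qed.

Lemma meanD n m f h : mean (n + m) f h = mean n (mean m f) h.
Proof. by rewrite /mean iterD. Qed.

Lemma mean_add n f g h :
  mean n (fun h => f h + g h) h = mean n f h + mean n g h.
Proof.
elim: n h => [//|n IH] h; rewrite !meanS -step_meanD.
by rewrite /step_mean !IH.
Qed.

Lemma meanZ n k f h : mean n (fun h => k * f h) h = k * mean n f h.
Proof.
elim: n h => [//|n IH] h; rewrite !meanS -step_meanZ.
by rewrite /step_mean !IH.
Qed.

Lemma mean_cst n k h : mean n (fun=> k) h = k.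
Proof.
elim: n h => [//|n IH] h; rewrite meanS /step_mean !IH; ring.
Qed.

Lemma step_mean_lin_sqr c h :
  step_mean (fun h => lin_process c h ^+ 2) h =
  lin_process c h ^+ 2 + c h ^+ 2 * (pi h * (1 - pi h)).
Proof. rewrite /step_mean /=; ring. Qed.

(** The exponential is multiplied, on average, by a factor known before the step. The upper half
    takes [e = -1] to compensate, the lower half a nonnegative [e] to stand in for bad steps. *)
Lemma step_mean_exp k e c d h :
  step_mean (fun h => expR (k * lin_process c h + e * past_sum d h)) h =
  expR (k * lin_process c h + e * past_sum d h) *
  (expR (e * d h) * mgf (pi h) (k * c h)).
Proof.
rewrite /step_mean /mgf /=.
set L := lin_process c h; set D := past_sum d h.
have -> : k * (L + c h * (1 - pi h)) + e * (D + d h) =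
  (k * L + e * D) + (e * d h + k * c h * (1 - pi h)) by ring.
have -> : k * (L + c h * (0 - pi h)) + e * (D + d h) =
  (k * L + e * D) + (e * d h - k * c h * pi h) by ring.
rewrite !(expRD (k * L + e * D)) !(expRD (e * d h)); ring.
Qed.

Hypothesis pi01 : forall h, 0 <= pi h <= 1.

Lemma step_mean_le f g h : (forall x, f (x :: h) <= g (x :: h)) ->
  step_mean f h <= step_mean g h.
Proof.
move=> fg; have /andP[p0 p1] := pi01 h.
by rewrite /step_mean lerD// ler_wpM2l// subr_ge0.
Qed.

Lemma mean_le n f g h : (forall t, size t = n -> f (t ++ h) <= g (t ++ h)) ->
  mean n f h <= mean n g h.
Proof.
elim: n h => [|n IH] h fg; first exact: (fg [::]).
rewrite !meanS; apply: step_mean_le => x; apply: IH => t st.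
by rewrite -cat_rcons; apply: fg; rewrite size_rcons st.
Qed.

Lemma mean_eq n f g h : (forall t, size t = n -> f (t ++ h) = g (t ++ h)) ->
  mean n f h = mean n g h.
Proof.
by move=> fg; apply/eqP; rewrite eq_le !mean_le// => t /fg ->.
Qed.

Lemma mean_prefixM n (k f : seq bool -> R) h :
  mean n (fun h' => k (drop n h') * f h') h = k h * mean n f h.
Proof.
rewrite -meanZ; apply: mean_eq => t st.
by rewrite drop_size_cat.
Qed.

(** The one-step factor sees only the length of the history, so the factors can be pulled out of the
    iterated mean one after the other. *)
Lemma mean_exp_le (u : nat -> R) N n f h : (forall h, 0 <= f h) ->
  (forall h, (N <= size h)%N -> step_mean f h <= expR (u (size h)) * f h) ->
  (N <= size h)%N ->
  mean n f h <= expR (\sum_(size h <= k < size h + n) u k) * f h.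
Proof.
move=> f0 fu; elim: n h => [|n IH] h Nh.
  by rewrite addn0 big_geq// expR0 mul1r.
rewrite meanS addnS big_ltn ?ltnS ?leq_addr// (addrC (u _)) expRD -mulrA.
apply: (@le_trans _ _ (step_mean (fun h' =>
  expR (\sum_((size h).+1 <= k < (size h + n).+1) u k) * f h') h)).
  by apply: step_mean_le => x; move: (IH (x :: h) (leqW Nh)); rewrite addSn.
by rewrite step_meanZ ler_wpM2l ?expR_ge0 ?fu.
Qed.

Lemma mean_exp_ge (u : nat -> R) N n f h : (forall h, 0 <= f h) ->
  (forall h, (N <= size h)%N -> expR (u (size h)) * f h <= step_mean f h) ->
  (N <= size h)%N ->
  expR (\sum_(size h <= k < size h + n) u k) * f h <= mean n f h.
Proof.
move=> f0 fu; elim: n h => [|n IH] h Nh.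
  by rewrite addn0 big_geq// expR0 mul1r.
rewrite meanS addnS big_ltn ?ltnS ?leq_addr// (addrC (u _)) expRD -mulrA.
apply: (@le_trans _ _ (step_mean (fun h' =>
  expR (\sum_((size h).+1 <= k < (size h + n).+1) u k) * f h') h)).
  by rewrite step_meanZ ler_wpM2l ?expR_ge0 ?fu.
by apply: step_mean_le => x; move: (IH (x :: h) (leqW Nh)); rewrite addSn.
Qed.

(* Ville's inequality: [f] frozen at the level [k] once it has reached it is
   still a supermartingale. *)
Lemma mean_hit_le f k n : 0 <= k -> (forall h, 0 <= f h) ->
  (forall h, step_mean f h <= f h) ->
  k * mean n (fun h => (hit (fun h => k <= f h) h)%:R) [::] <= f [::].
Proof.
move=> k0 f0 sf; rewrite -meanZ.
pose B := fun h => k <= f h.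
pose g h := if hit B h then k else f h.
apply: (@le_trans _ _ (mean n g [::])).
  apply: mean_le => t _; rewrite cats0 /g.
  by case: (hit B t); rewrite ?mulr1 ?mulr0.
have gg h : step_mean g h <= g h.
  rewrite {2}/g; case: ifP => hB.
    by rewrite (_ : step_mean g h = k)// /step_mean /g /= hB !orbT; ring.
  apply: le_trans (sf h); apply: step_mean_le => x.
  rewrite /g /= hB orbF.
  by case: ifP.
have gs j h : mean j g h <= g h.
  elim: j h => [//|j IH] h; rewrite meanS; apply: le_trans (gg h).
  exact: step_mean_le.
apply: (le_trans (gs n [::])).
by rewrite /g /= orbF; case: ifP.
Qed.

Lemma mean_lin_sqr n c :
  mean n (fun h => lin_process c h ^+ 2) [::] =
  \sum_(0 <= k < n) mean k (fun h => c h ^+ 2 * (pi h * (1 - pi h))) [::].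
Proof.
elim: n => [|n IH]; first by rewrite big_nil /mean /= expr0n.
rewrite big_nat_recr//= -IH -addn1 meanD -mean_add.
by apply: mean_eq => t _; rewrite /mean /= step_mean_lin_sqr.
Qed.

Lemma lin_processZ k c h :
  lin_process (fun h => k * c h) h = k * lin_process c h.
Proof. elim: h => [|x h IH] /=; rewrite ?mulr0// IH; ring. Qed.

Lemma past_sumE (w : nat -> R) h :
  past_sum (fun h => w (size h)) h = \sum_(0 <= k < size h) w k.
Proof.
elim: h => [|x h IH] /=; first by rewrite big_nil.
by rewrite IH big_nat_recr.
Qed.

(** The exponential of the compensated transform is a supermartingale started at 1, so Ville's
    inequality applies at level [expR x]. The compensator is deterministic because [b] sees only the
    length. *)
Lemma maximal_tail (c : seq bool -> R) (b : nat -> R) x n :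
  (forall h, mgf (pi h) (c h) <= expR (b (size h))) ->
  mean n (fun h => (hit (fun h =>
    x <= lin_process c h - \sum_(0 <= k < size h) b k) h)%:R) [::] <= expR (- x).
Proof.
move=> cb.
pose f h := expR (1 * lin_process c h + (-1) * past_sum (fun h => b (size h)) h).
have sf h : step_mean f h <= f h.
  rewrite step_mean_exp ler_piMr ?expR_ge0// !mul1r mulN1r expRN.
  by rewrite mulrC ler_pdivrMr ?expR_gt0 ?mul1r.
have := @mean_hit_le f (expR x) n (expR_ge0 _) (fun h => expR_ge0 _) sf.
rewrite {2}/f /= !mulr0 addr0 expR0 mulrC -ler_pdivlMr ?expR_gt0//.
rewrite div1r -expRN; apply: le_trans; apply: mean_le => t _.
rewrite ler_nat; set A := hit _ _; set B := hit _ _.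
suff -> : A = B by [].
rewrite /A /B; elim: (t ++ [::]) => [|y h IH] /=.
  by rewrite /f !orbF ler_expR/= !mulr0 addr0 big_nil subr0.
rewrite IH /f ler_expR past_sumE mul1r mulN1r; congr (_ || _).
Qed.

End binary_process.

Arguments mean : simpl never.

(** * The law of a binary process *)

Section history.
Context (R : realType) (d : measure_display) (T : measurableType d)
  (P : probability T R) (X : nat -> {RV P >-> bool}).

Fixpoint hist (n : nat) (w : T) : seq bool :=
  if n is n'.+1 then X n w :: hist n' w else [::].

Lemma size_hist n w : size (hist n w) = n.
Proof. by elim: n => //= n ->. Qed.

Lemma drop_hist j n w : drop j (hist (j + n) w) = hist n w.
Proof. by elim: j => [|j IH] /=; rewrite ?drop0. Qed.

Lemma nth_hist n k w : (1 <= k <= n)%N -> nth false (hist n w) (n - k) = X k w.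
Proof.
elim: n => [|n IH] /andP[k1 kn]; first by case: k k1 kn.
move: kn; rewrite leq_eqVlt => /orP[/eqP ->|kn]; first by rewrite subnn.
by rewrite subSn//= IH// k1.
Qed.

Lemma count_hist n w : (count id (hist n w))%:R = position X n w :> R.
Proof.
rewrite /position; elim: n => [|n IH]; first by rewrite big_geq.
by rewrite big_nat_recr//= natrD IH addrC.
Qed.

Lemma measurable_step n b : measurable [set w | X n w = b].
Proof. by have := measurable_funPTI (X n) (Y := [set b]) I. Qed.

Lemma hist_split n (B : pred (seq bool)) :
  [set w | B (hist n.+1 w)] =
  ([set w | X n.+1 w = true] `&` [set w | B (true :: hist n w)]) `|`
  ([set w | X n.+1 w = false] `&` [set w | B (false :: hist n w)]).
Proof.
apply/seteqP; split => w /=; first by case: (X n.+1 w) => ?; [left|right].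
by case=> -[->].
Qed.

Lemma measurable_hist n (B : pred (seq bool)) : measurable [set w | B (hist n w)].
Proof.
elim: n B => [|n IH] B.
  have [BN|BN] := boolP (B [::]).
    by rewrite (_ : [set _ | _] = setT)//; apply/seteqP; split.
  by rewrite (_ : [set _ | _] = set0)//; apply/seteqP; split => w //=; exact/negP.
rewrite hist_split; apply: measurableU; apply: measurableI;
  by [exact: measurable_step | exact: (IH (fun h => B (_ :: h)))].
Qed.

Lemma measurable_hist_eq n x : measurable [set w | hist n w = x].
Proof.
rewrite (_ : [set _ | _] = [set w | pred1 x (hist n w)]).
  exact: measurable_hist.
by apply/seteqP; split => w /= /eqP.
Qed.

Fixpoint all_histories (n : nat) : seq (seq bool) :=
  if n is n'.+1 then [seq true :: x | x <- all_histories n'] ++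
                     [seq false :: x | x <- all_histories n'] else [:: [::]].

Lemma size_all_histories n x : x \in all_histories n -> size x = n.
Proof.
elim: n x => [|n IH] x /=; first by rewrite inE => /eqP ->.
by rewrite mem_cat => /orP[] /mapP[y /IH <- ->].
Qed.

Lemma probability_histories A n : measurable A ->
  (P A = \sum_(x <- all_histories n) P (A `&` [set w | hist n w = x]))%E.
Proof.
move=> mA; elim: n => [|n IH].
  by rewrite /= big_seq1 (_ : [set w | [::] = [::]] = setT) ?setIT//; apply/seteqP; split.
rewrite /= big_cat/= !big_map -big_split/= IH; apply: eq_bigr => x _.
rewrite (measureDI P (B := [set w | X n.+1 w = true])).
- rewrite addrC; congr (P _ + P _)%E; apply/seteqP; split => w /=.
  + by move=> [[Aw <-]]; case: (X n.+1 w).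
  + by move=> [Aw [-> ->]].
  + by move=> [[Aw <-] ->].
  + by move=> [Aw [-> ->]].
- by apply: measurableI => //; exact: measurable_hist_eq.
- exact: measurable_step.
Qed.

Variable pi : seq bool -> R.

(** A product instead of a quotient, so that histories of probability zero impose nothing. *)
Definition transition_law := forall x,
  P ([set w | X (size x).+1 w = true] `&` [set w | hist (size x) w = x]) =
  ((pi x)%:E * P [set w | hist (size x) w = x])%E.

Hypothesis law : transition_law.

Fixpoint weight (x : seq bool) : R :=
  if x is b :: x' then weight x' * (if b then pi x' else 1 - pi x') else 1.

Lemma probability_hist_eq x : P [set w | hist (size x) w = x] = (weight x)%:E.
Proof.
elim: x => [|b x IH] /=.
  rewrite (_ : [set w | [::] = [::]] = setT) ?probability_setT//.
  by apply/seteqP; split.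
have Ptrue : P ([set w | hist (size x) w = x] `&` [set w | X (size x).+1 w = true])
    = (weight x * pi x)%:E.
  by rewrite setIC law IH -EFinM mulrC.
case: b.
  rewrite -Ptrue; congr (P _); apply/seteqP; split => w /=.
    by move=> [-> ->].
  by move=> [-> ->].
rewrite (_ : [set _ | _] =
    [set w | hist (size x) w = x] `\` [set w | X (size x).+1 w = true]).
  have PA : (P [set w | hist (size x) w = x] < +oo)%E by rewrite IH ltry.
  have := measureD (measurable_hist_eq (size x) x) (measurable_step (size x).+1 true) PA.
  move=> ->; rewrite [X in (_ - X)%E]Ptrue [X in (X - _)%E]IH.
  by rewrite -EFinB mulrBr mulr1.
apply/seteqP; split => w /=.
  by move=> [-> ->].
by move=> [->]; case: (X _ w).
Qed.

Lemma mean_histories n f :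
  mean pi n f [::] = \sum_(x <- all_histories n) weight x * f x.
Proof.
elim: n f => [|n IH] f.
  by rewrite /= big_seq1 mul1r.
rewrite -addn1 meanD IH/= addn1/= big_cat/= !big_map -big_split/=.
by apply: eq_bigr => x _; rewrite /mean /= /step_mean; ring.
Qed.

(** An event settled by the first [n] steps is a finite union of history atoms. Through this bridge
    probabilities become iterated means. *)
Lemma probability_hist n (B : pred (seq bool)) :
  P [set w | B (hist n w)] = (mean pi n (fun h => (B h)%:R) [::])%:E.
Proof.
rewrite (probability_histories n (measurable_hist n B)) mean_histories -sumEFin.
apply: eq_big_seq => x /size_all_histories sx.
have [Bx|Bx] := boolP (B x).
  rewrite mulr1 -probability_hist_eq sx; congr (P _).
  by apply/seteqP; split => w /=; [case|move=> ->].
rewrite mulr0 (_ : _ `&` _ = set0) ?measure0//.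
by apply/seteqP; split => w //= -[+ hx]; rewrite hx; exact/negP.
Qed.

Lemma first_borel_cantelli (n : nat -> nat) (B : nat -> pred (seq bool)) k0 C :
  (forall K, \sum_(k0 <= k < K) mean pi (n k) (fun h => (B k h)%:R) [::] <= C) ->
  {ae P, forall w, \forall k \near \oo, ~~ B k (hist (n k) w)}.
Proof.
move=> sC.
(* Emptying the events before [k0] lets the whole series be bounded by [C]. *)
pose F k := [set w | ((k0 <= k)%N && B k (hist (n k) w))].
have mF k : measurable (F k).
  exact: (measurable_hist (n k) (fun h => (k0 <= k)%N && B k h)).
have null : P (lim_sup_set F) = 0%E.
  apply: lim_sup_set_cvg0 => //; apply: (@le_lt_trans _ _ C%:E); last exact: ltry.
  apply: lime_le; first exact: is_cvg_nneseries.
  apply: nearW => K; rewrite (@le_trans _ _ (\sum_(0 <= k < K)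
      ((k0 <= k)%:R * mean pi (n k) (fun h => (B k h)%:R) [::])%:E)%E)//.
    apply: lee_sum => k _; rewrite /F; case: leqP => k0k.
      by rewrite mul1r [leLHS](probability_hist (n k) (B k)).
    by rewrite (_ : [set _ | _] = set0) ?measure0 ?mul0r//; apply/seteqP; split.
  rewrite sumEFin lee_fin; apply: le_trans (sC K).
  rewrite [leLHS](_ : _ = \sum_(0 <= k < K | (k0 <= k)%N)
      mean pi (n k) (fun h => (B k h)%:R) [::]); last first.
    by rewrite [RHS]big_mkcond; apply: eq_bigr => k _; case: leqP; rewrite ?mul1r ?mul0r.
  rewrite [leRHS](big_nat_widenl k0 0)//.
exists (lim_sup_set F); split => //.
  by apply: bigcap_measurable => // j _; apply: bigcup_measurable.
move=> w /= nB j _; apply: contrapT => nF; apply: nB.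
exists (maxn j k0) => // k /=; rewrite geq_max => /andP[jk k0k].
by apply/negP => Bk; apply: nF; exists k => //; rewrite /F /= k0k.
Qed.

Hypothesis pi01 : forall h, 0 <= pi h <= 1.

(** Peel off the last block: it succeeds with mean at least [p K] whatever came before, and this
    uniformity replaces independence. As the newest step comes first, [drop (n K - n k.+1)] restores
    the history at the end of block [k]. *)
Lemma mean_none_le (n : nat -> nat) (B : nat -> pred (seq bool)) (p : nat -> R) k1 K :
  {homo n : i j / (i <= j)%N} -> (k1 <= K)%N ->
  (forall k h, (k1 <= k)%N -> size h = n k ->
     p k <= mean pi (n k.+1 - n k) (fun h => (B k h)%:R) h) ->
  mean pi (n K) (fun h => (all (fun k => ~~ B k (drop (n K - n k.+1) h))
    (index_iota k1 K))%:R) [::] <= \prod_(k1 <= k < K) (1 - p k).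
Proof.
move=> nm + Bp; elim: K => [|K IH].
  by rewrite leqn0 => /eqP ->; rewrite big_geq//= mean_cst.
rewrite leq_eqVlt => /orP[/eqP <-|k1K].
  rewrite big_geq// /index_iota subnn/=.
  by rewrite (mean_cst pi (n k1) 1 [::]).
rewrite big_nat_recr//= -[X in mean pi X]( subnKC (nm _ _ (leqnSn K))) meanD.
set j := (n K.+1 - n K)%N.
(* [p K] is at most the mean of an indicator; the all-false history is just some history of the
   right length. *)
have p1 : 0 <= 1 - p K.
  have := Bp K (nseq (n K) false) k1K (size_nseq _ _).
  rewrite subr_ge0 => /le_trans; apply.
  rewrite -[leRHS](mean_cst pi (n K.+1 - n K) 1 (nseq (n K) false)).
  by apply: mean_le => // t _; case: (B _ _); rewrite ?lexx ?ler01.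
apply: (@le_trans _ _ ((1 - p K) * mean pi (n K) (fun h => (all (fun k =>
   ~~ B k (drop (n K - n k.+1) h)) (index_iota k1 K))%:R) [::])); last first.
  by rewrite [leRHS]mulrC; apply: ler_wpM2l => //; exact: IH.
rewrite -meanZ; apply: mean_le => // h; rewrite cats0 => sh.
rewrite mulrC.
have -> : mean pi j (fun h => (all (fun k => ~~ B k (drop (n K.+1 - n k.+1) h))
    (index_iota k1 K.+1))%:R) h =
  mean pi j (fun h' => (all (fun k => ~~ B k (drop (n K - n k.+1) (drop j h')))
    (index_iota k1 K))%:R * (1 - (B K h')%:R)) h.
  apply: mean_eq => // t st.
  have -> : index_iota k1 K.+1 = index_iota k1 K ++ [:: K].
    by rewrite /index_iota subSn// -addn1 iotaD/= subnKC.
  rewrite all_cat/= andbT.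
  rewrite subnn drop0 (eq_in_all (a2 := fun k => ~~ B k (drop (n K - n k.+1) (drop j (t ++ h))))).
    by case: (all _ _); case: (B _ _); rewrite /= ?subrr ?subr0 ?mulr0 ?mulr1.
  move=> k; rewrite mem_index_iota => /andP[_ kK].
  by rewrite drop_drop addnC addnBA ?nm// subnK// nm.
rewrite (mean_prefixM pi01 j (fun h => (all (fun k => ~~ B k (drop (n K - n k.+1) h))
    (index_iota k1 K))%:R)).
rewrite ler_wpM2l//.
have -> : (fun h' => 1 - (B K h')%:R) = (fun h' => 1 + (-1) * (B K h')%:R :> R).
  by apply/funext => h'; rewrite mulN1r.
rewrite mean_add meanZ mean_cst mulN1r lerB//.
exact: Bp.
Qed.

Lemma second_borel_cantelli (n : nat -> nat) (B : nat -> pred (seq bool)) (p : nat -> R) k0 :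
  {homo n : i j / (i <= j)%N} ->
  (forall k h, (k0 <= k)%N -> size h = n k ->
     p k <= mean pi (n k.+1 - n k) (fun h => (B k h)%:R) h) ->
  (forall k1 e, (k0 <= k1)%N -> 0 < e ->
     exists2 K, (k1 <= K)%N & \prod_(k1 <= k < K) (1 - p k) <= e) ->
  {ae P, forall w, forall N, exists2 k, (N <= k)%N & B k (hist (n k.+1) w)}.
Proof.
move=> nm Bp pp; apply: ae_foralln => N.
pose k1 := maxn N k0.
pose none K h := all (fun k => ~~ B k (drop (n K - n k.+1) h)) (index_iota k1 K).
pose F := \bigcap_K [set w | none K (hist (n K) w)].
have mF : measurable F by apply: bigcap_measurable => // K _; exact: measurable_hist.
exists F; split => //.
  apply/eqP; rewrite eq_le measure_ge0 andbT; apply/lee_addgt0Pr => e e0.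
  rewrite add0e; have [K k1K Ke] := pp k1 e (leq_maxr _ _) e0.
  apply: le_trans (_ : (P [set w | none K (hist (n K) w)] <= _)%E).
    by apply: le_measure; rewrite ?inE//; [exact: measurable_hist|move=> w /(_ K I)].
  rewrite [leLHS](probability_hist (n K) (none K)) lee_fin; apply: le_trans Ke; apply: mean_none_le => //.
  by move=> k h k1k; apply: Bp; rewrite (leq_trans _ k1k)// leq_maxr.
move=> w /= nB K _; apply/allP => k; rewrite mem_index_iota => /andP[k1k kK].
apply/negP => Bk; apply: nB; exists k; first by rewrite (leq_trans _ k1k)// leq_maxl.
suff <- : drop (n K - n k.+1) (hist (n K) w) = hist (n k.+1) w by [].
by rewrite -[in hist (n K)](subnK (nm _ _ kK)) drop_hist.
Qed.

End history.

(** * The minimal random walk as a binary process *)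

Definition dev (R : realType) (m : R) (h : seq bool) : R :=
  (count id h)%:R - m * (size h)%:R.

(** After [c] successes in [n] steps the walk succeeds with probability [q + a * c / n]; centring at
    the fixed point [m = q + a * m] gives this form. The first step has its own law, unrelated to
    [m]. *)
Definition succ_pr (R : realType) (a m s : R) (h : seq bool) : R :=
  if h is [::] then s else m + a * dev m h / (size h)%:R.

Section transition.
Context (R : realType) (d : measure_display) (T : measurableType d)
  (P : probability T R).

Lemma bernoulli_true (p : R) : 0 <= p <= 1 -> bernoulli_prob p [set true] = p%:E.
Proof. by move=> p01; rewrite /bernoulli_prob p01 fsbig_set1/= /bernoulli_pmf. Qed.

Lemma mutually_independent2 (G1 G2 : set (set T)) A1 A2 :
  mutually_independent P [:: G1; G2] -> G1 A1 -> G2 A2 ->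
  (P (A1 `&` A2) = P A1 * P A2)%E.
Proof.
move=> ind GA1 GA2.
pose A (i : 'I_2) := if (i == ord0) then A1 else A2.
have := ind [set: 'I_2]%SET A.
rewrite big_mkcond/= !big_ord_recl big_ord0 !inE /= mule1.
rewrite (_ : \bigcap_(i in _) A i = A1 `&` A2).
  apply=> i _; rewrite /A.
  by case: i => -[|[|//]] i2 /=.
apply/seteqP; split => w /=.
  by move=> Aw; split; [apply: (Aw ord0)|apply: (Aw (lift ord0 ord0))]; rewrite /= inE.
by move=> [A1w A2w] i _; rewrite /A; case: ifP.
Qed.

Lemma mutually_independent3 (G1 G2 G3 : set (set T)) A1 A2 A3 :
  mutually_independent P [:: G1; G2; G3] -> G1 A1 -> G2 A2 -> G3 A3 ->
  (P (A1 `&` A2 `&` A3) = P A1 * P A2 * P A3)%E.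
Proof.
move=> ind GA1 GA2 GA3.
pose A (i : 'I_3) := nth set0 [:: A1; A2; A3] i.
have := ind [set: 'I_3]%SET A.
rewrite big_mkcond/= !big_ord_recl big_ord0 !inE /= mule1 muleA.
rewrite (_ : \bigcap_(i in _) A i = A1 `&` A2 `&` A3).
  apply=> i _; rewrite /A.
  by case: i => -[|[|[|//]]] i2 /=.
apply/seteqP; split => w /=.
  move=> Aw; split; first split; [apply: (Aw ord0)|apply: (Aw (lift ord0 ord0))|
    apply: (Aw (lift ord0 (lift ord0 ord0)))]; by rewrite /= inE.
by move=> [[A1w A2w] A3w] [[|[|[|//]]] i2] _.
Qed.

Lemma sigma_rvP d' (T' : measurableType d') (Y : T -> T') (B : set T') :
  measurable B -> sigma_rv Y (Y @^-1` B).
Proof. by move=> mB; exists B; rewrite ?setTI. Qed.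

Lemma probability_preimages (V : {RV P >-> nat}) (B : set T) n : measurable B ->
  (P (B `&` [set w | (V w < n)%N]) = \sum_(0 <= k < n) P (B `&` [set w | V w = k]))%E.
Proof.
move=> mB; elim: n => [|n IH].
  rewrite big_geq// (_ : _ `&` _ = set0) ?measure0//.
  by apply/seteqP; split => w // [].
rewrite big_nat_recr//= -IH -measureU.
- congr (P _); apply/seteqP; split => w /=.
    move=> [Bw]; rewrite ltnS leq_eqVlt => /orP[/eqP|]; by [right|left].
  by move=> [[Bw Vw]|[Bw ->]]; split => //; rewrite ltnS ltnW.
- apply: measurableI => //.
  by have := measurable_funPTI V (Y := [set k | (k < n)%N]) I.
- apply: measurableI => //.
  by have := measurable_funPTI V (Y := [set n]) I.
- by apply/seteqP; split => w //= [[_ Vn] [_ Vw]]; rewrite Vw ltnn in Vn.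
Qed.

Lemma sum_nth_rev (F : bool -> R) (x : seq bool) :
  \sum_(1 <= k < (size x).+1) F (nth false x (size x - k)) = \sum_(b <- x) F b.
Proof.
elim: x => [|b x IH]; first by rewrite big_geq// big_nil.
rewrite [RHS]big_cons -IH /= big_nat_recr//= subnn addrC; congr (_ + _).
apply: eq_big_nat => k /andP[_ kx].
by rewrite subSn.
Qed.

Lemma sum_bool (u v : R) (x : seq bool) :
  \sum_(b <- x) (if b then u else v) =
  (count id x)%:R * u + ((size x)%:R - (count id x)%:R) * v.
Proof.
elim: x => [|b x IH]; first by rewrite big_nil /=; ring.
by rewrite big_cons IH /= -[in (size x).+1%:R]addn1 !natrD; case: b => /=; ring.
Qed.

Variables (p q s : R) (X alpha beta : nat -> {RV P >-> bool}) (U : nat -> {RV P >-> nat}).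
Hypotheses (hp : 0 <= p <= 1) (hq : 0 <= q <= 1) (hs : 0 <= s <= 1) (a_lt1 : p - q < 1).
Hypothesis hX : minimal_random_walk p q s X alpha beta U.

Lemma hist_past n x : (1 <= n)%N ->
  (<<s \bigcup_(k in [set k | (1 <= k <= n)%N]) sigma_rv (X k) >>) [set w | hist X n w = x].
Proof.
move=> n1; set G := \bigcup_(k in _) _.
suff H j : (j <= n)%N -> forall x, @measurable _ (g_sigma_algebraType G) [set w | hist X j w = x].
  exact: H.
elim: j => [|j IH] jn [|b y].
- by rewrite (_ : [set w | _] = setT) //; apply/seteqP; split.
- by rewrite (_ : [set w | _] = set0) //; apply/seteqP; split.
- by rewrite (_ : [set w | _] = set0) //; apply/seteqP; split.
rewrite (_ : [set w | _] = (X j.+1) @^-1` [set b] `&` [set w | hist X j w = y]).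
  apply: (@measurableI _ (g_sigma_algebraType G)); last exact: IH (ltnW jn) _.
  by apply: sub_gen_smallest; exists j.+1 => //; exact: sigma_rvP.
apply/seteqP; split => w /=; first by case=> -> ->.
by move=> [-> ->].
Qed.

Lemma mrw_X_step n w : (1 <= n)%N ->
  X n.+1 w = if X (U n w) w then alpha n.+1 w else beta n.+1 w.
Proof.
move=> n1; have := mrw_step hX w n1.
case: (X (U n w) w); case: (alpha n.+1 w); case: (beta n.+1 w); case: (X n.+1 w) => //=;
  rewrite ?(mulr1, mulr0, mul1r, mul0r, subr0, subrr, addr0, add0r) => /eqP;
  by rewrite ?oner_eq0// eq_sym oner_eq0.
Qed.

Let distr_set1 (Y : {RV P >-> bool}) r : 0 <= r <= 1 ->
  distribution P Y =1 bernoulli_prob r -> P (Y @^-1` [set true]) = r%:E.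
Proof. by move=> r01 /(_ [set true]); rewrite bernoulli_true. Qed.

Lemma probability_choice n k (b : bool) : (1 <= k <= n)%N ->
  P ((if b then alpha n.+1 else beta n.+1) @^-1` [set true] `&` U n @^-1` [set k]) =
  ((if b then p else q) / n%:R)%:E.
Proof.
move=> kn; have n1 : (1 <= n)%N by case/andP: kn; exact: leq_trans.
have PU : P (U n @^-1` [set k]) = (n%:R^-1)%:E.
  by have := mrw_U hX n1 k; rewrite kn.
have ind := mrw_indep hX n1.
have sT (Y : {RV P >-> bool}) : sigma_rv Y setT.
  by have := sigma_rvP Y (@measurableT _ bool).
case: b.
- have := mutually_independent3 ind (sigma_rvP (alpha n.+1) (B := [set true]) I)
    (sT (beta n.+1)) (sigma_rvP (U n) (B := [set k]) I).
  rewrite setIT => ->; rewrite probability_setT mule1 PU.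
  by rewrite (distr_set1 hp (mrw_alpha hX n1)).
- have := mutually_independent3 ind (sT (alpha n.+1))
    (sigma_rvP (beta n.+1) (B := [set true]) I) (sigma_rvP (U n) (B := [set k]) I).
  rewrite setTI => ->; rewrite probability_setT mul1e PU.
  by rewrite (distr_set1 hq (mrw_beta hX n1)).
Qed.

Lemma probability_U_range n : (1 <= n)%N -> P [set w | (U n w < n.+1)%N] = 1%E.
Proof.
move=> n1; have := probability_preimages (U n) n.+1 measurableT.
rewrite setTI => ->.
under eq_bigr => k _ do rewrite setTI.
rewrite big_ltn// [X in (X + _)%E](_ : _ = 0%E) ?add0e; last first.
  by have := mrw_U hX n1 0%N.
rewrite (eq_big_nat _ _ (F2 := fun=> (n%:R^-1)%:E)); last first.
  by move=> k kn; have := mrw_U hX n1 k; rewrite -ltnS kn.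
rewrite sumEFin sumr_const_nat subSS subn0 -[n%:R^-1 *+ n]mulr_natr mulVf//.
by rewrite pnatr_eq0 -lt0n.
Qed.

(** Split according to the value of [U n]. Once the history is known, the recalled step is a letter
    of it, and this letter chooses between [alpha] and [beta], which are independent of the past.
    Summing over positions then only counts successes. *)
Lemma mrw_transition_law :
  transition_law X (succ_pr (p - q) (q / (1 - (p - q))) s).
Proof.
move=> x; case: (ltnP 0 (size x)) => [x0|]; last first.
  rewrite leqn0 size_eq0 => /eqP -> /=.
  rewrite (_ : [set w | [::] = [::]] = setT) ?setIT ?probability_setT ?mule1.
    by have := distr_set1 hs (mrw_X1 hX).
  by apply/seteqP; split.
set n := size x in x0 *; set A := [set w | hist X n w = x].
set B := [set w | X n.+1 w = true].
have mA : measurable A by exact: measurable_hist_eq.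
have mB : measurable B by exact: measurable_step.
have mU : measurable [set w | (U n w < n.+1)%N].
  by have := measurable_funPTI (U n) (Y := [set k | (k < n.+1)%N]) I.
(* [U n] is in range only almost surely: discard the null event where it exceeds [n], and below the
   one where it is 0. *)
have -> : P (B `&` A) = P (B `&` A `&` [set w | (U n w < n.+1)%N]).
  have PU0 : P (~` [set w | (U n w < n.+1)%N]) = 0%E.
    by rewrite probability_setC// probability_U_range// subee.
  rewrite (measureDI P (measurableI _ _ mB mA) mU) [X in (X + _)%E](_ : _ = 0%E) ?add0e//.
  apply: (subset_measure0 _ _ _ PU0).
  - by apply: measurableD => //; exact: measurableI.
  - exact: measurableC.
  - by move=> w [].
rewrite probability_preimages; last exact: measurableI.
rewrite big_ltn// [X in (X + _)%E](_ : _ = 0%E) ?add0e; last first.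
  apply: (@subset_measure0 _ _ _ P _ (U n @^-1` [set 0%N])).
  - apply: measurableI; first exact: measurableI.
    by have := measurable_funPTI (U n) (Y := [set 0%N]) I.
  - exact: (measurable_funPTI (U n) I).
  - by move=> w [].
  - by have := mrw_U hX x0 0%N.
have PA : P A \is a fin_num by exact: fin_num_measure.
rewrite -(fineK PA).
rewrite (eq_big_nat _ _ (F2 := fun k => ((if nth false x (n - k) then p else q) / n%:R
    * fine (P A))%:E)); last first.
  move=> k; rewrite ltnS => kn.
  rewrite EFinM (fineK PA) -(probability_choice (nth false x (n - k)) kn).
  (* Given the history [x] and [U n w = k], a letter of [x] decides between [alpha] and [beta], so
     the event is the intersection of an event of the new variables with one of the past. *)
  rewrite -(mutually_independent2 (mrw_indep_past hX x0)); last 2 first.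
  - set G := _ `|` _ `|` _.
    apply: (@measurableI _ (g_sigma_algebraType G)); apply: sub_gen_smallest.
      by case: (nth _ _ _); left; [left|right]; exact: sigma_rvP.
    by right; exact: sigma_rvP.
  - exact: hist_past.
  congr (P _); apply/seteqP; split => w /=.
    move=> [[Bw Aw] Uk]; split => //; split => //.
    move: Bw; rewrite /B/= mrw_X_step// Uk -(nth_hist X w kn) Aw.
    by case: (nth _ _ _).
  move=> [[ab Uk] Aw]; split => //; split => //.
  rewrite /B/= mrw_X_step// Uk -(nth_hist X w kn) Aw.
  by move: ab; case: (nth _ _ _).
rewrite sumEFin -EFinM -mulr_suml; congr (_ * _)%:E.
rewrite -mulr_suml (sum_nth_rev (fun b => if b then p else q)) sum_bool.
have -> : succ_pr (p - q) (q / (1 - (p - q))) s x = q / (1 - (p - q)) +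
    (p - q) * dev (q / (1 - (p - q))) x / (size x)%:R by move: x0; rewrite /n; case: (x).
rewrite /dev -/n.
have n0 : n%:R != 0 :> R by rewrite pnatr_eq0 -lt0n.
have a1 : 1 - (p - q) != 0 by rewrite subr_eq0 eq_sym lt_eqF.
field; rewrite n0/=; apply/eqP => H; move/eqP: a1; apply; rewrite -H; ring.
Qed.

End transition.

(** * Moment generating function of a centred Bernoulli variable *)

Section mgf_bounds.
Variable R : realType.
Implicit Types x y p l m e : R.

Lemma ge0_derive_le (f df : R -> R) a b : a <= b ->
  (forall x, is_derive x 1 f (df x)) -> (forall x, a <= x <= b -> 0 <= df x) ->
  f a <= f b.
Proof.
rewrite le_eqVlt => /orP[/eqP ->//|ab] fd df0.
have [|c cab fE] := MVT ab (fun x _ => fd x).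
  apply: derivable_within_continuous => x _; exact: (@ex_derive _ _ _ _ _ _ _ (fd x)).
rewrite -subr_ge0 fE; apply: mulr_ge0; last by rewrite subr_ge0 ltW.
by apply: df0; move: cab; rewrite in_itv/= => /andP[/ltW -> /ltW ->].
Qed.

Let q2 : {poly R} := 1 + 'X + 2^-1 *: 'X^2.
(** The cubic coefficient 1, instead of 1/6, leaves room for the whole remainder on [-1, 1]. *)
Let q3 : {poly R} := 1 + 'X + 2^-1 *: 'X^2 + 'X^3.

Let q2E x : q2.[x] = 1 + x + x ^+ 2 / 2.
Proof. by rewrite /q2 !hornerE /=; ring. Qed.
Let q3E x : q3.[x] = 1 + x + x ^+ 2 / 2 + x ^+ 3.
Proof. by rewrite /q3 !hornerE /=; ring. Qed.

Let dq2 x : is_derive x 1 (expR - horner q2) (expR x - (1 + x)).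
Proof.
apply: is_derive_eq; congr (_ - _).
by rewrite /q2 -polyC1 !poly.derivE !hornerE /=; lra.
Qed.

Let dq3 x : is_derive x 1 (horner q3 - expR) (1 + x + 3 * x ^+ 2 - expR x).
Proof.
apply: is_derive_eq; congr (_ - _).
by rewrite /q3 -polyC1 !poly.derivE !hornerE /=; lra.
Qed.

Let dq2_ge0 x : 0 <= expR x - (1 + x).
Proof. by rewrite subr_ge0 expR_ge1Dx. Qed.

(** The difference to the Taylor polynomial is nondecreasing and vanishes at 0, so the two sides of
    0 give opposite inequalities. *)
Lemma expR_ge_taylor2 x : 0 <= x -> 1 + x + x ^+ 2 / 2 <= expR x.
Proof.
move=> x0; have := ge0_derive_le x0 dq2 (fun x _ => dq2_ge0 x).
by rewrite !fctE !q2E expR0; lra.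
Qed.

Lemma expR_le_taylor2 x : x <= 0 -> expR x <= 1 + x + x ^+ 2 / 2.
Proof.
move=> x0; have := ge0_derive_le x0 dq2 (fun x _ => dq2_ge0 x).
by rewrite !fctE !q2E expR0; lra.
Qed.

Let dq3_ge0 x : -1 <= x <= 1 -> 0 <= 1 + x + 3 * x ^+ 2 - expR x.
Proof.
move=> /andP[xm x1]; case: (lerP x 0) => x0.
  by have := expR_le_taylor2 x0; have := sqr_ge0 x; lra.
(* For [0 < x <= 1] this bounds [expR x] by the inverse square of [1 - x / 2], and a polynomial
   inequality is left. *)
have h : 1 - x / 2 <= expR (- (x / 2)) by exact: expR_ge1Dx.
have h2 : expR x * (1 - x / 2) ^+ 2 <= 1.
  rewrite -[leRHS](expRxMexpNx_1 x) ler_wpM2l ?expR_ge0//.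
  rewrite (_ : - x = - (x / 2) + - (x / 2)); last by field.
  by rewrite expRD -expr2 lerXn2r// ?nnegrE ?expR_ge0//; lra.
rewrite subr_ge0 -(ler_pM2r (_ : 0 < (1 - x / 2) ^+ 2)); last by apply: exprn_gt0; lra.
apply: (le_trans h2); nra.
Qed.

Lemma expR_le_taylor3 x : 0 <= x <= 1 -> expR x <= 1 + x + x ^+ 2 / 2 + x ^+ 3.
Proof.
move=> /andP[x0 x1].
have := @ge0_derive_le _ _ _ _ x0 dq3.
rewrite !fctE !q3E expR0 => H.
have /H : forall y, 0 <= y <= x -> 0 <= 1 + y + 3 * y ^+ 2 - expR y.
  by move=> y yx; apply: dq3_ge0; lra.
lra.
Qed.

Lemma expR_ge_taylor3 x : -1 <= x <= 0 -> 1 + x + x ^+ 2 / 2 + x ^+ 3 <= expR x.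
Proof.
move=> /andP[x0 x1].
have := @ge0_derive_le _ _ _ _ x1 dq3.
rewrite !fctE !q3E expR0 => H.
have /H : forall y, x <= y <= 0 -> 0 <= 1 + y + 3 * y ^+ 2 - expR y.
  by move=> y yx; apply: dq3_ge0; lra.
lra.
Qed.

Lemma expR_taylor2 x : `|x| <= 1 -> `|expR x - (1 + x + x ^+ 2 / 2)| <= `|x| ^+ 3.
Proof.
case: (lerP 0 x) => x0.
  rewrite (ger0_norm x0) => x1; have := expR_ge_taylor2 x0.
  have /expR_le_taylor3 : 0 <= x <= 1 by rewrite x0.
  by rewrite ler_norml => *; apply/andP; split; lra.
rewrite (ltr0_norm x0) => x1; have := expR_le_taylor2 (ltW x0).
have /expR_ge_taylor3 : -1 <= x <= 0 by apply/andP; split; lra.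
have -> : (- x) ^+ 3 = - x ^+ 3 by ring.
by rewrite ler_norml => *; apply/andP; split; lra.
Qed.

(** The linear terms cancel by centring. The factor [p * (1 - p)] kept in the error makes it a
    relative error on the variance, harmless however small the variance is. *)
Lemma mgf_taylor p l : 0 <= p <= 1 -> `|l| <= 1 ->
  `|mgf p l - (1 + l ^+ 2 * (p * (1 - p)) / 2)| <= `|l| ^+ 3 * (p * (1 - p)).
Proof.
move=> /andP[p0 p1] l1; have q0 : 0 <= 1 - p by rewrite subr_ge0.
have xl : `|l * (1 - p)| = `|l| * (1 - p) by rewrite normrM (ger0_norm q0).
have yl : `|- (l * p)| = `|l| * p by rewrite normrN normrM (ger0_norm p0).
have l0 := normr_ge0 l.
have x1 : `|l * (1 - p)| <= 1 by rewrite xl mulr_ile1//; lra.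
have y1 : `|- (l * p)| <= 1 by rewrite yl mulr_ile1//; lra.
have := expR_taylor2 x1; have := expR_taylor2 y1; rewrite xl yl /mgf.
set ex := expR (l * (1 - p)); set ey := expR _ => hy hx.
have -> : p * ex + (1 - p) * ey - (1 + l ^+ 2 * (p * (1 - p)) / 2) =
  p * (ex - (1 + l * (1 - p) + (l * (1 - p)) ^+ 2 / 2)) +
  (1 - p) * (ey - (1 + - (l * p) + (- (l * p)) ^+ 2 / 2)) by field.
apply: le_trans (ler_normD _ _) _; rewrite !normrM (ger0_norm p0) (ger0_norm q0).
apply: (@le_trans _ _ (p * (`|l| * (1 - p)) ^+ 3 + (1 - p) * (`|l| * p) ^+ 3)).
  by rewrite lerD// ler_wpM2l.
have -> : p * (`|l| * (1 - p)) ^+ 3 + (1 - p) * (`|l| * p) ^+ 3 =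
  `|l| ^+ 3 * (p * (1 - p)) * (1 - 2 * (p * (1 - p))) by ring.
by rewrite ler_piMr// ?mulr_ge0// ?exprn_ge0//; have := mulr_ge0 p0 q0; lra.
Qed.

Lemma mgf_le p l : 0 <= p <= 1 -> `|l| <= 1 ->
  mgf p l <= expR (l ^+ 2 * (p * (1 - p) * (1 + 2 * `|l|)) / 2).
Proof.
move=> p01 l1; have := mgf_taylor p01 l1; rewrite ler_norml => /andP[_ H].
apply: le_trans (expR_ge1Dx _).
have -> : l ^+ 2 * (p * (1 - p) * (1 + 2 * `|l|)) / 2 =
  l ^+ 2 * (p * (1 - p)) / 2 + `|l| ^+ 3 * (p * (1 - p)).
  by rewrite -(real_normK (num_real l)); field.
lra.
Qed.

Lemma mgf_ge p l : 0 <= p <= 1 -> `|l| <= 2^-1 ->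
  expR (l ^+ 2 * (p * (1 - p) * (1 - 3 * `|l|)) / 2) <= mgf p l.
Proof.
move=> p01 l1; have l1' : `|l| <= 1 by lra.
have := mgf_taylor p01 l1'; rewrite ler_norml => /andP[+ _].
have l0 := normr_ge0 l; have v0 : 0 <= p * (1 - p) by case/andP: p01 => ? ?; rewrite mulr_ge0// subr_ge0.
have v1 : p * (1 - p) <= 4^-1 by have := sqr_ge0 (p - 2^-1); rewrite expr2; lra.
rewrite -(real_normK (num_real l)); set k := `|l| in l1 l1' l0 *; set v := p * (1 - p) in v0 v1 *.
move=> H; pose w := k ^+ 2 * v / 2; pose u := w * (1 - 2 * k).
have w0 : 0 <= w by rewrite /w divr_ge0// mulr_ge0// sqr_ge0.
have wk : w <= k by rewrite /w; nra.
have u0 : 0 <= u by rewrite mulr_ge0//; lra.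
have uk : u <= k by rewrite /u; nra.
apply: (@le_trans _ _ (1 + u)); last first.
  have -> : u = k ^+ 2 * v / 2 - k ^+ 3 * v by rewrite /u /w; field.
  lra.
(* [expR (u / (1 + u)) <= 1 + u] is [1 - y <= expR (- y)] inverted at [y = u / (1 + u)]. Passing
   from [u] to [y] turns the loss [2 * k] into [3 * k]. *)
apply: (@le_trans _ _ (expR (u / (1 + u)))).
  rewrite ler_expR ler_pdivlMr; last lra.
  have -> : k ^+ 2 * (v * (1 - 3 * k)) / 2 * (1 + u) = w * ((1 - 3 * k) * (1 + u)).
    by rewrite /w; ring.
  rewrite -[leRHS]/(w * (1 - 2 * k)) ler_wpM2l//.
  nra.
have := expR_ge1Dx (- (u / (1 + u))); rewrite expRN.
have -> : 1 - u / (1 + u) = (1 + u)^-1 by field; lra.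
by rewrite lef_pV2// posrE ?expR_gt0//; lra.
Qed.

Lemma mgf_le_gauss p l : 0 <= p <= 1 -> `|l| <= 2^-1 -> mgf p l <= expR (l ^+ 2 * 1 / 2).
Proof.
move=> p01 l1; have l1' : `|l| <= 1 by lra.
apply: le_trans (mgf_le p01 l1') _; rewrite ler_expR ler_wpM2r// ler_wpM2l ?sqr_ge0//.
have := normr_ge0 l.
have v0 : 0 <= p * (1 - p) by case/andP: p01 => ? ?; rewrite mulr_ge0// subr_ge0.
have v1 : p * (1 - p) <= 4^-1 by have := sqr_ge0 (p - 2^-1); rewrite expr2; lra.
nra.
Qed.

(** An error [e] comes from replacing the variance at [p] by that at [m], and at most [3 / 4 * e]
    from the third-order term, as these variances are at most 1/4. *)
Lemma mgf_near p l m e : 0 <= p <= 1 -> 0 <= m <= 1 -> e <= 2^-1 ->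
  `|p - m| <= e -> `|l| <= e ->
  expR (l ^+ 2 * (m * (1 - m) - 2 * e) / 2) <= mgf p l <=
  expR (l ^+ 2 * (m * (1 - m) + 2 * e) / 2).
Proof.
move=> p01 m01 e2 pm le; have l1 : `|l| <= 2^-1 by lra.
have l1' : `|l| <= 1 by lra.
have l0 := normr_ge0 l.
have v0 : 0 <= p * (1 - p) by case/andP: p01 => ? ?; rewrite mulr_ge0// subr_ge0.
have v1 : p * (1 - p) <= 4^-1 by have := sqr_ge0 (p - 2^-1); rewrite expr2; lra.
have vm : `|p * (1 - p) - m * (1 - m)| <= e.
  have -> : p * (1 - p) - m * (1 - m) = (p - m) * (1 - p - m) by ring.
  rewrite normrM -[e]mulr1 ler_pM// ler_norml; lra.
move: vm; rewrite ler_norml => /andP[vm1 vm2].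
apply/andP; split.
  apply: le_trans (mgf_ge p01 l1); rewrite ler_expR ler_wpM2r// ler_wpM2l ?sqr_ge0//.
  nra.
apply: le_trans (mgf_le p01 l1') _; rewrite ler_expR ler_wpM2r// ler_wpM2l ?sqr_ge0//.
nra.
Qed.

End mgf_bounds.

(** * Asymptotics of the normalizing weights *)

Section log_growth.
Variable R : realType.

Lemma near_natr_ge (M : R) : \forall n \near \oo, M <= n%:R.
Proof. exact: nbhs_infty_ger. Qed.

Lemma near_ln_ge (M : R) : \forall n \near \oo, M <= ln n%:R.
Proof.
near=> n; rewrite -[M]expRK ler_ln ?posrE ?expR_gt0//.
  by near: n; exact: near_natr_ge.
by apply: lt_le_trans (expR_gt0 M) _; near: n; exact: near_natr_ge.
Unshelve. all: by end_near. Qed.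

Lemma near_lnln_ge (M : R) : \forall n \near \oo, M <= ln (ln n%:R).
Proof.
near=> n; rewrite -[M]expRK ler_ln ?posrE ?expR_gt0//.
  by near: n; exact: near_ln_ge.
by apply: lt_le_trans (expR_gt0 M) _; near: n; exact: near_ln_ge.
Unshelve. all: by end_near. Qed.

Lemma near_ln_powR_le (g e : R) : g < 1 -> 0 < e ->
  \forall n \near \oo, ln n%:R * n%:R `^ g <= e * n%:R.
Proof.
(* [n] splits into powers [c], [c] and [g]: one power [c] absorbs the logarithm, the other the
   constant. *)
move=> g1 e0; pose c := (1 - g) / 2; have c0 : 0 < c by rewrite /c; lra.
near=> n; have n0 : 0 < n%:R :> R by apply: lt_le_trans ltr01 _; near: n; exact: near_natr_ge.
have lc : ln n%:R <= c^-1 * n%:R `^ c.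
  rewrite ler_pdivlMl// -ln_powR; apply/ltW/ln_sublinear; exact: powR_gt0.
have nE : n%:R = n%:R `^ c * n%:R `^ c * n%:R `^ g :> R.
  rewrite -!powRD ?(gt_eqF n0) ?implybT//.
  by rewrite (_ : c + c + g = 1) ?powRr1 ?(ltW n0)// /c; field.
have uc : c^-1 <= e * n%:R `^ c.
  rewrite -ler_pdivrMl// /powR (gt_eqF n0) -[leLHS]lnK; last first.
    by rewrite posrE mulr_gt0 ?invr_gt0.
  rewrite ler_expR -ler_pdivrMl//.
  by near: n; exact: near_ln_ge.
rewrite [in leRHS]nE; have u0 := powR_gt0 c n0; have w0 := powR_gt0 g n0.
rewrite mulrA ler_wpM2r ?(ltW w0)//; apply: le_trans lc _.
by rewrite mulrA ler_wpM2r// ltW.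
Unshelve. all: by end_near. Qed.

End log_growth.

Section weights.
(** [gam n ^+ 2] grows like the power [2 * a] of [n]. The exponent [g] dominates [2 * a] and lies
    strictly between 0 and 1, so negative [a] needs no separate treatment. *)
Variables (R : realType) (a g : R).
Hypotheses (a_geN1 : -1 <= a) (growth_ge : 2 * a <= g).
Hypotheses (growth_gt0 : 0 < g) (growth_lt1 : g < 1).
Let a_lt2V : a < 1 / 2. Proof. by have := growth_ge; have := growth_lt1; lra. Qed.

(* The centred walk [dev] satisfies
   [dev (x :: h) = (1 + a / size h) * dev h + (x - pi h)], so [dev h / gam (size h)]
   is a martingale; the product starts at 2 because the factor at 1 vanishes when
   [a = -1]. *)
Definition gam (n : nat) : R := \prod_(2 <= k < n) (1 + a / k%:R).

(* The variance that [dev] would have if the innovations had variance 1. *)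
Fixpoint varn (n : nat) : R :=
  if n is n'.+1 then (1 + a / n'%:R) ^+ 2 * varn n' + 1 else 0.

Lemma gam2 : gam 2 = 1. Proof. by rewrite /gam big_geq. Qed.

Lemma gamS n : (2 <= n)%N -> gam n.+1 = gam n * (1 + a / n%:R).
Proof. by move=> n2; rewrite /gam big_nat_recr. Qed.

Lemma factor_gt0 n : (2 <= n)%N -> 0 < 1 + a / n%:R.
Proof.
move=> n2; have n0 : 2 <= n%:R :> R by rewrite ler_nat.
suff : -1 < a / n%:R by lra.
by have := a_geN1; rewrite ltr_pdivlMr; lra.
Qed.

Lemma factor_ge0 n : 0 <= 1 + a / n%:R.
Proof.
case: n => [|n]; first by rewrite invr0 mulr0 addr0.
have n0 : 1 <= n.+1%:R :> R by rewrite ler1n.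
rewrite -lerBlDl sub0r ler_pdivlMr; last by rewrite ltr0n.
by move: n0; have := a_geN1; set r := n.+1%:R; lra.
Qed.

Lemma gam_gt0 n : 0 < gam n.
Proof.
rewrite /gam big_nat_cond; apply: prodr_gt0 => k; rewrite andbT => /andP[k2 _].
exact: factor_gt0.
Qed.

Lemma varn_ge0 n : 0 <= varn n.
Proof. by elim: n => //= n IH; rewrite addr_ge0// mulr_ge0// sqr_ge0. Qed.

Lemma varn_ge1 n : 1 <= varn n.+1.
Proof. by rewrite /= lerDr mulr_ge0 ?varn_ge0 ?sqr_ge0. Qed.

(** Variation of constants for the recursion of [varn]: the squared ratio carries along what was
    built up by time [N], and the sum is what is created afterwards. *)
Lemma sum_sqr_gam_ratio N n : (2 <= N <= n)%N ->
  \sum_(N <= k < n) (gam n / gam k.+1) ^+ 2 = varn n - (gam n / gam N) ^+ 2 * varn N.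
Proof.
move=> /andP[N2]; elim: n => [|n IH]; first by case: N N2.
rewrite leq_eqVlt => /orP[/eqP <-|Nn].
  by rewrite big_geq// divff ?gt_eqF ?gam_gt0//; ring.
have n2 : (2 <= n)%N by rewrite (leq_trans N2).
rewrite big_nat_recr//= divff ?gt_eqF ?gam_gt0// expr1n gamS//.
rewrite (eq_bigr (fun k => (1 + a / n%:R) ^+ 2 * (gam n / gam k.+1) ^+ 2)); last first.
  by move=> k _; ring.
rewrite -mulr_sumr IH//; ring.
Qed.

Lemma sum_sqr_inv_gam n : (2 <= n)%N ->
  \sum_(2 <= k < n) (gam k.+1)^-1 ^+ 2 <= varn n / gam n ^+ 2.
Proof.
move=> n2; have g0 : 0 < gam n ^+ 2 by rewrite exprn_gt0 ?gam_gt0.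
rewrite ler_pdivlMr// mulr_suml.
rewrite (eq_bigr (fun k => (gam n / gam k.+1) ^+ 2)); last by move=> k _; ring.
rewrite sum_sqr_gam_ratio ?leqnn//= gerBl mulr_ge0 ?sqr_ge0//.
exact: varn_ge0 2.
Qed.

Lemma inv_le_ln n : (2 <= n)%N -> n%:R^-1 <= ln n%:R - ln n.-1%:R :> R.
Proof.
case: n => [//|[//|n]] _ /=.
have h : 1 + (- n.+2%:R^-1) <= expR (- n.+2%:R^-1 : R) by exact: expR_ge1Dx.
have e : n.+1%:R / n.+2%:R = 1 + (- n.+2%:R^-1) :> R.
  rewrite -[n.+2%:R]natr1; have : 0 < n.+1%:R :> R by rewrite ltr0n.
  by set x := n.+1%:R => x0; field; rewrite gt_eqF// addr_gt0.
rewrite -lerN2 opprB -ln_div ?posrE ?ltr0n// -[leRHS]expRK ler_ln ?posrE ?expR_gt0 ?divr_gt0//.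
by rewrite e.
Qed.

Lemma factor_le n : (2 <= n)%N ->
  1 + a / n%:R <= expR (g / 2 * (ln n%:R - ln n.-1%:R)).
Proof.
move=> n2; apply: le_trans (expR_ge1Dx _) _; rewrite ler_expR.
have n0 : 0 < n%:R :> R by rewrite ltr0n (leq_trans _ n2).
apply: (@le_trans _ _ (g / 2 * n%:R^-1)).
  by rewrite ler_wpM2r ?invr_ge0 ?(ltW n0)//; have := growth_ge; lra.
by rewrite ler_wpM2l ?inv_le_ln//; have := growth_gt0; lra.
Qed.

Lemma gam_ratio_le_pred j n : (2 <= j <= n)%N ->
  gam n / gam j <= expR (g / 2 * (ln n.-1%:R - ln j.-1%:R)).
Proof.
move=> /andP[j2]; elim: n => [|n IH]; first by case: j j2.
rewrite leq_eqVlt => /orP[/eqP <-|jn].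
  by rewrite divff ?gt_eqF ?gam_gt0// subrr mulr0 expR0.
have n2 : (2 <= n)%N by rewrite (leq_trans j2).
rewrite gamS// mulrAC.
have -> : g / 2 * (ln n.+1.-1%:R - ln j.-1%:R) =
  g / 2 * (ln n.-1%:R - ln j.-1%:R) + g / 2 * (ln n%:R - ln n.-1%:R) :> R.
  by rewrite /=; ring.
rewrite expRD ler_pM ?factor_ge0 ?factor_le ?IH//.
by rewrite divr_ge0// ltW ?gam_gt0.
Qed.

(** Comparison with logarithms gives a power of [n.-1 / j.-1]; this quotient is at most
    [2 * (n / j)] since [j >= 2], and [2] to the power [g] is at most 2. *)
Lemma gam_ratio_le j n : (2 <= j <= n)%N ->
  (gam n / gam j) ^+ 2 <= 2 * (n%:R / j%:R) `^ g.
Proof.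
move=> jn; have [j2 nj] := andP jn.
have j0 : 0 < j%:R :> R by rewrite ltr0n (leq_trans _ j2).
have n0 : 0 < n%:R :> R by rewrite (lt_le_trans j0)// ler_nat.
have j10 : 0 < j.-1%:R :> R by rewrite ltr0n; case: j j2 {jn nj j0} => [|[]].
have n10 : 0 < n.-1%:R :> R.
  by rewrite (lt_le_trans j10)// ler_nat; case: (n) (j) nj => [|n'] [].
have njp : n.-1%:R / j.-1%:R <= 2 * (n%:R / j%:R) :> R.
  rewrite ler_pdivrMr// [leRHS](_ : _ = n%:R * (2 * j.-1%:R / j%:R)); last by ring.
  apply: (@le_trans _ _ n%:R); first by rewrite ler_nat leq_pred.
  rewrite ler_peMr ?(ltW n0)// ler_pdivlMr// mul1r -natrM ler_nat.
  by case: (j) j2 => [|[|k]] //= _; rewrite mul2n -addnn !addSn !addnS !ltnS leq_addr.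
have g0 := growth_gt0; have g1 := growth_lt1.
apply: (@le_trans _ _ ((2 * (n%:R / j%:R)) `^ g)).
  apply: (@le_trans _ _ (expR (g / 2 * (ln n.-1%:R - ln j.-1%:R)) ^+ 2)).
    rewrite lerXn2r ?nnegrE ?expR_ge0 ?gam_ratio_le_pred//.
    by rewrite divr_ge0// ltW ?gam_gt0.
  have r0 : 0 < 2 * (n%:R / j%:R) :> R by rewrite mulr_gt0// divr_gt0.
  rewrite /powR gt_eqF// expr2 -expRD ler_expR -ln_div ?posrE//.
  rewrite [leLHS](_ : _ = g * ln (n.-1%:R / j.-1%:R)); last by field.
  by rewrite ler_wpM2l ?(ltW g0)// ler_ln ?posrE// divr_gt0.
rewrite powRM ?ler0n// ?divr_ge0 ?ler0n// ler_wpM2r ?powR_ge0//.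
rewrite -[leRHS]powRr1// ler_powR ?ltW//; lra.
Qed.

(** The worst case is [a = -1], where the product telescopes. *)
Lemma gam_ratio_ge n N : (2 <= n <= N)%N -> n.-1%:R / N.-1%:R <= gam N / gam n.
Proof.
move=> /andP[n2]; elim: N => [|N IH]; first by case: n n2.
rewrite leq_eqVlt => /orP[/eqP <-|nN].
  by rewrite !divff ?gt_eqF ?gam_gt0// ltr0n; case: (n) n2 => [|[]].
have N2 : (2 <= N)%N by rewrite (leq_trans n2).
have N0 : 0 < N%:R :> R by rewrite ltr0n (leq_trans _ N2).
have N10 : 0 < N.-1%:R :> R by rewrite ltr0n; case: (N) N2 => [|[]].
rewrite gamS//= mulrAC.
have -> : n.-1%:R / N%:R = (n.-1%:R / N.-1%:R) * (N.-1%:R / N%:R) :> R.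
  by field; rewrite !gt_eqF.
rewrite ler_pM ?divr_ge0 ?ler0n ?IH//.
have -> : N.-1%:R = N%:R - 1 :> R by rewrite -[in RHS](prednK (ltnW N2)) -natr1 addrK.
rewrite mulrBl divff ?gt_eqF// mul1r lerD2l -mulN1r ler_wpM2r ?invr_ge0 ?(ltW N0)//; exact: a_geN1.
Qed.

Let b := 1 - 2 * a.
Let b0 : 0 < b. Proof. by rewrite /b; have := a_lt2V; lra. Qed.

(* [varn n - n / b] satisfies a recursion with forcing term [a ^+ 2 / (b * n)],
   for which [A * expR (g * ln n.-1%:R) - D] is a supersolution. *)
Lemma varn_error : exists A, forall n, (2 <= n)%N ->
  `|varn n - n%:R / b| <= A * expR (g * ln n%:R).
Proof.
(* [D * (g / n)] is [(b * n)^-1], which dominates the forcing term because [a ^+ 2 <= 1]. Adding [D]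
   to the initial error in [A] makes the supersolution exact at [n = 2], where [ln n.-1%:R = 0]. *)
have g0 := growth_gt0; pose D := (b * g)^-1.
have D0 : 0 < D by rewrite invr_gt0 mulr_gt0.
pose A := `|varn 2 - 2 / b| + D; have A0 : 0 <= A by rewrite addr_ge0 ?normr_ge0 ?(ltW D0).
exists A => n n2; apply: (@le_trans _ _ (A * expR (g * ln n.-1%:R) - D)); last first.
  rewrite lerBlDr; apply: ler_wpDr; first exact: ltW.
  rewrite ler_wpM2l// ler_expR ler_wpM2l ?(ltW g0)//.
  rewrite ler_ln ?posrE ?ltr0n ?ler_nat ?leq_pred//; last exact: ltnW.
  by case: n n2 => [|[]].
elim: n n2 => [//|n IH]; rewrite ltnS leq_eqVlt => /orP[/eqP <-|n2].
  by rewrite (_ : 2.-1%:R = 1 :> R)// ln1 mulr0 expR0 mulr1 /A addrK.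
have n0 : 0 < n%:R :> R by rewrite ltr0n (leq_trans _ n2).
have -> : varn n.+1 - n.+1%:R / b =
    (1 + a / n%:R) ^+ 2 * (varn n - n%:R / b) + a ^+ 2 / (b * n%:R).
  by rewrite /= -natr1; rewrite /b; field; rewrite gt_eqF//= gt_eqF//; exact: b0.
apply: le_trans (ler_normD _ _) _.
rewrite normrM ger0_norm ?sqr_ge0// [X in _ + X]ger0_norm; last first.
  by rewrite divr_ge0 ?sqr_ge0// mulr_ge0// ltW.
have f0 := factor_ge0 n; have fl := factor_le n2.
have E0 := IH n2; set En := A * expR (g * ln n.-1%:R) - D in E0.
have En0 : 0 <= En by apply: le_trans E0.
apply: (@le_trans _ _ ((1 + a / n%:R) ^+ 2 * En + a ^+ 2 / (b * n%:R))).
  by rewrite lerD2r ler_wpM2l ?sqr_ge0.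
have f1 : (1 + a / n%:R) ^+ 2 <= (1 + g / 2 / n%:R) ^+ 2.
  rewrite lerXn2r ?nnegrE//; first by rewrite addr_ge0// divr_ge0 ?divr_ge0 ?ltW.
  by rewrite lerD2l ler_wpM2r ?invr_ge0 ?(ltW n0)//; have := growth_ge; lra.
have f2 : (1 + g / 2 / n%:R) ^+ 2 <= expR (g * (ln n%:R - ln n.-1%:R)).
  have -> : g * (ln n%:R - ln n.-1%:R) = g / 2 * (ln n%:R - ln n.-1%:R) *+ 2 :> R.
    by rewrite mulr2n; field.
  rewrite mulr2n expRD -expr2 lerXn2r ?nnegrE ?expR_ge0//.
    by rewrite addr_ge0// divr_ge0 ?divr_ge0 ?ltW.
  apply: le_trans (expR_ge1Dx _) _; rewrite ler_expR.
  by rewrite ler_wpM2l ?inv_le_ln// divr_ge0 ?(ltW g0).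
have f3 : 1 + g / n%:R <= (1 + g / 2 / n%:R) ^+ 2.
  have -> : g / 2 / n%:R = (g / n%:R) / 2 by field; rewrite gt_eqF.
  by have := sqr_ge0 (g / n%:R); rewrite !expr2; lra.
apply: (@le_trans _ _ ((1 + g / 2 / n%:R) ^+ 2 * En + a ^+ 2 / (b * n%:R))).
  by rewrite lerD2r ler_wpM2r.
rewrite /En mulrBr.
have h1 : (1 + g / 2 / n%:R) ^+ 2 * (A * expR (g * ln n.-1%:R)) <=
   A * expR (g * ln n%:R).
  rewrite mulrCA ler_wpM2l//.
  have -> : g * ln n%:R = g * (ln n%:R - ln n.-1%:R) + g * ln n.-1%:R :> R by ring.
  by rewrite expRD ler_wpM2r ?expR_ge0.
have h2 : a ^+ 2 / (b * n%:R) <= D * (g / n%:R).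
  have -> : D * (g / n%:R) = (b * n%:R)^-1 by rewrite /D; field; rewrite !gt_eqF.
  rewrite ler_piMl ?invr_ge0 ?mulr_ge0 ?(ltW b0) ?(ltW n0)//.
  by have := a_lt2V; have := a_geN1; nra.
have h3 : D * (1 + g / n%:R) <= (1 + g / 2 / n%:R) ^+ 2 * D.
  by rewrite mulrC ler_wpM2r// ltW.
rewrite /=; lra.
Qed.

Lemma near_varn e : 0 < e -> \forall n \near \oo, `|varn n - n%:R / b| <= e * n%:R.
Proof.
move=> e0; have [A HA] := varn_error.
have e1 : 0 < e / (`|A| + 1) by rewrite divr_gt0// ltr_wpDl.
near=> n.
have n2 : (2 <= n)%N by near: n; exists 2%N.
have n0 : 0 < n%:R :> R by rewrite ltr0n (leq_trans _ n2).
apply: le_trans (HA n n2) _.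
have -> : expR (g * ln n%:R) = n%:R `^ g by rewrite /powR gt_eqF.
apply: (@le_trans _ _ ((`|A| + 1) * (ln n%:R * n%:R `^ g))).
  rewrite mulrA ler_wpM2r ?powR_ge0//.
  apply: (@le_trans _ _ (`|A| + 1)); first by have := ler_norm A; lra.
  by rewrite ler_peMr ?addr_ge0//; near: n; exact: near_ln_ge.
rewrite mulrC -ler_pdivlMr; last by rewrite ltr_wpDl.
rewrite [leRHS]mulrAC.
by near: n; apply: near_ln_powR_le => //; exact: growth_lt1.
Unshelve. all: by end_near. Qed.

(** A Lindeberg condition, uniform in [j]: a single squared weight is negligible against
    [n / ln (ln n)], so the exponents used at this scale stay within any prescribed range. *)
Lemma near_gam_ratio e : 0 < e -> \forall n \near \oo, forall j, (2 <= j <= n)%N ->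
  ln (ln n%:R) * (gam n / gam j) ^+ 2 <= e * n%:R.
Proof.
move=> e0; near=> n => j jn.
have [j2 nj] := andP jn.
have j0 : 0 < j%:R :> R by rewrite ltr0n (leq_trans _ j2).
have n0 : 0 < n%:R :> R by rewrite (lt_le_trans j0)// ler_nat.
have ln1 : 1 <= ln n%:R :> R by near: n; exact: near_ln_ge.
have lln : 0 <= ln (ln n%:R) :> R by near: n; exact: near_lnln_ge.
apply: (@le_trans _ _ (2 * (ln n%:R * n%:R `^ g))).
  rewrite [leRHS]mulrCA; apply: (@ler_pM _ (ln (ln n%:R)) _ ((gam n / gam j) ^+ 2)).
  - exact: lln.
  - exact: sqr_ge0.
  - by apply/ltW/ln_sublinear; lra.
  apply: le_trans (gam_ratio_le jn) _; rewrite ler_wpM2l//.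
  apply: ge0_ler_powR; rewrite ?nnegrE ?divr_ge0 ?ler0n ?(ltW growth_gt0)//.
  by rewrite ler_pdivrMr// ler_peMr ?ler0n// ler1n (leq_trans _ j2).
rewrite -ler_pdivlMl// mulrA.
by near: n; apply: near_ln_powR_le; [exact: growth_lt1|rewrite mulr_gt0// invr_gt0].
Unshelve. all: by end_near. Qed.

(** The constant left by finitely many steps gets multiplied by [gam n]; as [2 * a < 1], it stays
    below the scale of [psi]. *)
Lemma near_gam_le e C : 0 < e -> \forall n \near \oo, C * gam n <= e * Num.sqrt n%:R.
Proof.
move=> e0; pose e1 := e / (`|C| + 1); have C0 : 0 < `|C| + 1 by rewrite ltr_wpDl.
have e10 : 0 < e1 by rewrite divr_gt0.
have h := near_gam_ratio (exprn_gt0 2 e10).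
near=> n.
have n2 : (2 <= n)%N by near: n; exists 2%N.
have /(_ 2%N) : forall j, (2 <= j <= n)%N ->
    ln (ln n%:R) * (gam n / gam j) ^+ 2 <= e1 ^+ 2 * n%:R by near: n.
move=> /(_ n2).
rewrite gam2 divr1 => gn.
have g2 : gam n ^+ 2 <= (e1 * Num.sqrt n%:R) ^+ 2.
  rewrite exprMn sqr_sqrtr ?ler0n//; apply: le_trans gn.
  by rewrite ler_peMl ?sqr_ge0//; near: n; exact: near_lnln_ge.
have g1 : gam n <= e1 * Num.sqrt n%:R.
  by move: g2; rewrite ler_pXn2r ?nnegrE ?(ltW (gam_gt0 _))// mulr_ge0 ?sqrtr_ge0// ltW.
apply: (@le_trans _ _ ((`|C| + 1) * gam n)).
  by rewrite ler_wpM2r ?(ltW (gam_gt0 _))//; have := ler_norm C; lra.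
apply: le_trans (ler_wpM2l (ltW C0) g1) _.
by rewrite /e1 mulrA mulrCA divff ?mulr1 ?gt_eqF// mulrC.
Unshelve. all: by end_near. Qed.

End weights.

(** * Upper half of the law of the iterated logarithm *)

Section blocks.
Variable R : realType.
Implicit Types theta : R.

Definition psi (n : nat) : R := Num.sqrt (2 * n%:R * ln (ln n%:R)).

Lemma sum_expR_ln_le theta : 1 < theta -> exists C, forall K,
  \sum_(1 <= k < K) expR (- (theta * ln k%:R)) <= C.
Proof.
move=> theta1; pose dl := theta - 1; have dl0 : 0 < dl by rewrite /dl; lra.
pose u k : R := expR (- (dl * ln k%:R)).
have C0 : 0 <= 1 + dl^-1 by rewrite addr_ge0 ?invr_ge0 ?(ltW dl0).
exists (1 + dl^-1); case=> [|[|K]]; [by rewrite big_geq|by rewrite big_geq|].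
rewrite big_ltn// ln1 mulr0 oppr0 expR0 lerD2l.
(* Integral test in discrete form: each term is at most [dl^-1] times the decrement of [u]. *)
apply: (@le_trans _ _ (dl^-1 * (u 1%N - u K.+1))); last first.
  rewrite ler_piMr ?invr_ge0 ?(ltW dl0)// /u ln1 mulr0 oppr0 expR0 gerBl.
  exact: expR_ge0.
rewrite ler_pdivlMl//; elim: K => [|K IH]; first by rewrite big_geq// mulr0 subrr.
rewrite big_nat_recr//= mulrDr.
have -> : u 1%N - u K.+2 = (u 1%N - u K.+1) + (u K.+1 - u K.+2) by ring.
apply: lerD => //.
have ->: expR (- (theta * ln K.+2%:R)) = u K.+2 * K.+2%:R^-1.
  rewrite -[K.+2%:R^-1]lnK ?posrE ?invr_gt0 ?ltr0n// lnV ?posrE ?ltr0n//.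
  by rewrite /u -expRD /dl; congr expR; ring.
have -> : u K.+1 = u K.+2 * expR (dl * (ln K.+2%:R - ln K.+1%:R)).
  by rewrite /u -expRD; congr expR; ring.
rewrite mulrCA -[X in _ * _ - X]mulr1 -mulrBr ler_wpM2l ?expR_ge0//.
apply: (@le_trans _ _ (dl * (ln K.+2%:R - ln K.+1%:R))).
  by rewrite ler_wpM2l ?(ltW dl0)//; exact: (inv_le_ln R (isT : (2 <= K.+2)%N)).
by have := expR_ge1Dx (dl * (ln K.+2%:R - ln K.+1%:R)); lra.
Qed.

Lemma block_cover (N : nat -> nat) k0 n : {homo N : i j / (i <= j)%N} ->
  (exists K, (n < N K)%N) -> (N k0 <= n)%N ->
  exists2 k, (k0 <= k)%N & (N k <= n < N k.+1)%N.
Proof.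
move=> Nm nK Nn; case: (ex_minnP nK) => -[|K] HK Kmin.
  by have := leq_trans HK (leq_trans (Nm _ _ (leq0n k0)) Nn); rewrite ltnn.
exists K; last by rewrite HK andbT leqNgt; apply/negP => /Kmin; rewrite ltnn.
rewrite leqNgt; apply/negP => Kk0.
by have := leq_trans HK (leq_trans (Nm _ _ Kk0) Nn); rewrite ltnn.
Qed.

Lemma near_exprn_ge theta M : 1 < theta -> \forall k \near \oo, M <= theta ^+ k.
Proof.
move=> t1; have lt0 : 0 < ln theta by exact: ln_gt0.
near=> k; have t0 : 0 < theta by lra.
rewrite -[theta ^+ k]lnK ?posrE ?exprn_gt0// lnXn//.
apply: le_trans (_ : ln theta *+ k <= _).
  rewrite -mulr_natr -ler_pdivrMl//; near: k; exact: near_natr_ge.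
by apply: le_trans (expR_ge1Dx _); lra.
Unshelve. all: by end_near. Qed.

(** The shift by 2 keeps block ends at least 2, where [gam] starts, and makes even their
    predecessors dominate [theta ^+ k], as the lower bound on ratios of [gam] is in terms of
    predecessors. *)
Definition block theta (k : nat) : nat := (Num.truncn (theta ^+ k)).+2.

Lemma block_bounds theta k : 1 < theta ->
  theta ^+ k <= (block theta k).-1%:R /\ (block theta k)%:R <= theta ^+ k + 2.
Proof.
move=> t1; have : 0 <= theta ^+ k by rewrite exprn_ge0//; lra.
move=> /truncn_itv /andP[h1 /ltW h2]; split; first exact: h2.
by rewrite /block -addn2 natrD lerD2r.
Qed.

Lemma block_homo theta : 1 < theta -> {homo block theta : i j / (i <= j)%N}.
Proof.
move=> t1 i j ij; rewrite /block !ltnS; apply: le_truncn.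
by apply: ler_weXn2l => //; apply: ltW.
Qed.

Lemma block_unbounded theta n : 1 < theta -> exists k, (n < block theta k)%N.
Proof.
move=> t1; have [k _ /(_ k (leqnn k)) nk] := near_exprn_ge n%:R t1.
exists k; rewrite /block ltnS -(ler_nat R); apply: (le_trans nk).
by have [] := block_bounds k t1.
Qed.

(** [ln (ln n)] is at least [ln k + ln (ln theta)]; this constant may be very negative, and the
    factor [theta] absorbs it for large [k]. *)
Lemma near_ln_block theta : 1 < theta -> \forall k \near \oo,
  forall n, theta ^+ k <= n%:R -> ln k%:R <= theta * ln (ln n%:R) :> R.
Proof.
move=> t1; have lt0 : 0 < ln theta by exact: ln_gt0.
near=> k => n tn.
have k0 : 0 < k%:R :> R by apply: lt_le_trans ltr01 _; near: k; exact: near_natr_ge.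
have tk0 : 0 < theta ^+ k by rewrite exprn_gt0//; lra.
have h1 : k%:R * ln theta <= ln n%:R.
  rewrite mulrC mulr_natr -lnXn; last lra.
  by rewrite ler_ln ?posrE// (lt_le_trans tk0).
have h2 : ln k%:R + ln (ln theta) <= ln (ln n%:R).
  rewrite -lnM ?posrE// ler_ln ?posrE ?mulr_gt0//.
  by apply: lt_le_trans h1; rewrite mulr_gt0.
have h3 : - theta * ln (ln theta) / (theta - 1) <= ln k%:R.
  by near: k; exact: near_ln_ge.
rewrite ler_pdivrMr in h3; last lra.
have : theta * (ln k%:R + ln (ln theta)) <= theta * ln (ln n%:R) by rewrite ler_wpM2l//; lra.
lra.
Unshelve. all: by end_near. Qed.

End blocks.

Section history_sums.
Context (R : realType) (d : measure_display) (T : measurableType d)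
  (P : probability T R) (X : nat -> {RV P >-> bool}) (pi : seq bool -> R).

(** Exchanges weights cut off outside good histories for the true ones, once the path has become
    good. *)
Lemma lin_process_hist_eq c c' n0 n w : (n0 <= n)%N ->
  (forall k, (n0 <= k < n)%N -> c (hist X k w) = c' (hist X k w)) ->
  lin_process pi c (hist X n w) - lin_process pi c (hist X n0 w) =
  lin_process pi c' (hist X n w) - lin_process pi c' (hist X n0 w).
Proof.
elim: n => [|n IH]; first by rewrite leqn0 => /eqP ->; rewrite !subrr.
rewrite leq_eqVlt => /orP[/eqP <-|n0n] cc; first by rewrite !subrr.
rewrite /= cc ?ltnSn ?andbT// addrAC IH//; last first.
  by move=> k /andP[k0 kn]; apply: cc; rewrite k0 ltnW.
by rewrite addrAC.
Qed.

End history_sums.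

Section walk.
Variables (R : realType) (a m s g : R).
Hypotheses (a_geN1 : -1 <= a) (g_ge : 2 * a <= g) (g_gt0 : 0 < g) (g_lt1 : g < 1).

Let pi := succ_pr a m s.
Hypothesis pi01 : forall h, 0 <= pi h <= 1.

Let b := 1 - 2 * a.
Let b0 : 0 < b. Proof. by rewrite /b; have := g_ge; have := g_lt1; lra. Qed.

Let gam := gam a.
Let varn := varn a.
Let gam_gt0 n : 0 < gam n. Proof. exact: gam_gt0. Qed.

Lemma dev_cons x h : (0 < size h)%N ->
  dev m (x :: h) = (1 + a / (size h)%:R) * dev m h + (x%:R - pi h).
Proof.
move=> h0; have n0 : (size h)%:R != 0 :> R by rewrite pnatr_eq0 -lt0n.
have -> : pi h = m + a * dev m h / (size h)%:R by rewrite /pi; case: (h) h0.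
by rewrite /dev /= natrD -natr1; move: n0; set n := (size h)%:R => n0; field.
Qed.

Lemma gam_dev_cons x h : (2 <= size h)%N ->
  dev m (x :: h) / gam (size h).+1 =
  dev m h / gam (size h) + (gam (size h).+1)^-1 * (x%:R - pi h).
Proof.
move=> h2; rewrite dev_cons; last exact: ltnW.
have f0 := factor_gt0 a_geN1 h2.
have gh := gam_gt0 (size h); rewrite /gam gamS// -/gam.
move: f0; set f := 1 + _ => f0; set e := x%:R - _.
by field; rewrite !gt_eqF.
Qed.

Section upper_block.
Variables (z S2 eta : R) (G : pred (seq bool)).
Hypotheses (z2 : z ^+ 2 = 1) (S2_gt0 : 0 < S2) (eta_gt0 : 0 < eta).
Hypothesis mgfG : forall h l, G h -> `|l| <= eta ->
  mgf (pi h) l <= expR (l ^+ 2 * S2 / 2).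

Definition gam_weight (h : seq bool) : R :=
  if (2 <= size h)%N && G h then (gam (size h).+1)^-1 else 0.

(** Chernoff bound at the optimal parameter [l]: the level contributes [2 * x], the compensator
    takes away at most [x]. The last hypothesis keeps all exponents [l / gam k] within [eta], where
    [mgfG] is available. *)
Lemma upper_block N x : (2 <= N)%N -> 0 < x ->
  (forall k, (2 <= k <= N)%N -> 2 * x * (gam N / gam k) ^+ 2 <= eta ^+ 2 * (S2 * varn N)) ->
  mean pi N (fun h => (hit (fun h =>
    Num.sqrt (2 * x * (S2 * varn N)) / gam N <= z * lin_process pi gam_weight h) h)%:R) [::]
  <= expR (- x).
Proof.
move=> N2 x0 small.
have gN := gam_gt0 N; have vN : 0 < varn N.
  by case: (N) N2 => [//|n] _; apply: lt_le_trans (varn_ge1 a n).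
have SV0 : 0 < S2 * varn N by rewrite mulr_gt0.
pose l := Num.sqrt (2 * x / (S2 * varn N)) * gam N.
have l2 : l ^+ 2 = 2 * x * gam N ^+ 2 / (S2 * varn N).
  have xs : 0 <= 2 * x / (S2 * varn N).
    by apply: divr_ge0; [apply: mulr_ge0 => //; exact: ltW|exact: ltW].
  by rewrite /l exprMn (sqr_sqrtr xs) mulrAC.
have l0 : 0 < l by rewrite mulr_gt0// sqrtr_gt0 divr_gt0// mulr_gt0.
(* A zero weight has moment exactly 1, so with the cut at [N] and outside [G] the bound [bb] holds
   after every history. *)
pose c h := if (2 <= size h < N)%N && G h then l * z / gam (size h).+1 else 0.
pose bb k := if (2 <= k < N)%N then l ^+ 2 * S2 / 2 * (gam k.+1)^-1 ^+ 2 else 0.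
have cb h : mgf (pi h) (c h) <= expR (bb (size h)).
  rewrite /c /bb; case: ifP => [/andP[hN Gh]|_]; last first.
    rewrite mgf0 -expR0 ler_expR; case: ifP => // _.
    by rewrite mulr_ge0 ?sqr_ge0// divr_ge0// mulr_ge0 ?sqr_ge0// ltW.
  have [h2 hN'] := andP hN.
  rewrite hN; have gh := gam_gt0 (size h).+1; apply: le_trans (mgfG Gh _) _.
    rewrite -(@ler_pXn2r _ 2) ?nnegrE ?normr_ge0 ?(ltW eta_gt0)// real_normK ?num_real//.
    rewrite expr_div_n exprMn z2 mulr1 l2.
    have -> : 2 * x * gam N ^+ 2 / (S2 * varn N) / gam (size h).+1 ^+ 2 =
        2 * x * (gam N / gam (size h).+1) ^+ 2 / (S2 * varn N).
      by field; rewrite !gt_eqF.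
    by rewrite ler_pdivrMr// small// (leqW h2) hN'.
  rewrite ler_expR expr_div_n exprMn z2 le_eqVlt; apply/orP; left; apply/eqP.
  by field; rewrite gt_eqF.
apply: le_trans (maximal_tail pi01 x N cb).
apply: (mean_le pi01) => t; rewrite cats0 => tN.
rewrite ler_nat; set A := hit _ t; set B := hit _ t.
suff : A -> B by case: A => // ->.
rewrite {}/A {}/B; have : (size t <= N)%N by rewrite tN.
elim: t {tN} => [|y t IH] tN /=.
  rewrite orbF mulr0 leNgt => /negP[]; rewrite divr_gt0// sqrtr_gt0 mulr_gt0//.
  by rewrite mulr_gt0.
case/orP => [H|/(IH (ltnW tN)) ->]; last by rewrite orbT.
apply/orP; left.
have linE u : (size u <= N)%N ->
    lin_process pi c u = l * (z * lin_process pi gam_weight u).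
  elim: u => [|y' u IHu] /=; first by rewrite !mulr0.
  move=> uN; rewrite (IHu (ltnW uN)) /c /gam_weight uN andbT.
  by case: ifP => _; ring.
rewrite -[X in X - _]/(lin_process pi c (y :: t)) (linE (y :: t))//.
have sb : \sum_(0 <= k < (size t).+1) bb k <= x.
  apply: (@le_trans _ _ (\sum_(0 <= k < N) bb k)).
    rewrite [leRHS](big_cat_nat (leq0n _) tN)//= lerDl sumr_ge0// => k _.
    rewrite /bb; case: ifP => // _.
    by rewrite mulr_ge0 ?sqr_ge0// divr_ge0// mulr_ge0 ?sqr_ge0// ltW.
  rewrite big_ltn ?(ltnW N2)// big_ltn// /bb/= !add0r.
  rewrite (eq_big_nat _ _ (F2 := fun k => l ^+ 2 * S2 / 2 * (gam k.+1)^-1 ^+ 2)).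
    rewrite -mulr_sumr.
    have q0 : 0 <= l ^+ 2 * S2 / 2 by rewrite divr_ge0// mulr_ge0 ?sqr_ge0// ltW.
    have H' : \sum_(2 <= k < N) (gam k.+1)^-1 ^+ 2 <= varn N / gam N ^+ 2.
      exact: sum_sqr_inv_gam.
    apply: (le_trans (ler_wpM2l q0 H')).
    rewrite l2 le_eqVlt; apply/orP; left; apply/eqP; rewrite -/gam -/varn.
    by field; rewrite !gt_eqF.
  by move=> k kN; rewrite kN.
have := ler_wpM2l (ltW l0) H.
rewrite [X in X <= _](_ : _ = 2 * x).
  by move=> lx; rewrite lerBrDr; apply: le_trans lx; rewrite mulrDl !mul1r lerD2l.
rewrite /l mulrACA -sqrtrM; last by apply: divr_ge0; [apply: mulr_ge0 => //; exact: ltW|exact: ltW].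
rewrite divff ?gt_eqF// mulr1.
have -> : 2 * x / (S2 * varn N) * (2 * x * (S2 * varn N)) = (2 * x) ^+ 2.
  by field; rewrite !gt_eqF.
by rewrite sqrtr_sqr ger0_norm// mulr_ge0// ltW.
Qed.

End upper_block.

End walk.

Lemma near_block (R : realType) (theta : R) (Q : nat -> Prop) : 1 < theta ->
  (\forall n \near \oo, Q n) -> \forall k \near \oo, Q (block theta k.+1).
Proof.
move=> t1 [M _ QM]; near=> k; apply: QM => /=; rewrite -(ler_nat R).
have [h _] := block_bounds k.+1 t1.
apply: (@le_trans _ _ (theta ^+ k.+1)); last first.
  by apply: (le_trans h); rewrite ler_nat leq_pred.
apply: (@le_trans _ _ (theta ^+ k)); last by apply: ler_weXn2l => //; exact: ltW.
by near: k; exact: near_exprn_ge.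
Unshelve. all: by end_near. Qed.

Section upper_law.
Context (R : realType) (d : measure_display) (T : measurableType d)
  (P : probability T R) (X : nat -> {RV P >-> bool}) (a m s g : R).
Hypotheses (a_geN1 : -1 <= a) (g_ge : 2 * a <= g) (g_gt0 : 0 < g) (g_lt1 : g < 1).
Let pi := succ_pr a m s.
Hypothesis pi01 : forall h, 0 <= pi h <= 1.
Hypothesis law : transition_law X pi.

Let b := 1 - 2 * a.
Let b0 : 0 < b. Proof. by rewrite /b; have := g_ge; have := g_lt1; lra. Qed.

Lemma gam_dev_hist n0 n w : (2 <= n0 <= n)%N ->
  dev m (hist X n w) / gam a n = dev m (hist X n0 w) / gam a n0 +
  lin_process pi (fun h => (gam a (size h).+1)^-1) (hist X n w) -
  lin_process pi (fun h => (gam a (size h).+1)^-1) (hist X n0 w).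
Proof.
move=> /andP[n02]; elim: n => [|n IH]; first by rewrite leqn0; case: (n0) n02.
rewrite leq_eqVlt => /orP[/eqP <-|n0n]; first by ring.
have := gam_dev_cons m s a_geN1 (X n.+1 w) (h := hist X n w).
rewrite size_hist => /(_ (leq_trans n02 n0n)) /= ->.
by rewrite IH// size_hist -/pi; ring.
Qed.

Lemma hit_hist (B : pred (seq bool)) i n w : (i <= n)%N ->
  B (hist X i w) -> hit B (hist X n w).
Proof.
move=> + Bi; elim: n => [|n IH].
  by rewrite leqn0 => /eqP i0; move: Bi; rewrite i0 /= => ->.
rewrite leq_eqVlt => /orP[/eqP i1|ni]; first by move: Bi; rewrite i1 /= => ->.
by rewrite /= IH// orbT.
Qed.

(* [z] is a sign: both tails are treated at once. *)
Theorem upper_lil (z S2 eta kappa : R) (G : pred (seq bool)) :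
  z ^+ 2 = 1 -> 0 < S2 -> 0 < eta ->
  (forall h l, G h -> `|l| <= eta -> mgf (pi h) l <= expR (l ^+ 2 * S2 / 2)) ->
  0 < kappa -> S2 / b < kappa ^+ 2 ->
  {ae P, forall w, (\forall n \near \oo, G (hist X n w)) ->
    \forall n \near \oo, z * dev m (hist X n w) <= kappa * psi R n}.
Proof.
move=> z2 S20 eta0 mgfG kappa0 kappaS.
have z1 : `|z| = 1.
  by apply/eqP; rewrite -(@eqrXn2 _ 2) ?normr_ge0// real_normK ?num_real// z2 expr1n.
have Sb : 0 < S2 / b by rewrite divr_gt0.
pose r := kappa ^+ 2 / (S2 / b).
have r1 : 1 < r by rewrite ltr_pdivlMr// mul1r.
have r0 : 0 < r by lra.
(* The estimates cost nine factors [theta] in the square: four from the squared ratio of [gam], two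
   from [N k <= theta ^+ 2 * n], one each from [x], from [ln k] against [ln (ln n)] and from [varn].
   The tenth is the margin that swallows the initial constant. *)
pose theta := expR (ln r / 10).
have t1 : 1 < theta by rewrite expR_gt1 divr_gt0// ln_gt0.
have t0 : 0 < theta by lra.
have t10 : theta ^+ 10 = r by rewrite -expRM_natl mulrC divfK// lnK// posrE.
(* [N k] is the end of block [k], so one event at time [N k] controls every [n] in the block. With
   [x k] below, its probability is at most the power [- theta] of [k], which is summable. *)
pose N k := block theta k.+1.
have N2 k : (2 <= N k)%N by [].
pose x k : R := theta * ln k%:R.
pose B k := hit (fun h => Num.sqrt (2 * x k * (S2 * varn a (N k))) / gam a (N k) <=
  z * lin_process pi (gam_weight a G) h).
have [C HC] := sum_expR_ln_le t1.
have nvarn : \forall n \near \oo, `|varn a n - n%:R / b| <= Num.min (theta - 1) 2^-1 / b * n%:R.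
  apply: (near_varn a_geN1 g_ge g_gt0 g_lt1).
  by rewrite divr_gt0// lt_min; apply/andP; split; rewrite ?subr_gt0 ?invr_gt0.
have nv1 : \forall k \near \oo, varn a (N k) <= theta / b * (N k)%:R.
  have := near_block t1 nvarn; apply: filterS => k; rewrite ler_norml => /andP[_].
  have : Num.min (theta - 1) 2^-1 / b * (N k)%:R <= (theta - 1) / b * (N k)%:R.
    rewrite ler_wpM2r ?ler0n// ler_wpM2r ?invr_ge0 ?(ltW b0)//.
    by rewrite ge_min lexx.
  rewrite /N; set n := (block _ _)%:R.
  have -> : theta / b * n = (theta - 1) / b * n + n / b by field; rewrite gt_eqF.
  lra.
have nv2 : \forall k \near \oo, (N k)%:R / (2 * b) <= varn a (N k).
  have := near_block t1 nvarn; apply: filterS => k; rewrite ler_norml => /andP[+ _].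
  have : Num.min (theta - 1) 2^-1 / b * (N k)%:R <= 2^-1 / b * (N k)%:R.
    rewrite ler_wpM2r ?ler0n// ler_wpM2r ?invr_ge0 ?(ltW b0)//.
    by rewrite ge_min lexx orbT.
  rewrite /N; set n := (block _ _)%:R.
  have -> : n / (2 * b) = n / b - 2^-1 / b * n by field; rewrite gt_eqF.
  lra.
have small : \forall k \near \oo, forall j, (2 <= j <= N k)%N ->
    2 * x k * (gam a (N k) / gam a j) ^+ 2 <= eta ^+ 2 * (S2 * varn a (N k)).
  pose e := eta ^+ 2 * S2 / (2 * b) / (2 * theta ^+ 2).
  have e0 : 0 < e by rewrite !divr_gt0 ?mulr_gt0 ?exprn_gt0//.
  have := near_block t1 (near_gam_ratio a_geN1 g_ge g_gt0 g_lt1 e0) => ngr.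
  near=> k => j jN.
  have h1 : forall j, (2 <= j <= N k)%N ->
     ln (ln (N k)%:R) * (gam a (N k) / gam a j) ^+ 2 <= e * (N k)%:R by near: k.
  have h2 : forall n, theta ^+ k <= n%:R -> ln k%:R <= theta * ln (ln n%:R) :> R.
    by near: k; exact: near_ln_block.
  have h3 : (N k)%:R / (2 * b) <= varn a (N k) by near: k.
  have tN : theta ^+ k <= (N k)%:R.
    apply: (@le_trans _ _ (theta ^+ k.+1)); first by apply: ler_weXn2l => //; exact: ltW.
    have [h _] := block_bounds k.+1 t1.
    by apply: (le_trans h); rewrite ler_nat leq_pred.
  apply: (@le_trans _ _ (2 * theta ^+ 2 * (e * (N k)%:R))).
    apply: (@le_trans _ _ (2 * theta ^+ 2 * (ln (ln (N k)%:R) * (gam a (N k) / gam a j) ^+ 2))).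
      rewrite mulrA; apply: ler_wpM2r; first exact: sqr_ge0.
      rewrite /x expr2 !mulrA -!mulrA ler_wpM2l// ler_wpM2l ?(ltW t0)//.
      exact: h2.
    apply: ler_wpM2l; last exact: h1.
    by apply: mulr_ge0 => //; exact: sqr_ge0.
  have -> : 2 * theta ^+ 2 * (e * (N k)%:R) = eta ^+ 2 * (S2 * ((N k)%:R / (2 * b))).
    by rewrite /e; field; rewrite !gt_eqF.
  by rewrite ler_wpM2l ?sqr_ge0// ler_wpM2l// ltW.
have [k0 _ Hk0] := small.
have BC : {ae P, forall w, \forall k \near \oo, ~~ B k (hist X (N k) w)}.
  apply: (first_borel_cantelli (k0 := maxn k0 2) (C := C) law) => K.
  apply: (@le_trans _ _ (\sum_(maxn k0 2 <= k < K) expR (- x k))).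
    rewrite big_nat_cond [leRHS]big_nat_cond; apply: ler_sum => k.
    rewrite andbT => /andP[+ _]; rewrite geq_max => /andP[k0k k2].
    apply: (upper_block a_geN1 pi01 z2 S20 eta0 mgfG) => //.
      by rewrite mulr_gt0// ln_gt0// ltr1n.
    exact: Hk0.
  apply: le_trans (HC K).
  case: (leqP (maxn k0 2) K) => [hK|hK]; last first.
    by rewrite [leLHS]big_geq ?(ltnW hK)//; apply: sumr_ge0 => k _; exact: expR_ge0.
  rewrite [leRHS](big_cat_nat (n := maxn k0 2))//=; last by rewrite (leq_trans _ (leq_maxr _ _)).
  by rewrite lerDr sumr_ge0// => k _; exact: expR_ge0.
have nlb := near_ln_block t1.
pose kappa1 := Num.sqrt (theta ^+ 9 * (S2 / b)).
have k1k : kappa1 < kappa.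
  rewrite -(@ltr_pXn2r _ 2) ?nnegrE ?sqrtr_ge0 ?(ltW kappa0)//.
  rewrite sqr_sqrtr; last by rewrite mulr_ge0 ?exprn_ge0 ?(ltW t0) ?(ltW Sb).
  have -> : kappa ^+ 2 = theta ^+ 10 * (S2 / b) by rewrite t10 divfK// gt_eqF.
  by rewrite ltr_pM2r// (exprS theta 9) ltr_pMl ?exprn_gt0.
move: BC; apply: filterS => w nB [n1 _ Gn1].
pose n0 := maxn n1 2.
(* Everything that happened before the path became good enters only through this constant. *)
pose Cw := dev m (hist X n0 w) / gam a n0 - lin_process pi (gam_weight a G) (hist X n0 w).
have devE n : (n0 <= n)%N ->
    dev m (hist X n w) = gam a n * (Cw + lin_process pi (gam_weight a G) (hist X n w)).
  move=> n0n; have gn := gam_gt0 a_geN1 n.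
  have n02 : (2 <= n0 <= n)%N by rewrite n0n andbT leq_maxr.
  have := gam_dev_hist w n02; rewrite -addrA.
  rewrite (@lin_process_hist_eq _ _ _ _ _ _ _ (gam_weight a G) _ _ _ n0n); last first.
    move=> k /andP[n0k kn]; rewrite /gam_weight size_hist (leq_trans _ n0k) ?leq_maxr//=.
    by rewrite Gn1//= (leq_trans _ n0k)// leq_maxl.
  move=> H; rewrite -[LHS](divfK (_ : gam a n != 0)) ?gt_eqF// H /Cw; ring.
have gap : 0 < theta ^+ 2 - theta by rewrite expr2 subr_gt0 ltr_pMr.
have [k1 _ Hk] : \forall k \near \oo, [/\ ~~ B k (hist X (N k) w),
    forall n, theta ^+ k <= n%:R -> ln k%:R <= theta * ln (ln n%:R) :> R,
    2 / (theta ^+ 2 - theta) <= theta ^+ k & varn a (N k) <= theta / b * (N k)%:R].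
  near=> k; split; near: k => //; exact: near_exprn_ge.
near=> n.
have n0n : (n0 <= n)%N by near: n; exists n0.
have Nn : (block theta k1 <= n)%N by near: n; exists (block theta k1).
have L1 : 1 <= ln (ln n%:R) :> R by near: n; exact: near_lnln_ge.
have gC : `|Cw| * gam a n <= (kappa - kappa1) * Num.sqrt n%:R.
  by near: n; apply: (near_gam_le a_geN1 g_ge g_gt0 g_lt1); rewrite subr_gt0.
have [k k1k' /andP[kn nk]] := block_cover (block_homo t1) (block_unbounded n t1) Nn.
have [nBk hln hgap hv] := Hk k k1k'.
have nN : (n <= N k)%N by exact: ltnW.
have n2 : (2 <= n)%N by rewrite (leq_trans _ n0n)// leq_maxr.
have lin_le : z * lin_process pi (gam_weight a G) (hist X n w) <=
    Num.sqrt (2 * x k * (S2 * varn a (N k))) / gam a (N k).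
  rewrite leNgt; apply/negP => H; move/negP: nBk; apply; rewrite /B.
  by apply: (hit_hist nN); rewrite ltW.
have gn := gam_gt0 a_geN1 n; have gN := gam_gt0 a_geN1 (N k).
have [bk1 _] := block_bounds k t1.
have [_ bk2] := block_bounds k.+1 t1.
have tk0 : 0 < theta ^+ k by rewrite exprn_gt0.
have tn1 : theta ^+ k <= n.-1%:R.
  by apply: (le_trans bk1); rewrite ler_nat -!subn1 leq_sub2r.
have tn : theta ^+ k <= n%:R by apply: (le_trans tn1); rewrite ler_nat leq_pred.
have gap2 : theta ^+ k.+1 + 2 <= theta ^+ 2 * theta ^+ k.
  by move: hgap; rewrite ler_pdivrMr// (exprS theta k); set tk := theta ^+ k; lra.
have ratio : gam a n / gam a (N k) <= theta ^+ 2.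
  have nNk : (2 <= n <= N k)%N by rewrite n2.
  have n10 : 0 < n.-1%:R :> R by apply: lt_le_trans tn1.
  have N10 : 0 < (N k).-1%:R :> R by [].
  have h : n.-1%:R * gam a n <= gam a (N k) * (N k).-1%:R.
    by have := gam_ratio_ge a_geN1 nNk; rewrite ler_pdivrMr// mulrAC ler_pdivlMr.
  rewrite ler_pdivrMr// -(ler_pM2l n10); apply: (le_trans h).
  rewrite [leRHS](_ : _ = gam a (N k) * (theta ^+ 2 * n.-1%:R)); last by ring.
  rewrite ler_wpM2l ?(ltW gN)//.
  apply: (@le_trans _ _ (theta ^+ 2 * theta ^+ k)); last by rewrite ler_wpM2l// sqr_ge0.
  by apply: le_trans gap2; apply: le_trans bk2; rewrite ler_nat leq_pred.
have Nn2 : (N k)%:R <= theta ^+ 2 * n%:R.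
  by apply: (le_trans bk2); apply: (le_trans gap2); rewrite ler_wpM2l// sqr_ge0.
rewrite devE//.
have psi_n : Num.sqrt n%:R <= psi R n.
  by apply: ler_wsqrtr; have : 0 <= n%:R :> R by []; nra.
have nL0 : 0 <= 2 * n%:R * ln (ln n%:R) :> R.
  by apply: mulr_ge0; [exact: mulr_ge0|exact: le_trans L1].
have main : gam a n / gam a (N k) * Num.sqrt (2 * x k * (S2 * varn a (N k))) <=
   kappa1 * psi R n.
  rewrite -(@ler_pXn2r _ 2) ?nnegrE ?mulr_ge0 ?sqrtr_ge0 ?invr_ge0 ?(ltW gn) ?(ltW gN)//.
  have lnk : 0 <= ln k%:R :> R.
    case: (k) => [|k']; first by rewrite ln0.
    by rewrite ln_ge0// ler1n.
  have xk0 : 0 <= x k by rewrite mulr_ge0 ?(ltW t0).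
  have vN0 := varn_ge0 a (N k).
  have xN0 : 0 <= 2 * x k * (S2 * varn a (N k)).
    apply: mulr_ge0; first exact: mulr_ge0.
    by apply: mulr_ge0 => //; exact: ltW.
  rewrite exprMn (sqr_sqrtr xN0).
  rewrite [leRHS]exprMn !sqr_sqrtr; last 2 first.
  - exact: nL0.
  - by rewrite mulr_ge0 ?exprn_ge0 ?(ltW t0) ?(ltW Sb).
  apply: (@le_trans _ _ ((theta ^+ 2) ^+ 2 * (2 * x k * (S2 * varn a (N k))))).
    rewrite (ler_wpM2r xN0)// lerXn2r ?nnegrE ?sqr_ge0//.
    by rewrite divr_ge0// ltW.
  have -> : theta ^+ 9 * (S2 / b) * (2 * n%:R * ln (ln n%:R)) =
    (theta ^+ 2) ^+ 2 * (2 * (theta * (theta * ln (ln n%:R))) *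
      (S2 * (theta / b * (theta ^+ 2 * n%:R)))) by field; rewrite gt_eqF.
  rewrite ler_wpM2l ?sqr_ge0//; apply: ler_pM.
  - exact: mulr_ge0.
  - by apply: mulr_ge0 => //; exact: ltW.
  - by rewrite ler_wpM2l// ler_wpM2l ?(ltW t0)//; exact: hln.
  rewrite ler_wpM2l ?(ltW S20)//; apply: (le_trans hv).
  by rewrite ler_wpM2l// divr_ge0 ?(ltW t0) ?(ltW b0).
have zC : z * Cw <= `|Cw| by apply: le_trans (ler_norm _) _; rewrite normrM z1 mul1r.
have -> : z * (gam a n * (Cw + lin_process pi (gam_weight a G) (hist X n w))) =
  gam a n * (z * Cw) + gam a n * (z * lin_process pi (gam_weight a G) (hist X n w)) by ring.
have e1 := ler_wpM2l (ltW gn) zC.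
have e2 := ler_wpM2l (ltW gn) lin_le.
have e3 : gam a n * (Num.sqrt (2 * x k * (S2 * varn a (N k))) / gam a (N k)) <= kappa1 * psi R n.
  by apply: le_trans main; rewrite le_eqVlt; apply/orP; left; apply/eqP; ring.
have e4 : (kappa - kappa1) * Num.sqrt n%:R <= (kappa - kappa1) * psi R n.
  by rewrite ler_wpM2l// subr_ge0 ltW.
lra.
Unshelve. all: by end_near. Qed.

End upper_law.

(** * Lower half of the law of the iterated logarithm *)

Section lower_block.
Variables (R : realType) (pi : seq bool -> R) (G : pred (seq bool)) (w : nat -> R)
  (z S dl eta : R).
Hypothesis pi01 : forall h, 0 <= pi h <= 1.
Hypotheses (z2 : z ^+ 2 = 1) (S_gt0 : 0 < S) (dl_ge0 : 0 <= dl) (w_ge0 : forall k, 0 <= w k).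
Hypothesis mgfG : forall h l, G h -> `|l| <= eta ->
  expR (l ^+ 2 * (S * (1 - dl)) / 2) <= mgf (pi h) l <= expR (l ^+ 2 * (S * (1 + dl)) / 2).

Definition good_weight h : R := if G h then z * w (size h) else 0.
Definition bad_variance h : R := if G h then 0 else w (size h) ^+ 2.

(* The bad steps contribute the deterministic factor a good step would have in
   mean, so the moments of [W] are controlled on every path; on the event that
   all steps are good, [W l = expR (l * lin_process pi good_weight)]. *)
Let W l h := expR (l * lin_process pi good_weight h +
                   l ^+ 2 * S / 2 * past_sum bad_variance h).

Let step_W l h : (forall k, `|l * w k| <= eta) ->
  expR (l ^+ 2 * (S * (1 - dl)) / 2 * w (size h) ^+ 2) * W l h <= step_mean pi (W l) h <=
  expR (l ^+ 2 * (S * (1 + dl)) / 2 * w (size h) ^+ 2) * W l h.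
Proof.
move=> lw; rewrite /W step_mean_exp -/(W l h) !(mulrC _ (W l h)) !ler_pM2l ?expR_gt0//.
rewrite /bad_variance /good_weight; case: ifP => Gh.
  rewrite mulr0 expR0 mul1r.
  have lz : `|l * (z * w (size h))| <= eta.
    rewrite mulrCA normrM (_ : `|z| = 1) ?mul1r ?lw//.
    by apply/eqP; rewrite -(@eqrXn2 _ 2) ?normr_ge0// real_normK ?num_real// z2 expr1n.
  have := mgfG Gh lz.
  have lE y : (l * (z * w (size h))) ^+ 2 * y / 2 = l ^+ 2 * y / 2 * w (size h) ^+ 2.
    by rewrite !exprMn z2; ring.
  by rewrite !lE.
rewrite mulr0 mgf0 mulr1 !ler_expR.
have q : 0 <= l ^+ 2 * S / 2 * w (size h) ^+ 2.
  by rewrite mulr_ge0 ?sqr_ge0// divr_ge0// mulr_ge0 ?sqr_ge0// ltW.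
have -> : l ^+ 2 * (S * (1 - dl)) / 2 * w (size h) ^+ 2 =
  (1 - dl) * (l ^+ 2 * S / 2 * w (size h) ^+ 2) by ring.
have -> : l ^+ 2 * (S * (1 + dl)) / 2 * w (size h) ^+ 2 =
  (1 + dl) * (l ^+ 2 * S / 2 * w (size h) ^+ 2) by ring.
by have h0 := mulr_ge0 dl_ge0 q; apply/andP; split; lra.
Qed.

Let mean_W l n h : (forall k, `|l * w k| <= eta) ->
  lin_process pi good_weight h = 0 -> past_sum bad_variance h = 0 ->
  expR (l ^+ 2 * (S * (1 - dl)) / 2 * \sum_(size h <= k < size h + n) w k ^+ 2) <=
  mean pi n (W l) h <=
  expR (l ^+ 2 * (S * (1 + dl)) / 2 * \sum_(size h <= k < size h + n) w k ^+ 2).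
Proof.
move=> lw L0 D0.
have W1 : W l h = 1 by rewrite /W L0 D0 !mulr0 addr0 expR0.
have Wge h' : 0 <= W l h' by exact: expR_ge0.
apply/andP; split.
- have := @mean_exp_ge R pi pi01 (fun k => l ^+ 2 * (S * (1 - dl)) / 2 * w k ^+ 2) 0 n (W l) h Wge.
  rewrite W1 mulr1 -mulr_sumr; apply => // h' _.
  by have /andP[] := step_W h' lw.
- have := @mean_exp_le R pi pi01 (fun k => l ^+ 2 * (S * (1 + dl)) / 2 * w k ^+ 2) 0 n (W l) h Wge.
  rewrite W1 mulr1 -mulr_sumr; apply => // h' _.
  by have /andP[] := step_W h' lw.
Qed.

(* The exponential moment at [lam] is carried neither by the paths below [x]
   (compare with the moment at [(1 - rho) * lam]) nor by those where [W lam]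
   exceeds [T] (compare with [(1 + rho) * lam]); so at least half of it comes
   from the event below, on which it is at most [T]. *)
Lemma lower_block n h rho lam :
  let B := \sum_(size h <= k < size h + n) w k ^+ 2 in
  let Lam := lam ^+ 2 * S * B / 2 in
  let x := (1 - rho) * (lam * S * B) in
  0 < rho < 1 -> dl = rho ^+ 2 / 10 -> 0 <= lam ->
  (forall k, (1 + rho) * lam * w k <= eta) ->
  expR (- (Lam * (rho ^+ 2 / 2))) <= 4^-1 ->
  lin_process pi good_weight h = 0 -> past_sum bad_variance h = 0 ->
  expR (- (Lam * (1 + 3 * rho))) / 2 <=
  mean pi n (fun h => ((x <= lin_process pi good_weight h) ||
                       (past_sum bad_variance h != 0))%:R) h.
Proof.
move=> B Lam x /andP[r0 r1] dlE lam0 lw small L0 D0.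
have B0 : 0 <= B by apply: sumr_ge0 => k _; exact: sqr_ge0.
have Lam0 : 0 <= Lam by rewrite divr_ge0// mulr_ge0// mulr_ge0 ?sqr_ge0// ltW.
pose A h := (x <= lin_process pi good_weight h) || (past_sum bad_variance h != 0).
pose T := expR (Lam * (2 + 2 * rho)).
pose T' := expR (- (rho * (Lam * (2 + 2 * rho)))).
pose E := expR (rho * (lam * x)).
have D_ge0 h' : 0 <= past_sum bad_variance h'.
  elim: h' => //= y h' IH; rewrite addr_ge0// /bad_variance; case: ifP => // _.
  exact: sqr_ge0.
(* Above [T], raising [W lam] to the power [1 + rho] gains the factor [T'], and the nonnegative bad
   variance may even be multiplied by the square of [1 + rho]. Off the event, a share [rho] of the
   exponent is at most [rho * (lam * x)], which is paid by [E]. *)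
have key h' : W lam h' <= E * W ((1 - rho) * lam) h' +
    (T * (A h')%:R + T' * W ((1 + rho) * lam) h').
  have t1 : 0 <= E * W ((1 - rho) * lam) h' by rewrite mulr_ge0 ?expR_ge0.
  have t3 : 0 <= T' * W ((1 + rho) * lam) h' by rewrite mulr_ge0 ?expR_ge0.
  case: (boolP (A h')) => [Ah|].
    rewrite mulr1; case: (lerP (W lam h') T) => WT; first lra.
    suff : W lam h' <= T' * W ((1 + rho) * lam) h' by have := expR_ge0 (Lam * (2 + 2 * rho)); rewrite -/T; lra.
    rewrite /T' /W -expRD ler_expR.
    move: WT; rewrite /T /W ltr_expR => WT.
    set L := lin_process _ _ _ in WT *; set D := past_sum _ _ in WT *.
    have q : 0 <= lam ^+ 2 * S / 2 * D.
      by rewrite mulr_ge0 ?D_ge0// divr_ge0// mulr_ge0 ?sqr_ge0// ltW.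
    have -> : ((1 + rho) * lam) ^+ 2 * S / 2 * D = (1 + rho) ^+ 2 * (lam ^+ 2 * S / 2 * D) by ring.
    have -> : (1 + rho) * lam * L = (1 + rho) * (lam * L) by ring.
    set u := lam * L in WT *; set v := _ * D in WT q *; set t := Lam * _ in WT *.
    by have := ler_wpM2l (ltW r0) (ltW WT); nra.
  rewrite /A negb_or -ltNge negbK => /andP[Lx /eqP D'].
  suff : W lam h' <= E * W ((1 - rho) * lam) h' by rewrite mulr0; lra.
  rewrite /E /W D' !mulr0 !addr0 -expRD ler_expR.
  have := ler_wpM2l (mulr_ge0 (ltW r0) lam0) (ltW Lx); lra.
have lwr c : 0 <= c <= 1 + rho -> forall k, `|c * lam * w k| <= eta.
  move=> /andP[c0 c1] k; rewrite ger0_norm ?mulr_ge0//.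
  by apply: le_trans (lw k); rewrite ler_wpM2r// ler_wpM2r.
have c1 : 0 <= (1 : R) <= 1 + rho by apply/andP; split; lra.
have c2 : 0 <= 1 - rho <= 1 + rho by apply/andP; split; lra.
have c3 : 0 <= 1 + rho <= 1 + rho by apply/andP; split; lra.
have /andP[m1 _] := mean_W n (lwr 1 c1) L0 D0.
have /andP[_ m2] := mean_W n (lwr (1 - rho) c2) L0 D0.
have /andP[_ m3] := mean_W n (lwr (1 + rho) c3) L0 D0.
rewrite mul1r in m1.
have M : mean pi n (W lam) h <= E * mean pi n (W ((1 - rho) * lam)) h +
    (T * mean pi n (fun h => (A h)%:R) h + T' * mean pi n (W ((1 + rho) * lam)) h).
  by rewrite -!meanZ -!mean_add; apply: mean_le.
pose p := mean pi n (fun h => (A h)%:R) h; rewrite -[leRHS]/p; rewrite -/p in M.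
rewrite -/B in m1 m2 m3; pose Lo := expR (Lam * (1 - dl)).
have dl0 : 0 <= rho ^+ 2 by exact: sqr_ge0.
(* In units of [Lam], both competing moments have exponent at most [1 - rho ^+ 2 + 4 * dl], against
   [1 - dl] for the main one. The choice [dl = rho ^+ 2 / 10] leaves exactly the gap [rho ^+ 2 / 2],
   worth a factor 1/4 by hypothesis. *)
have quarter v : v <= 1 - dl - rho ^+ 2 / 2 -> expR (Lam * v) <= Lo * 4^-1.
  move=> hv; apply: (@le_trans _ _ (Lo * expR (- (Lam * (rho ^+ 2 / 2))))).
    rewrite /Lo -expRD ler_expR; have := ler_wpM2l Lam0 hv; lra.
  by rewrite ler_wpM2l ?expR_ge0.
have h1 : Lo <= mean pi n (W lam) h.
  by apply: le_trans m1; rewrite /Lo ler_expR /Lam le_eqVlt; apply/orP; left; apply/eqP; ring.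
have h2 : E * mean pi n (W ((1 - rho) * lam)) h <= Lo * 4^-1.
  apply: le_trans (ler_wpM2l (expR_ge0 _) m2) _; rewrite -expRD.
  have -> : rho * (lam * x) + ((1 - rho) * lam) ^+ 2 * (S * (1 + dl)) / 2 * B =
      Lam * (2 * rho * (1 - rho) + (1 - rho) ^+ 2 * (1 + dl)) by rewrite /x /Lam; field.
  by apply: quarter; rewrite dlE; nra.
have h3 : T' * mean pi n (W ((1 + rho) * lam)) h <= Lo * 4^-1.
  apply: le_trans (ler_wpM2l (expR_ge0 _) m3) _; rewrite -expRD.
  have -> : - (rho * (Lam * (2 + 2 * rho))) +
      ((1 + rho) * lam) ^+ 2 * (S * (1 + dl)) / 2 * B =
      Lam * ((1 + rho) ^+ 2 * (1 + dl) - rho * (2 + 2 * rho)) by rewrite /Lam; field.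
  apply: quarter; rewrite dlE.
  have r4 : (1 + rho) ^+ 2 <= 4 by nra.
  by have := ler_wpM2l dl0 r4; lra.
have h4 : Lo / 2 <= T * p by lra.
have T0 : 0 < T by exact: expR_gt0.
rewrite -(ler_pM2l T0); apply: le_trans h4.
rewrite mulrA ler_wpM2r ?invr_ge0// /T /Lo -expRD ler_expR.
have : dl <= rho by rewrite dlE; nra.
by move/(ler_wpM2l Lam0); lra.
Qed.

End lower_block.

(** Each factor is at most [(k + 3) / (k + 2)] to the power [- D], so the product telescopes to a
    power decay in [K]. *)
Lemma prod_harmonic_le (R : realType) (D : R) k1 e : 0 < D -> 0 < e ->
  (forall k, (k1 <= k)%N -> 0 <= 1 - D / k.+2%:R) ->
  exists2 K, (k1 <= K)%N & \prod_(k1 <= k < K) (1 - D / k.+2%:R) <= e.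
Proof.
move=> D0 e0 pos.
have H K : (k1 <= K)%N ->
    \prod_(k1 <= k < K) (1 - D / k.+2%:R) <= expR (- (D * (ln K.+2%:R - ln k1.+2%:R))).
  elim: K => [|K IH]; first by rewrite leqn0 => /eqP ->; rewrite big_geq// subrr mulr0 oppr0 expR0.
  rewrite leq_eqVlt => /orP[/eqP <-|k1K].
    by rewrite big_geq// subrr mulr0 oppr0 expR0.
  rewrite big_nat_recr//=.
  have -> : - (D * (ln K.+3%:R - ln k1.+2%:R)) =
    - (D * (ln K.+2%:R - ln k1.+2%:R)) + - (D * (ln K.+3%:R - ln K.+2%:R)) by ring.
  rewrite expRD; apply: ler_pM; [|exact: pos|exact: IH|].
    by rewrite big_nat_cond; apply: prodr_ge0 => k /andP[/andP[kk _] _]; exact: pos.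
  apply: le_trans (expR_ge1Dx _); rewrite lerD2l lerN2 ler_wpM2l ?(ltW D0)//.
  have h : K.+3%:R / K.+2%:R = 1 + K.+2%:R^-1 :> R.
    by rewrite -[K.+3%:R]natr1 mulrDl divff ?mul1r// pnatr_eq0.
  rewrite -ln_div ?posrE ?ltr0n// h; apply: le_ln1Dx.
  by apply: (@lt_le_trans _ _ 0); rewrite ?ltrN10// invr_ge0.
near \oo => K; exists K; first by near: K; exists k1.
apply: le_trans (H K _) _; first by near: K; exists k1.
rewrite -[e]lnK ?posrE// ler_expR lerNl -ler_pdivrMl// lerBrDr.
apply: (@le_trans _ _ (ln K%:R)); first by near: K; exact: near_ln_ge.
by rewrite ler_ln ?posrE ?ltr0n ?ler_nat//; [rewrite -addn2 leq_addr|near: K; exists 1%N].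
Unshelve. all: by end_near. Qed.

Section lower_law.
Context (R : realType) (d : measure_display) (T : measurableType d)
  (P : probability T R) (X : nat -> {RV P >-> bool}) (a m s g : R).
Hypotheses (a_geN1 : -1 <= a) (g_ge : 2 * a <= g) (g_gt0 : 0 < g) (g_lt1 : g < 1).
Let pi := succ_pr a m s.
Hypothesis pi01 : forall h, 0 <= pi h <= 1.
Hypothesis law : transition_law X pi.

Let b := 1 - 2 * a.
Let b0 : 0 < b. Proof. by rewrite /b; have := g_ge; have := g_lt1; lra. Qed.

Lemma lin_process0 c h : (forall k h', (k < size h)%N -> size h' = k -> c h' = 0) ->
  lin_process pi c h = 0.
Proof.
elim: h => //= x h IH c0; rewrite IH ?(c0 (size h))// ?mul0r ?addr0// => k h' kh.
by apply: c0; rewrite ltnW.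
Qed.

Lemma past_sum0 (c : seq bool -> R) h : (forall k h', (k < size h)%N -> size h' = k -> c h' = 0) ->
  past_sum c h = 0.
Proof.
elim: h => //= x h IH c0; rewrite IH ?(c0 (size h))// ?addr0// => k h' kh.
by apply: c0; rewrite ltnW.
Qed.

Lemma past_sum_hist0 (c : seq bool -> R) n w :
  (forall k, (k < n)%N -> c (hist X k w) = 0) -> past_sum c (hist X n w) = 0.
Proof.
elim: n => //= n IH c0; rewrite IH ?c0 ?addr0// => k kn.
by apply: c0; rewrite ltnW.
Qed.

(** The weights with which the innovations of the block from [n] to [n'] enter [dev] at its end. *)
Definition window (n n' i : nat) : R :=
  if (n <= i < n')%N then gam a n' / gam a i.+1 else 0.

Lemma window_ge0 n n' i : 0 <= window n n' i.
Proof. by rewrite /window; case: ifP => // _; rewrite divr_ge0// ltW ?gam_gt0. Qed.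

Lemma sum_window n n' : (2 <= n <= n')%N ->
  \sum_(n <= k < n') window n n' k ^+ 2 = varn a n' - (gam a n' / gam a n) ^+ 2 * varn a n.
Proof.
move=> nn'; rewrite -(sum_sqr_gam_ratio a_geN1 nn').
by apply: eq_big_nat => k kn; rewrite /window kn.
Qed.

(** The bound with [C0] is an upper law for the opposite sign: it keeps the history before a block
    from cancelling what the block contributes. A [G] is asked for at every accuracy [e], since the
    accuracy needed depends on the gap between [kappa ^+ 2] and [S / b]. *)
Theorem lower_lil (z S kappa C0 : R) :
  z ^+ 2 = 1 -> 0 < S ->
  (forall e : R, 0 < e -> exists (G : pred (seq bool)) (eta : R), [/\ 0 < eta,
     (forall h (l : R), G h -> `|l| <= eta ->
        expR (l ^+ 2 * (S - e) / 2) <= mgf (pi h) l <= expR (l ^+ 2 * (S + e) / 2)) &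
     {ae P, forall w, \forall n \near \oo, G (hist X n w)}]) ->
  0 <= C0 ->
  {ae P, forall w, \forall n \near \oo, - (z * dev m (hist X n w)) <= C0 * psi R n} ->
  0 <= kappa -> kappa ^+ 2 < S / b ->
  {ae P, forall w, forall N, exists2 n, (N <= n)%N &
    kappa * psi R n <= z * dev m (hist X n w)}.
Proof.
move=> z2 S0 hG C00 hC kappa0 kappaS.
have Sb : 0 < S / b by rewrite divr_gt0.
pose k1 := Num.sqrt (S / b).
have k1k : kappa < k1.
  by rewrite -(@ltr_pXn2r _ 2) ?nnegrE ?sqrtr_ge0// sqr_sqrtr// ltW.
have k1p : 0 < 5 * k1 + 1 by have := sqrtr_ge0 (S / b); rewrite -/k1; lra.
(* The block will yield [(1 - rho) * (1 - 4 * rho) * k1] and its past may take away [rho]; what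
   remains is at least [kappa] once [rho * (5 * k1 + 1) <= k1 - kappa]. *)
pose rho := Num.min ((k1 - kappa) / (5 * k1 + 1)) 10^-1.
have rho0 : 0 < rho by rewrite lt_min divr_gt0 ?subr_gt0//= invr_gt0.
have rho1 : rho <= 10^-1 by rewrite ge_min lexx orbT.
have rhok : rho * (5 * k1 + 1) <= k1 - kappa.
  by rewrite -ler_pdivlMr// ge_min lexx.
(* The first bound makes the variance inherited from before the block a small share of the total;
   the second makes the inherited part of [dev] at most [rho * psi] at the end of the block. *)
pose e := Num.min (rho / 8) (rho ^+ 2 / (2 * C0 ^+ 2 + 1)).
have C2 : 0 < 2 * C0 ^+ 2 + 1 by have := sqr_ge0 C0; lra.
have e0 : 0 < e by rewrite lt_min !divr_gt0// exprn_gt0.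
have e1 : 8 * e <= rho by rewrite mulrC -ler_pdivlMr// ge_min lexx.
have e2 : (2 * C0 ^+ 2 + 1) * e <= rho ^+ 2 by rewrite mulrC -ler_pdivlMr// ge_min lexx orbT.
clearbody e; clearbody rho.
have r1 : 0 < 1 - rho by lra.
have r3 : 0 < 1 + 3 * rho by lra.
have r4 : 0 <= 1 - 4 * rho by lra.
have r5 : (1 + rho) ^+ 2 <= 4 by nra.
have r6 : (1 - 4 * rho) ^+ 2 <= (1 - rho) / (1 + 3 * rho) by rewrite ler_pdivlMr//; nra.
have kap : kappa <= (1 - rho) * (1 - 4 * rho) * k1 - rho.
  by have := sqrtr_ge0 (S / b); rewrite -/k1; have := sqr_ge0 rho; nra.
have e3 : 2 * C0 ^+ 2 * e <= rho ^+ 2 by move: e2; rewrite mulrDl mul1r; lra.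
have half : 2^-1 <= 1 - rho by lra.
(* The squared ratio of [gam] over a block is at most twice the power [g] of [K], hence at most
   [2 * e * K]: this fixes the growth factor of the blocks. *)
have [K K2 Kg] : exists2 K, (2 <= K)%N & K%:R `^ g <= e * K%:R.
  near \oo => K; exists K; first by near: K; exists 2%N.
  apply: (@le_trans _ _ (ln K%:R * K%:R `^ g)).
    by rewrite ler_peMl ?powR_ge0//; near: K; exact: near_ln_ge.
  by near: K; exact: near_ln_powR_le.
have K0 : 0 < K%:R :> R by rewrite ltr0n (leq_trans _ K2).
pose N k := (K ^ k.+1)%N.
have NS k : N k.+1 = (K * N k)%N by rewrite /N expnS.
have Nk k : (k < N k)%N by apply: (leq_trans (ltnSn k)); apply: ltnW; exact: ltn_expl.
have N2 k : (2 <= N k)%N by rewrite /N (leq_trans K2)// -{1}(expn1 K) leq_exp2l.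
have Nm : {homo N : i j / (i <= j)%N} by move=> i j ij; rewrite /N leq_exp2l.
have N0 k : 0 < (N k)%:R :> R by rewrite ltr0n (leq_trans _ (N2 k)).
have nearN (Q : nat -> Prop) : (\forall n \near \oo, Q n) -> \forall k \near \oo, Q (N k).
  by move=> [M _ QM]; exists M => // k /= Mk; apply: QM => /=; rewrite (leq_trans Mk)// ltnW.
have nearNS (Q : nat -> Prop) : (\forall n \near \oo, Q n) -> \forall k \near \oo, Q (N k.+1).
  by move=> [M _ QM]; exists M => // k /= Mk; apply: QM => /=; rewrite (leq_trans Mk)// ltnW// ltnW.
have eS : 0 < S * (rho ^+ 2 / 10) by rewrite mulr_gt0// divr_gt0// exprn_gt0.
have [G [eta [eta0 mgfG Gae]]] := hG _ eS.
pose w k := window (N k) (N k.+1).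
pose Bv k := \sum_(N k <= i < N k.+1) w k i ^+ 2.
have NN k : (2 <= N k <= N k.+1)%N by rewrite N2 Nm.
have ratioN k : (N k.+1)%:R / (N k)%:R = K%:R :> R.
  by rewrite NS natrM mulfK// gt_eqF.
have c2 k : (gam a (N k.+1) / gam a (N k)) ^+ 2 <= 2 * (e * K%:R).
  apply: le_trans (gam_ratio_le a_geN1 g_ge g_gt0 g_lt1 (NN k)) _.
  by rewrite ratioN ler_wpM2l.
have nB : \forall k \near \oo, (1 - rho) * (N k.+1)%:R / b <= Bv k.
  have d1 : 0 < rho / (2 * b) by rewrite divr_gt0// mulr_gt0.
  have d2 : 0 < b^-1 by rewrite invr_gt0.
  have n1 := nearNS _ (near_varn a_geN1 g_ge g_gt0 g_lt1 d1).
  have n2 := nearN _ (near_varn a_geN1 g_ge g_gt0 g_lt1 d2).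
  near=> k.
  have h1 : `|varn a (N k.+1) - (N k.+1)%:R / b| <= rho / (2 * b) * (N k.+1)%:R by near: k.
  have h2 : `|varn a (N k) - (N k)%:R / b| <= b^-1 * (N k)%:R by near: k.
  move: h1 h2; rewrite !ler_norml => /andP[h1 _] /andP[_ h2].
  rewrite /Bv /w sum_window//.
  have v2 : varn a (N k) <= 2 * ((N k)%:R / b).
    by move: h2; rewrite mulrC; lra.
  have v3 : (gam a (N k.+1) / gam a (N k)) ^+ 2 * varn a (N k) <=
      2 * (e * K%:R) * (2 * ((N k)%:R / b)).
    by apply: ler_pM => //; [exact: sqr_ge0|exact: varn_ge0].
  have v4 : 2 * (e * K%:R) * (2 * ((N k)%:R / b)) = 4 * e * ((N k.+1)%:R / b).
    by rewrite NS natrM; ring.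
  have v5 : 0 <= (N k.+1)%:R / b by rewrite divr_ge0// ltW.
  have v6 : 8 * e * ((N k.+1)%:R / b) <= rho * ((N k.+1)%:R / b) by rewrite ler_wpM2r.
  have v7 : rho / (2 * b) * (N k.+1)%:R = rho / 2 * ((N k.+1)%:R / b) by field; rewrite gt_eqF.
  have -> : (1 - rho) * (N k.+1)%:R / b = (1 - rho) * ((N k.+1)%:R / b) by ring.
  by move: h1 v3; rewrite v7 v4; lra.
pose L k : R := ln (ln (N k.+1)%:R).
(* With this divisor the block bound becomes [expR (- L k) / 2], which is the inverse of
   [2 * ln K * (k + 2)]: a divergent harmonic series. The tilt [lam k] below solves
   [lam k ^+ 2 * S * Bv k / 2 = Lam k]. *)
pose Lam k := L k / (1 + 3 * rho).
pose lam k := Num.sqrt (2 * Lam k / (S * Bv k)).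
have nL M : \forall k \near \oo, M <= L k by exact: (nearNS _ (near_lnln_ge M)).
have lam2 k : 0 <= L k -> lam k ^+ 2 = 2 * Lam k / (S * Bv k).
  move=> Lk0; rewrite sqr_sqrtr// divr_ge0//.
    by rewrite mulr_ge0// divr_ge0// ltW.
  by rewrite mulr_ge0 ?(ltW S0)//; apply: sumr_ge0 => ? _; exact: sqr_ge0.
have nsmall : \forall k \near \oo, forall i, (1 + rho) * lam k * w k i <= eta.
  pose e4 := eta ^+ 2 * S / (16 * b).
  have e40 : 0 < e4 by rewrite divr_gt0// mulr_gt0// exprn_gt0.
  have n1 := nearNS _ (near_gam_ratio a_geN1 g_ge g_gt0 g_lt1 e40).
  have nL0 := nL 0.
  near=> k => i; have lam0 : 0 <= lam k by exact: sqrtr_ge0.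
  rewrite /w /window; case: ifP => ik; last by rewrite mulr0 ltW.
  have h1 : forall j, (2 <= j <= N k.+1)%N ->
      L k * (gam a (N k.+1) / gam a j) ^+ 2 <= e4 * (N k.+1)%:R by near: k.
  have h2 : (1 - rho) * (N k.+1)%:R / b <= Bv k by near: k.
  have Lk0 : 0 <= L k by near: k.
  have [ik1 ik2] := andP ik.
  have /h1 h3 : (2 <= i.+1 <= N k.+1)%N by rewrite ik2 (leq_trans (N2 k))// leqW.
  have B0 : 0 < Bv k.
    by apply: lt_le_trans h2; rewrite divr_gt0// mulr_gt0.
  have SB0 : 0 < S * Bv k by rewrite mulr_gt0.
  rewrite -(@ler_pXn2r _ 2) ?nnegrE ?(ltW eta0)//; last first.
    apply: mulr_ge0; last by rewrite divr_ge0// ltW// gam_gt0.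
    by apply: mulr_ge0 => //; rewrite addr_ge0// ltW.
  rewrite 2!exprMn lam2//.
  have LamL : Lam k <= L k by rewrite ler_pdivrMr// ler_peMr// lerDl mulr_ge0// ltW.
  apply: (@le_trans _ _ (4 * (2 * L k / (S * Bv k)) * (gam a (N k.+1) / gam a i.+1) ^+ 2)).
    rewrite ler_wpM2r ?sqr_ge0//; apply: ler_pM; rewrite ?sqr_ge0//.
    - rewrite divr_ge0 ?(ltW SB0)// mulr_ge0// divr_ge0// ltW//.
    - by rewrite ler_wpM2r ?invr_ge0 ?(ltW SB0)// ler_wpM2l.
  have -> : 4 * (2 * L k / (S * Bv k)) * (gam a (N k.+1) / gam a i.+1) ^+ 2 =
      8 * (L k * (gam a (N k.+1) / gam a i.+1) ^+ 2) / (S * Bv k) by ring.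
  rewrite ler_pdivrMr//.
  apply: (@le_trans _ _ (8 * (e4 * (N k.+1)%:R))); first by rewrite ler_wpM2l.
  apply: (@le_trans _ _ (eta ^+ 2 * (S * ((1 - rho) * (N k.+1)%:R / b)))); last first.
    by rewrite ler_wpM2l ?sqr_ge0// ler_wpM2l// ltW.
  have -> : 8 * (e4 * (N k.+1)%:R) = 2^-1 * (eta ^+ 2 * S * (N k.+1)%:R / b).
    by rewrite /e4; field; rewrite gt_eqF.
  have -> : eta ^+ 2 * (S * ((1 - rho) * (N k.+1)%:R / b)) =
    (1 - rho) * (eta ^+ 2 * S * (N k.+1)%:R / b) by ring.
  rewrite ler_wpM2r//.
  by rewrite divr_ge0 ?(ltW b0)// mulr_ge0// mulr_ge0 ?sqr_ge0// ltW.
have nLam : \forall k \near \oo, expR (- (Lam k * (rho ^+ 2 / 2))) <= 4^-1.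
  near=> k; rewrite -[4^-1]lnK ?posrE ?invr_gt0// ler_expR.
  have q : 0 < rho ^+ 2 / 2 / (1 + 3 * rho) by rewrite !divr_gt0// exprn_gt0.
  have : (- ln 4^-1) / (rho ^+ 2 / 2 / (1 + 3 * rho)) <= L k by near: k; exact: nL.
  rewrite ler_pdivrMr// /Lam => h; rewrite lerNl; apply: (le_trans h).
  by rewrite le_eqVlt; apply/orP; left; apply/eqP; ring.
have lnK0 : 0 < ln K%:R :> R by rewrite ln_gt0// ltr1n.
pose D : R := (2 * ln K%:R)^-1.
have D0 : 0 < D by rewrite invr_gt0 mulr_gt0.
have pE k : expR (- (Lam k * (1 + 3 * rho))) / 2 = D / k.+2%:R.
  rewrite /Lam divfK ?gt_eqF// /L /N natrX lnXn// expRN lnK ?posrE ?mulrn_wgt0//.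
  by rewrite /D -mulr_natr -!invfM; congr (_^-1); ring.
(* A block containing a bad step counts as a success, so the bound holds after every history; along
   almost every path late blocks have no bad step, and a success then means a large sum. *)
pose Bk k h := ((1 - rho) * (lam k * S * Bv k) <= lin_process pi (good_weight G (w k) z) h) ||
   (past_sum (bad_variance G (w k)) h != 0).
have nL0 := nL 0.
have [k0 _ Hk0] : \forall k \near \oo, [/\ (1 - rho) * (N k.+1)%:R / b <= Bv k,
    (forall i, (1 + rho) * lam k * w k i <= eta),
    expR (- (Lam k * (rho ^+ 2 / 2))) <= 4^-1 & 0 <= L k].
  by near=> k; split; near: k.
have Bpos k : (k0 <= k)%N -> 0 < Bv k.
  move=> /Hk0[h2 _ _ _]; apply: lt_le_trans h2.
  by rewrite divr_gt0// mulr_gt0.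
have LamE k : (k0 <= k)%N -> lam k ^+ 2 * S * Bv k / 2 = Lam k.
  move=> kk; have [_ _ _ Lk] := Hk0 k kk; have := Bpos k kk => B0.
  by rewrite lam2//; field; rewrite !gt_eqF.
have Bmean k h : (k0 <= k)%N -> size h = N k ->
    D / k.+2%:R <= mean pi (N k.+1 - N k) (fun h => (Bk k h)%:R) h.
  move=> kk sh; have [_ sm lm Lk] := Hk0 k kk.
  have := @lower_block R pi G (w k) z S (rho ^+ 2 / 10) eta pi01 z2 S0 _ _ _
    (N k.+1 - N k)%N h rho (lam k).
  cbv zeta; rewrite sh subnKC ?Nm// -/(Bv k) LamE// pE; apply => //.
  - by rewrite divr_ge0// sqr_ge0.
  - by move=> i; exact: window_ge0.
  - move=> h' l Gh' hl; have := mgfG h' l Gh' hl.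
    have -> : S * (1 - rho ^+ 2 / 10) = S - S * (rho ^+ 2 / 10) by ring.
    by have -> : S * (1 + rho ^+ 2 / 10) = S + S * (rho ^+ 2 / 10) by ring.
  - by rewrite rho0 -subr_gt0.
  - exact: sqrtr_ge0.
  - apply: lin_process0 => i h' ih sh'; rewrite /good_weight sh' /w /window.
    by rewrite -sh leqNgt ih mulr0 if_same.
  - apply: past_sum0 => i h' ih sh'; rewrite /bad_variance sh' /w /window.
    by rewrite -sh leqNgt ih expr0n if_same.
have BC : {ae P, forall w', forall M, exists2 k, (M <= k)%N & Bk k (hist X (N k.+1) w')}.
  apply: (second_borel_cantelli law pi01 Nm Bmean) => kk e' kk0 e'0.
  apply: prod_harmonic_le => // k kkk.
  rewrite subr_ge0; apply: le_trans (Bmean k (nseq (N k) false) _ (size_nseq _ _)) _.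
    exact: leq_trans kkk.
  rewrite -[leRHS](mean_cst pi (N k.+1 - N k) 1 (nseq (N k) false)).
  by apply: mean_le => // t _; case: (Bk _ _); rewrite ?lexx ?ler01.
move: BC Gae hC; apply: filterS3 => v BC [n1 _ Gn1] [n2 _ hn2] M.
have [k Mk HB] := BC (maxn (maxn M k0) (maxn n1 n2)).
move: Mk; rewrite !geq_max => /andP[/andP[Mk kk] /andP[n1k n2k]].
exists (N k.+1); first by rewrite (leq_trans Mk)// ltnW// ltnW.
have [hB _ _ Lk] := Hk0 k kk; have B0 := Bpos k kk.
have Gk j : (N k <= j)%N -> G (hist X j v).
  by move=> jk; apply: Gn1; rewrite /= (leq_trans n1k)// (leq_trans _ jk)// ltnW.
have bad0 : past_sum (bad_variance G (w k)) (hist X (N k.+1) v) = 0.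
  apply: past_sum_hist0 => j jk; rewrite /bad_variance size_hist /w /window.
  case: (leqP (N k) j) => hj; first by rewrite Gk.
  by rewrite expr0n if_same.
move: HB; rewrite /Bk bad0 eqxx orbF => Hx.
have [gN gN'] := (gam_gt0 a_geN1 (N k), gam_gt0 a_geN1 (N k.+1)).
have lin0 : lin_process pi (good_weight G (w k) z) (hist X (N k) v) = 0.
  apply: lin_process0 => i h' ih sh'; rewrite /good_weight sh' /w /window.
  by rewrite size_hist in ih; rewrite leqNgt ih mulr0 if_same.
have devE : z * dev m (hist X (N k.+1) v) =
    gam a (N k.+1) / gam a (N k) * (z * dev m (hist X (N k) v)) +
    lin_process pi (good_weight G (w k) z) (hist X (N k.+1) v).
  have := @lin_process_hist_eq _ _ _ _ X pi (good_weight G (w k) z)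
    (fun h => (z * gam a (N k.+1)) * (gam a (size h).+1)^-1) _ _ v (Nm _ _ (leqnSn k)).
  rewrite lin0 subr0 => ->; last first.
    move=> j jk; rewrite /good_weight size_hist Gk ?(andP jk).1// /w /window jk; ring.
  rewrite !lin_processZ -mulrBr.
  have := gam_dev_hist X m s a_geN1 v (NN k); rewrite -addrA -/pi => H.
  rewrite -[dev m (hist X (N k.+1) v)](divfK (_ : gam a (N k.+1) != 0)) ?gt_eqF// H.
  by ring.
(* [(lam k * S * Bv k) ^+ 2] is [2 * Lam k * S * Bv k]; the losses in [Lam] and [Bv] multiply it by
   at least [(1 - rho) / (1 + 3 * rho)], which exceeds [(1 - 4 * rho) ^+ 2]. *)
have xge : (1 - rho) * (1 - 4 * rho) * k1 * psi R (N k.+1) <= (1 - rho) * (lam k * S * Bv k).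
  have -> : (1 - rho) * (1 - 4 * rho) * k1 * psi R (N k.+1) =
    (1 - rho) * ((1 - 4 * rho) * (k1 * psi R (N k.+1))) by ring.
  rewrite -(mulrA (lam k)); apply: ler_wpM2l; first exact: ltW.
  have psi2 : psi R (N k.+1) ^+ 2 = 2 * (N k.+1)%:R * L k.
    by rewrite sqr_sqrtr// mulr_ge0// mulr_ge0.
  have k12 : k1 ^+ 2 = S / b by rewrite sqr_sqrtr// ltW.
  rewrite -(@ler_pXn2r _ 2 isT) ?nnegrE; last 2 first.
  - by apply: mulr_ge0 => //; apply: mulr_ge0; exact: sqrtr_ge0.
  - apply: mulr_ge0; first exact: sqrtr_ge0.
    by apply: mulr_ge0; exact: ltW.
  rewrite !exprMn psi2 k12 lam2//.
  have -> : 2 * Lam k / (S * Bv k) * (S ^+ 2 * Bv k ^+ 2) = 2 * Lam k * S * Bv k.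
    by field; rewrite !gt_eqF.
  apply: (@le_trans _ _ (2 * Lam k * S * ((1 - rho) * (N k.+1)%:R / b))); last first.
    by rewrite ler_wpM2l// mulr_ge0 ?(ltW S0)// mulr_ge0// divr_ge0// ltW.
  rewrite /Lam.
  have -> : 2 * (L k / (1 + 3 * rho)) * S * ((1 - rho) * (N k.+1)%:R / b) =
    (1 - rho) / (1 + 3 * rho) * (S / b * (2 * (N k.+1)%:R * L k)).
    by field; rewrite !gt_eqF.
  apply: ler_wpM2r.
    by rewrite mulr_ge0 ?(ltW Sb)// mulr_ge0// mulr_ge0.
  exact: r6.
have lnle : ln (ln (N k)%:R) <= L k :> R.
  have lnN : 0 < ln (N k)%:R :> R by rewrite ln_gt0// ltr1n.
  have NNR : (N k)%:R <= (N k.+1)%:R :> R by rewrite ler_nat Nm.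
  have lnNN : ln (N k)%:R <= ln (N k.+1)%:R :> R by rewrite ler_ln ?posrE.
  by rewrite /L ler_ln ?posrE// (lt_le_trans lnN).
have tail : gam a (N k.+1) / gam a (N k) * (C0 * psi R (N k)) <= rho * psi R (N k.+1).
  apply: (@le_trans _ _ (gam a (N k.+1) / gam a (N k) * (C0 * Num.sqrt (2 * (N k)%:R * L k)))).
    rewrite ler_wpM2l ?divr_ge0 ?(ltW gN) ?(ltW gN')// ler_wpM2l//.
    by apply: ler_wsqrtr; rewrite ler_wpM2l// mulr_ge0.
  have NL0 : 0 <= 2 * (N k)%:R * L k by rewrite mulr_ge0// mulr_ge0.
  have NL1 : 0 <= 2 * (N k.+1)%:R * L k by rewrite mulr_ge0// mulr_ge0.
  rewrite -(@ler_pXn2r _ 2 isT) ?nnegrE; last 2 first.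
  - apply: mulr_ge0; first by rewrite divr_ge0// ltW.
    by apply: mulr_ge0 => //; exact: sqrtr_ge0.
  - by apply: mulr_ge0; [exact: ltW|exact: sqrtr_ge0].
  rewrite exprMn [X in _ * X <= _]exprMn [leRHS]exprMn !sqr_sqrtr//.
  apply: (@le_trans _ _ (2 * (e * K%:R) * (C0 ^+ 2 * (2 * (N k)%:R * L k)))).
    by rewrite ler_wpM2r// mulr_ge0// sqr_ge0.
  have -> : 2 * (e * K%:R) * (C0 ^+ 2 * (2 * (N k)%:R * L k)) =
    (2 * C0 ^+ 2 * e) * (2 * (N k.+1)%:R * L k) by rewrite NS natrM; ring.
  by rewrite ler_wpM2r.
have hN : - (z * dev m (hist X (N k) v)) <= C0 * psi R (N k).
  by apply: hn2; rewrite /= (leq_trans n2k)// ltnW.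
have c0 : 0 <= gam a (N k.+1) / gam a (N k) by rewrite divr_ge0// ltW.
have hN' := ler_wpM2l c0 hN; rewrite devE.
have psi0 : 0 <= psi R (N k.+1) by exact: sqrtr_ge0.
apply: (le_trans (ler_wpM2r psi0 kap)); rewrite mulrBl addrC; apply: lerD.
  by rewrite -[leRHS]opprK lerN2; apply: le_trans tail; rewrite -mulrN.
exact: le_trans Hx.
Unshelve. all: by end_near. Qed.

End lower_law.

(** * Quadratic strong law *)

Section log_cesaro.
Variable R : realType.

Lemma ln_le_inv k : ln k.+2%:R - ln k.+1%:R <= k.+1%:R^-1 :> R.
Proof.
have h : k.+2%:R / k.+1%:R = 1 + k.+1%:R^-1 :> R.
  by rewrite -[k.+2%:R]natr1 mulrDl divff ?mul1r// pnatr_eq0.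
rewrite -ln_div ?posrE ?ltr0n// h; apply: le_ln1Dx.
by apply: (@lt_le_trans _ _ 0); rewrite ?ltrN10// invr_ge0.
Qed.

Lemma sum_inv_le_ln n : (1 <= n)%N -> \sum_(1 <= k < n) k.+1%:R^-1 <= ln n%:R :> R.
Proof.
elim: n => [//|[|n] IH] _; first by rewrite big_geq// ln1.
rewrite big_nat_recr//=.
have h := inv_le_ln R (isT : (2 <= n.+2)%N); rewrite /= in h.
by apply: le_trans (lerD (IH isT) h) _; rewrite addrC subrK.
Qed.

Lemma sum_inv_ge_ln n : (1 <= n)%N -> ln n%:R - 1 <= \sum_(1 <= k < n) k.+1%:R^-1 :> R.
Proof.
move=> n1; have : forall n, (1 <= n)%N ->
    ln n.+1%:R - ln 2 <= \sum_(1 <= k < n) k.+1%:R^-1 :> R.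
  elim=> [//|[|k] IH] _; first by rewrite big_geq// subrr.
  rewrite big_nat_recr//=.
  by apply: le_trans (lerD (IH isT) (ln_le_inv k.+1)); rewrite [leRHS]addrC addrA subrK.
move/(_ n n1); have : ln 2 <= 1 :> R.
  by rewrite -[2]/(1 + 1); apply: le_ln1Dx; lra.
have : ln n%:R <= ln n.+1%:R :> R by rewrite ler_ln ?posrE ?ltr0n// ler_nat.
lra.
Qed.

(** Toeplitz averaging: the early terms and the gap between the harmonic sum and [ln n] are bounded,
    so [ln n] swallows them. *)
Lemma log_cesaro (t : nat -> R) l e : 0 < e ->
  (forall e, 0 < e -> \forall n \near \oo, `|t n - l| <= e) ->
  \forall n \near \oo, `|\sum_(1 <= k < n) t k / k.+1%:R - l * ln n%:R| <= e * ln n%:R.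
Proof.
move=> e0 tl; have e20 : 0 < e / 2 by rewrite divr_gt0.
have [n0 _ Hn0] := tl _ e20.
pose n1 := maxn n0 1; pose C := \sum_(1 <= k < n1) `|t k - l| / k.+1%:R.
near=> n.
have n1n : (n1 <= n)%N by near: n; exists n1.
have n1' : (1 <= n)%N by rewrite (leq_trans _ n1n)// leq_maxr.
have Cn : (C + `|l|) / (e / 2) <= ln n%:R by near: n; exact: near_ln_ge.
rewrite ler_pdivrMr// in Cn.
have h1 := sum_inv_le_ln n1'; have h2 := sum_inv_ge_ln n1'.
have -> : \sum_(1 <= k < n) t k / k.+1%:R - l * ln n%:R =
    \sum_(1 <= k < n) (t k - l) / k.+1%:R + l * (\sum_(1 <= k < n) k.+1%:R^-1 - ln n%:R).
  rewrite mulrBr mulr_sumr addrA -big_split/=; congr (_ - _).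
  by apply: eq_bigr => k _; ring.
have h3 : `|l * (\sum_(1 <= k < n) k.+1%:R^-1 - ln n%:R)| <= `|l|.
  rewrite normrM ler_piMr// ler_norml; apply/andP; split; lra.
have h4 : `|\sum_(1 <= k < n) (t k - l) / k.+1%:R| <= C + e / 2 * ln n%:R.
  apply: le_trans (ler_norm_sum _ _ _) _.
  rewrite (big_cat_nat (leq_maxr n0 1) n1n)/=; apply: lerD.
    by apply: ler_sum => k _; rewrite normrM [X in _ * X <= _]ger0_norm.
  apply: (@le_trans _ _ (\sum_(n1 <= k < n) e / 2 * k.+1%:R^-1)).
    rewrite big_nat_cond [leRHS]big_nat_cond; apply: ler_sum => k; rewrite andbT => /andP[nk _].
    rewrite normrM [X in _ * X <= _]ger0_norm// ler_wpM2r//.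
    by apply: Hn0; rewrite /= (leq_trans _ nk)// leq_maxl.
  rewrite -mulr_sumr ler_wpM2l ?(ltW e20)//; apply: le_trans h1.
  rewrite [leRHS](big_cat_nat (leq_maxr n0 1) n1n)/= lerDr sumr_ge0// => k _.
by have := ler_normD (\sum_(1 <= k < n) (t k - l) / k.+1%:R) (l * (\sum_(1 <= k < n) k.+1%:R^-1 - ln n%:R)); lra.
Unshelve. all: by end_near. Qed.

Lemma sum_inv_sqr_le n : \sum_(2 <= k < n) (k%:R ^+ 2)^-1 <= 1 :> R.
Proof.
suff H k : \sum_(2 <= i < k.+2) (i%:R ^+ 2)^-1 <= 1 - k.+1%:R^-1 :> R.
  case: n => [|[|n]]; [by rewrite big_geq|by rewrite big_geq|apply: (le_trans (H n))].
  by rewrite gerBl.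
elim: k => [|k IH]; first by rewrite big_geq// invr1 subrr.
rewrite big_nat_recr//=; apply: le_trans (lerD IH (lexx _)) _.
rewrite -[k.+2%:R]natr1; have : 0 < k.+1%:R :> R by rewrite ltr0n.
move: k.+1%:R => x x0.
have x10 : 0 < x + 1 by lra.
have -> : 1 - x^-1 + ((x + 1) ^+ 2)^-1 = 1 - (x + 1)^-1 - (x * (x + 1) ^+ 2)^-1.
  by field; rewrite !gt_eqF.
by rewrite gerBl invr_ge0 mulr_ge0 ?sqr_ge0// ltW.
Qed.

Lemma near_lnln_le e : 0 < e -> \forall n \near \oo, ln (ln n%:R) <= e * ln n%:R :> R.
Proof.
move=> e0; near=> n; have L : (2 / e) ^+ 2 <= ln n%:R by near: n; exact: near_ln_ge.
have e2 : 0 < 2 / e by rewrite divr_gt0.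
have L0 : 0 < ln n%:R :> R by apply: lt_le_trans L; rewrite exprn_gt0.
pose r := Num.sqrt (ln n%:R : R); have r0 : 0 < r by rewrite sqrtr_gt0.
have rE : ln n%:R = r ^+ 2 by rewrite sqr_sqrtr// ltW.
have re : 2 / e <= r.
  by rewrite -(@ler_pXn2r _ 2 isT) ?nnegrE ?(ltW e2) ?(ltW r0)// -rE.
rewrite ler_pdivrMr// in re.
rewrite rE lnXn// -mulr_natl; have := ln_sublinear r0 => lr.
by rewrite expr2; nra.
Unshelve. all: by end_near. Qed.

End log_cesaro.

Section second_moment.
Context (R : realType) (d : measure_display) (T : measurableType d)
  (P : probability T R) (X : nat -> {RV P >-> bool}) (a m s g : R).
Hypotheses (a_geN1 : -1 <= a) (g_ge : 2 * a <= g) (g_gt0 : 0 < g) (g_lt1 : g < 1).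
Hypothesis m01 : 0 <= m <= 1.
Let pi := succ_pr a m s.
Hypothesis pi01 : forall h, 0 <= pi h <= 1.
Hypothesis law : transition_law X pi.

Let b := 1 - 2 * a.
Let b0 : 0 < b. Proof. by rewrite /b; have := g_ge; have := g_lt1; lra. Qed.

(** Besides the conditional variance, this holds the remainder of
    [(1 + a / n) ^+ 2 / (n + 1) - n^-1], which equals [- b / n ^+ 2 + (b + a ^+ 2) / (n ^+ 2 * (n +
    1))]. *)
Definition drift (h : seq bool) : R :=
  pi h * (1 - pi h) + (b + a ^+ 2) * (dev m h / (size h)%:R) ^+ 2.

(* The increment of [dev h ^+ 2 / (size h)%:R] has martingale part
   [qweight h * (x - pi h)], since [(x - p) ^+ 2 = p * (1 - p) + (1 - 2 * p) * (x - p)]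
   when [x] is 0 or 1. *)
Definition qweight (h : seq bool) : R :=
  if h is [::] then 0
  else (2 * (1 + a / (size h)%:R) * dev m h + (1 - 2 * pi h)) / (size h).+1%:R.

Let step_identity (N y p x : R) : 0 < N -> x = 0 \/ x = 1 ->
  b * (y / N) ^+ 2 - y ^+ 2 / N =
  (p * (1 - p) + (b + a ^+ 2) * (y / N) ^+ 2) / (N + 1) +
  (2 * (1 + a / N) * y + (1 - 2 * p)) / (N + 1) * (x - p) -
  ((1 + a / N) * y + (x - p)) ^+ 2 / (N + 1).
Proof.
move=> N0 x01; have N10 : 0 < N + 1 by lra.
by rewrite /b; case: x01 => ->; field; rewrite !gt_eqF.
Qed.

Lemma quadratic_identity n w : (1 <= n)%N ->
  b * \sum_(1 <= k < n) (dev m (hist X k w) / k%:R) ^+ 2 =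
  \sum_(1 <= k < n) drift (hist X k w) / k.+1%:R +
  lin_process pi qweight (hist X n w) - dev m (hist X n w) ^+ 2 / n%:R +
  dev m (hist X 1 w) ^+ 2.
Proof.
elim: n => [//|[|n] IH] _.
  by rewrite !big_geq// mulr0 divr1 add0r subrK /= mul0r addr0.
have sumS (F : nat -> R) : \sum_(1 <= k < n.+2) F k = \sum_(1 <= k < n.+1) F k + F n.+1.
  by rewrite big_nat_recr.
rewrite !sumS mulrDr IH//.
have sh : size (hist X n.+1 w) = n.+1 by exact: size_hist.
have x01 : (X n.+2 w)%:R = 0 :> R \/ (X n.+2 w)%:R = 1 :> R by case: (X _ _); [right|left].
have N0 : 0 < n.+1%:R :> R by rewrite ltr0n.
have := step_identity (dev m (hist X n.+1 w)) (pi (hist X n.+1 w)) N0 x01.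
have -> : hist X n.+2 w = X n.+2 w :: hist X n.+1 w by [].
rewrite (@dev_cons _ a m s (X n.+2 w) (hist X n.+1 w)) ?sh// -/pi natr1.
have -> : lin_process pi qweight (X n.+2 w :: hist X n.+1 w) =
    lin_process pi qweight (hist X n.+1 w) +
    (2 * (1 + a / n.+1%:R) * dev m (hist X n.+1 w) + (1 - 2 * pi (hist X n.+1 w))) / n.+2%:R
    * ((X n.+2 w)%:R - pi (hist X n.+1 w)) by rewrite /= -sh.
have -> : drift (hist X n.+1 w) = pi (hist X n.+1 w) * (1 - pi (hist X n.+1 w)) +
    (b + a ^+ 2) * (dev m (hist X n.+1 w) / n.+1%:R) ^+ 2 by rewrite /drift sh.
move=> H.
have e1 (A B C D E : R) : A + B - C + D + E = (A + B + D) + (E - C) by ring.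
rewrite e1 H; set k2 := n.+2%:R; set N := n.+1%:R; ring.
Qed.

Lemma mean_dev_sqr_le n : mean pi n (fun h => dev m h ^+ 2) [::] <= varn a n.
Proof.
elim: n => [|n IH]; first by rewrite /mean /= /dev /= mulr0 subr0 expr0n.
rewrite (_ : mean pi n.+1 _ _ = mean pi n (mean pi 1 (fun h => dev m h ^+ 2)) [::]); last first.
  by rewrite -meanD addn1.
apply: (@le_trans _ _ (mean pi n (fun h => (1 + a / n%:R) ^+ 2 * dev m h ^+ 2 + 1) [::])).
  apply: (mean_le pi01) => h; rewrite cats0 => sh; rewrite /mean /= /step_mean.
  have /andP[p0 p1] := pi01 h; have /andP[m0 m1] := m01.
  (* The first step has mean [s] instead of [m], so it is not centred; its square is bounded by 1
     directly. *)
  case: n sh {IH} => [|n] sh.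
    move/size0nil: sh p0 p1 => ->; rewrite /dev /= => p0 p1.
    rewrite /pi /= in p0 p1.
    rewrite !addn0 mulr0n mulr1 mulr0 subr0 expr0n mulr0 ?add0r sqrrN.
    have h1 : (1 - m) ^+ 2 <= 1 by nra.
    have h2 : m ^+ 2 <= 1 by nra.
    by nra.
  rewrite !(dev_cons a m s) ?sh// -/pi; set c := (1 + _) * _.
  have -> : (1 + a / n.+1%:R) ^+ 2 * dev m h ^+ 2 = c ^+ 2 by rewrite /c; ring.
  by rewrite mulr1n mulr0n; nra.
by rewrite mean_add meanZ mean_cst /= lerD2r ler_wpM2l ?sqr_ge0.
Qed.

Lemma varn_linear : exists2 C, 0 <= C & forall n, varn a n <= C * n%:R.
Proof.
have e0 : 0 < (1 : R) by [].
have [M _ HM] := near_varn a_geN1 g_ge g_gt0 g_lt1 e0.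
have S0 : 0 <= \sum_(0 <= i < M) varn a i by apply: sumr_ge0 => i _; exact: varn_ge0.
have bi : 0 <= b^-1 by rewrite invr_ge0 ltW.
exists (b^-1 + 1 + \sum_(0 <= i < M) varn a i); first by lra.
move=> [|n]; first by rewrite /= mulr0.
case: (leqP M n.+1) => Mn.
  have := HM _ Mn; rewrite -/b ler_norml => /andP[_ h].
  rewrite mulrDl; apply: ler_wpDr; first exact: mulr_ge0.
  by move: h; rewrite mul1r mulrDl mul1r [b^-1 * _]mulrC; lra.
apply: (@le_trans _ _ (\sum_(0 <= i < M) varn a i)).
  rewrite (big_cat_nat (leq0n n.+1) (ltnW Mn))/= (big_ltn Mn) addrCA lerDl addr_ge0//;
    by apply: sumr_ge0 => i _; exact: varn_ge0.
apply: (@le_trans _ _ ((b^-1 + 1 + \sum_(0 <= i < M) varn a i) * 1)); first by rewrite mulr1; lra.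
by rewrite ler_wpM2l ?ler1n//; lra.
Qed.

Lemma mean_qweight_sqr : exists2 C, 0 <= C & forall n, (1 <= n)%N ->
  mean pi n (fun h => lin_process pi qweight h ^+ 2) [::] <= C * ln n%:R.
Proof.
have [C C0 HC] := varn_linear.
(* As [1 + a / k] lies between 0 and 2, the squared numerator of [qweight] is at most
   [32 * y ^+ 2 + 2] with [y = dev m h]. A conditional variance of at most 1/4 leaves
   [8 * y ^+ 2 + 1], and [y ^+ 2] has mean at most [C * k]. *)
exists (8 * C + 1); first by lra.
move=> n n1; rewrite (mean_lin_sqr pi01).
rewrite big_ltn// [X in X + _](_ : _ = 0) ?add0r; last by rewrite /mean /= expr0n mul0r.
apply: (@le_trans _ _ (\sum_(1 <= k < n) (8 * C + 1) * k.+1%:R^-1)); last first.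
  by rewrite -mulr_sumr ler_wpM2l ?sum_inv_le_ln//; lra.
rewrite big_nat_cond [leRHS]big_nat_cond; apply: ler_sum => k; rewrite andbT => /andP[k1 _].
have k0 : 0 < k%:R :> R by rewrite ltr0n.
have k10 : 0 < k.+1%:R :> R by rewrite ltr0n.
apply: (@le_trans _ _ (mean pi k (fun h => (k.+1%:R ^+ 2)^-1 * (8 * dev m h ^+ 2 + 1)) [::])).
  apply: (mean_le pi01) => h; rewrite cats0 => sh.
  have -> : qweight h = (2 * (1 + a / k%:R) * dev m h + (1 - 2 * pi h)) / k.+1%:R.
    by move: k1; rewrite -sh /qweight; case: (h).
  have /andP[p0 p1] := pi01 h; set y := dev m h; set p := pi h in p0 p1 *.
  have f1 : 0 <= 1 + a / k%:R <= 2.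
    rewrite factor_ge0//=.
    have : a / k%:R <= 1.
      rewrite ler_pdivrMr// mul1r; apply: (@le_trans _ _ 1); last by rewrite ler1n.
      by have := g_ge; have := g_lt1; lra.
    lra.
  move: f1 => /andP[f0 f1]; set f := 1 + a / k%:R in f0 f1 *.
  have v0 : 0 <= p * (1 - p) by rewrite mulr_ge0// subr_ge0.
  have v1 : p * (1 - p) <= 4^-1 by have := sqr_ge0 (p - 2^-1); rewrite expr2; lra.
  have fy : (f * y) ^+ 2 <= 4 * y ^+ 2.
    by rewrite exprMn ler_wpM2r ?sqr_ge0//; nra.
  have sq : (2 * f * y + (1 - 2 * p)) ^+ 2 <= 32 * y ^+ 2 + 2.
    have : 0 <= (2 * f * y - (1 - 2 * p)) ^+ 2 by exact: sqr_ge0.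
    have : (1 - 2 * p) ^+ 2 <= 1 by nra.
    by move: fy; nra.
  have main : (2 * f * y + (1 - 2 * p)) ^+ 2 * (p * (1 - p)) <= 8 * y ^+ 2 + 1.
    apply: (@le_trans _ _ ((32 * y ^+ 2 + 2) * 4^-1)).
      by apply: ler_pM => //; exact: sqr_ge0.
    by have := sqr_ge0 y; lra.
  rewrite expr_div_n mulrAC [leRHS]mulrC ler_wpM2r ?invr_ge0 ?sqr_ge0//.
rewrite meanZ mean_add meanZ mean_cst.
rewrite mulrC ler_pdivrMr ?exprn_gt0//.
have -> : (8 * C + 1) / k.+1%:R * k.+1%:R ^+ 2 = (8 * C + 1) * k.+1%:R.
  by field; rewrite gt_eqF.
have := mean_dev_sqr_le k; have := HC k; rewrite -[k.+1%:R]natr1.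
set x := k%:R in k0 *; set M := mean _ _ _ _ => h1 h2.
have : C * x >= 0 by rewrite mulr_ge0 ?(ltW k0).
by have := ltW k0; nra.
Qed.

End second_moment.

(** Sandwich of a monotone quantity between two sample points. Of the 9, 4 come from the errors
    there, 4 from multiplying them by [1 + e] with [e <= 1], and 1 covers the shift of [sg * z]. *)
Lemma interpolation (R : realFieldType) (sg e x y z B B1 B2 : R) :
  0 <= sg -> sg <= 4^-1 -> 0 < e -> e <= 1 -> 0 <= x -> x <= z -> z <= y ->
  y <= (1 + e) * x ->
  - (4 * e * x) <= B1 - sg * x -> B2 - sg * y <= 4 * e * y -> B1 <= B -> B <= B2 ->
  - (9 * e * z) <= B - sg * z <= 9 * e * z.
Proof.
move=> sg0 sg1 e0 e1 x0 xz zy yx u1 u2 b1 b2.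
have y1 : y <= (1 + e) * z by apply: (le_trans yx); rewrite ler_wpM2l//; lra.
have x1 : (1 - e) * z <= x.
  have : 0 <= e * (e * x) by rewrite !mulr_ge0// ltW.
  by nra.
have ez : 0 <= e * z by rewrite mulr_ge0//; lra.
have y2 : (sg + 4 * e) * y <= (sg + 4 * e) * ((1 + e) * z) by rewrite ler_wpM2l//; lra.
have y3 : (sg + 4 * e) * ((1 + e) * z) <= (sg + 9 * e) * z by nra.
have x2 : sg * ((1 - e) * z) <= sg * x by rewrite ler_wpM2l.
have x3 : e * x <= e * z by rewrite ler_wpM2l// ltW.
have x4 : sg * (e * z) <= e * z by rewrite ler_piMl//; lra.
by apply/andP; split; lra.
Qed.

Section quadratic_law.
Context (R : realType) (d : measure_display) (T : measurableType d)
  (P : probability T R) (X : nat -> {RV P >-> bool}) (a m s g : R).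
Hypotheses (a_geN1 : -1 <= a) (g_ge : 2 * a <= g) (g_gt0 : 0 < g) (g_lt1 : g < 1).
Hypothesis m01 : 0 <= m <= 1.
Let pi := succ_pr a m s.
Hypothesis pi01 : forall h, 0 <= pi h <= 1.
Hypothesis law : transition_law X pi.

Let b := 1 - 2 * a.
Let b0 : 0 < b. Proof. by rewrite /b; have := g_ge; have := g_lt1; lra. Qed.

(** The square in the exponent balances two needs: Chebyshev's failure probabilities, of order
    [1 / ln (nj j)], are summable like [1 / j ^+ 2], while [ln (nj j.+1) / ln (nj j)] tends to 1, so
    that monotonicity fills the gaps. *)
Let nj (j : nat) : nat := (2 ^ (j * j))%N.
Let l2 : R := ln 2.
Let l20 : 0 < l2. Proof. by rewrite /l2 ln_gt0//; lra. Qed.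

Let ln_nj j : ln (nj j)%:R = j%:R ^+ 2 * l2.
Proof. by rewrite /nj natrX lnXn// -[LHS]mulr_natl natrM expr2. Qed.

Let nj_homo : {homo nj : i j / (i <= j)%N}.
Proof. by move=> i j ij; rewrite /nj leq_exp2l// leq_mul. Qed.

Let nj_gt j : (j < nj j)%N.
Proof.
rewrite /nj; case: j => [//|j]; apply: (leq_trans (ltn_expl j.+1 (ltnSn 1))).
by rewrite leq_exp2l// leq_pmulr.
Qed.

Lemma martingale_log : {ae P, forall w, forall e, 0 < e ->
  \forall j \near \oo, `|lin_process pi (qweight a m s) (hist X (nj j) w)| <= e * ln (nj j)%:R}.
Proof.
have [C C0 HC] := mean_qweight_sqr a_geN1 g_ge g_gt0 g_lt1 m01 pi01.
(* Countably many thresholds suffice, and they yield one null set for all [e]. *)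
have H (i : nat) : {ae P, forall w, \forall j \near \oo,
    ~~ (i.+1%:R^-1 * ln (nj j)%:R < `|lin_process pi (qweight a m s) (hist X (nj j) w)|)}.
  pose e : R := i.+1%:R^-1; have e0 : 0 < e by rewrite invr_gt0 ltr0n.
  pose B j h := e * ln (nj j)%:R < `|lin_process pi (qweight a m s) h|.
  pose D := C / (e ^+ 2 * l2).
  have D0 : 0 <= D by rewrite divr_ge0// mulr_ge0 ?sqr_ge0// ltW.
  apply: (first_borel_cantelli (B := B) (k0 := 2) (C := D) law) => K.
  apply: (@le_trans _ _ (\sum_(2 <= j < K) D * (j%:R ^+ 2)^-1)); last first.
    by rewrite -mulr_sumr ler_piMr ?sum_inv_sqr_le.
  rewrite big_nat_cond [leRHS]big_nat_cond; apply: ler_sum => j; rewrite andbT => /andP[j2 _].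
  have j0 : 0 < j%:R :> R by rewrite ltr0n (leq_trans _ j2).
  have L0 : 0 < ln (nj j)%:R :> R by rewrite ln_nj mulr_gt0// exprn_gt0.
  have nj1 : (1 <= nj j)%N by rewrite (leq_trans _ (nj_gt j)).
  have eL : 0 < e * ln (nj j)%:R by rewrite mulr_gt0.
  apply: (@le_trans _ _ (mean pi (nj j) (fun h => ((e * ln (nj j)%:R) ^+ 2)^-1 *
      lin_process pi (qweight a m s) h ^+ 2) [::])).
    apply: (mean_le pi01) => h _; rewrite /B; case: ltP => [hB|_]; last first.
      by rewrite mulr_ge0 ?invr_ge0 ?sqr_ge0.
    rewrite mulrC ler_pdivlMr ?exprn_gt0// mul1r -[leRHS]real_normK ?num_real//.
    by rewrite lerXn2r ?nnegrE ?(ltW eL) ?(ltW hB).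
  rewrite meanZ mulrC ler_pdivrMr ?exprn_gt0//; apply: (le_trans (HC _ nj1)).
  rewrite le_eqVlt; apply/orP; left; apply/eqP.
  by rewrite /D ln_nj; field; rewrite !gt_eqF.
have := ae_foralln H; apply: filterS => w Hw e e0.
have ie : (Num.truncn e^-1).+1%:R^-1 <= e.
  have /truncn_itv/andP[_ /ltW h] : 0 <= e^-1 by rewrite invr_ge0 ltW.
  by rewrite -[leRHS]invrK lef_pV2 ?posrE ?invr_gt0// ltr0n.
have := Hw (Num.truncn e^-1); apply: filterS => j; rewrite -leNgt => /le_trans; apply.
by rewrite ler_wpM2r// ln_nj mulr_ge0 ?sqr_ge0// ltW.
Qed.

Theorem quadratic_strong_law (C : R) :
  {ae P, forall w, \forall n \near \oo, `|dev m (hist X n w)| <= C * psi R n} ->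
  {ae P, forall w, forall e, 0 < e -> \forall n \near \oo, `|dev m (hist X n w)| <= e * n%:R} ->
  {ae P, forall w,
    (ln n%:R)^-1 * (\sum_(1 <= k < n.+1) (dev m (hist X k w) / k%:R) ^+ 2) @[n --> \oo]
      --> m * (1 - m) / b}.
Proof.
move=> H1 H2; move: H1 H2 martingale_log; apply: filterS3 => w H1 H2 H3.
pose q n := \sum_(1 <= k < n) (dev m (hist X k w) / k%:R) ^+ 2.
have q_homo i j : (1 <= i)%N -> (i <= j)%N -> q i <= q j.
  move=> i1 ij; rewrite /q [leRHS](big_cat_nat i1 ij)/= lerDl.
  by apply: sumr_ge0 => k _; exact: sqr_ge0.
pose sg := m * (1 - m).
have sg0 : 0 <= sg by have /andP[m0 m1] := m01; rewrite mulr_ge0// subr_ge0.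
have sg1 : sg <= 4^-1 by have := sqr_ge0 (m - 2^-1); rewrite /sg expr2; lra.
have a2 : a ^+ 2 <= 1 by have := a_geN1; have := g_ge; have := g_lt1; nra.
have b3 : b <= 3 by rewrite /b; have := a_geN1; lra.
have drift_cvg e : 0 < e -> \forall n \near \oo, `|drift a m s (hist X n w) - sg| <= e.
  move=> e0; pose e1 := Num.min 1 (e / 5).
  have e10 : 0 < e1 by rewrite lt_min ltr01 divr_gt0.
  have e11 : e1 <= 1 by rewrite ge_min lexx.
  have e15 : 5 * e1 <= e by rewrite mulrC -ler_pdivlMr// ge_min lexx orbT.
  have h2 := H2 _ e10; near=> n.
  have n1 : (1 <= n)%N by near: n; exists 1%N.
  have n0 : 0 < n%:R :> R by rewrite ltr0n.
  have : `|dev m (hist X n w)| <= e1 * n%:R by near: n.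
  rewrite -ler_pdivrMr// -[n%:R^-1]gtr0_norm ?invr_gt0// -normrM => hy.
  have piE : succ_pr a m s (hist X n w) = m + a * (dev m (hist X n w) / n%:R).
    by rewrite mulrA -[in n%:R](size_hist X n w); case: (n) n1.
  rewrite /drift piE size_hist; set y := _ / n%:R in hy *.
  have -> : (m + a * y) * (1 - (m + a * y)) + (1 - 2 * a + a ^+ 2) * y ^+ 2 - sg =
    a * (1 - 2 * m) * y + (1 - 2 * a) * y ^+ 2 by rewrite /sg; ring.
  have /andP[m0 m1] := m01.
  have a1 : `|a| <= 1 by rewrite ler_norml; have := a_geN1; have := g_ge; have := g_lt1; lra.
  have c1 : `|a * (1 - 2 * m)| <= 1.
    by rewrite normrM mulr_ile1// ler_norml; lra.
  have y2 : `|y| ^+ 2 <= e1 by have := normr_ge0 y; nra.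
  apply: le_trans (ler_normD _ _) _; rewrite normrM (normrM (1 - 2 * a)).
  rewrite (ger0_norm (sqr_ge0 y)) -[y ^+ 2]real_normK ?num_real// (gtr0_norm b0) -/b.
  have := normr_ge0 y; have := normr_ge0 (a * (1 - 2 * m)); have := b0.
  move: (`|y|) (`|a * _|) hy c1 y2 => u v hy c1 y2 bb v0 u0.
  have : v * u <= e1 by nra.
  have : b * u ^+ 2 <= 3 * e1 by apply: ler_pM => //; [exact: ltW|exact: sqr_ge0].
  lra.
(* One [e] each for the averaged drift, the martingale, the final term [dev ^+ 2 / n], which the
   bound with [C] makes of order [ln (ln n)], and the fixed initial term. *)
have at_nj e : 0 < e -> \forall j \near \oo,
    `|b * q (nj j) - sg * ln (nj j)%:R| <= 4 * e * ln (nj j)%:R.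
  move=> e0.
  have lift (Q : nat -> Prop) : (\forall n \near \oo, Q n) -> \forall j \near \oo, Q (nj j).
    by move=> [M _ QM]; exists M => // j /= Mj; apply: QM => /=; rewrite (leq_trans Mj)// ltnW.
  have h1 := lift _ (log_cesaro e0 drift_cvg).
  have h3 := H3 _ e0.
  have C20 : 0 < e / (2 * C ^+ 2 + 1).
    by rewrite divr_gt0//; have := sqr_ge0 C; lra.
  have h4 := lift _ (near_lnln_le C20).
  have h5 := lift _ H1.
  have h6 := lift _ (near_ln_ge (dev m (hist X 1 w) ^+ 2 / e)).
  have h7 := lift _ (near_lnln_ge 0).
  near=> j; set n := nj j.
  have n1 : (1 <= n)%N by rewrite (leq_trans _ (nj_gt j)).
  have n0 : 0 < n%:R :> R by rewrite ltr0n.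
  have k1 : `|\sum_(1 <= k < n) drift a m s (hist X k w) / k.+1%:R - sg * ln n%:R| <= e * ln n%:R.
    by rewrite /n; near: j.
  have k3 : `|lin_process pi (qweight a m s) (hist X n w)| <= e * ln n%:R by rewrite /n; near: j.
  have k4 : ln (ln n%:R) <= e / (2 * C ^+ 2 + 1) * ln n%:R by rewrite /n; near: j.
  have k5 : `|dev m (hist X n w)| <= C * psi R n by rewrite /n; near: j.
  have k6 : dev m (hist X 1 w) ^+ 2 / e <= ln n%:R by rewrite /n; near: j.
  have k7 : 0 <= ln (ln n%:R) :> R by rewrite /n; near: j.
  rewrite ler_pdivrMr// in k6.
  have k8 : dev m (hist X n w) ^+ 2 / n%:R <= e * ln n%:R.
    rewrite ler_pdivrMr// -[dev _ _ ^+ 2]real_normK ?num_real//.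
    apply: (@le_trans _ _ ((C * psi R n) ^+ 2)).
      by rewrite lerXn2r ?nnegrE// (le_trans _ k5).
    rewrite exprMn sqr_sqrtr; last by rewrite mulr_ge0// mulr_ge0.
    have -> : C ^+ 2 * (2 * n%:R * ln (ln n%:R)) = 2 * C ^+ 2 * ln (ln n%:R) * n%:R by ring.
    rewrite ler_wpM2r ?(ltW n0)//.
    apply: (@le_trans _ _ ((2 * C ^+ 2 + 1) * ln (ln n%:R))).
      by rewrite ler_wpM2r// lerDl.
    rewrite -ler_pdivlMl; last by have := sqr_ge0 C; lra.
    by apply: (le_trans k4); rewrite le_eqVlt; apply/orP; left; apply/eqP; ring.
  have k9 : 0 <= dev m (hist X n w) ^+ 2 / n%:R by rewrite divr_ge0 ?sqr_ge0// ltW.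
  have k10 : 0 <= dev m (hist X 1 w) ^+ 2 by exact: sqr_ge0.
  rewrite (quadratic_identity X a m s w n1).
  move: k1 k3; rewrite !ler_norml => /andP[k1 k1'] /andP[k3 k3'].
  apply/andP; split; lra.
have jratio e : 0 < e -> \forall j \near \oo, ln (nj j.+1)%:R <= (1 + e) * ln (nj j)%:R :> R.
  move=> e0; near=> j.
  have j1 : 1 <= j%:R :> R by near: j; exact: near_natr_ge.
  have j3 : 3 / e <= j%:R by near: j; exact: near_natr_ge.
  rewrite ler_pdivrMr// in j3.
  rewrite !ln_nj mulrA ler_wpM2r ?(ltW l20)// -natr1.
  by move: j%:R j1 j3 => x x1 x3; nra.
apply/cvgrPdist_le => eps eps0; pose e := Num.min 1 (eps * b / 9).
have e0 : 0 < e by rewrite lt_min ltr01/= divr_gt0// mulr_gt0.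
have e1 : e <= 1 by rewrite ge_min lexx.
have e9 : 9 * e <= eps * b by rewrite mulrC -ler_pdivlMr// ge_min lexx orbT.
have n1 := at_nj _ e0; have n2 := jratio _ e0.
have [j0 _ Hj] : \forall j \near \oo,
   [/\ `|b * q (nj j) - sg * ln (nj j)%:R| <= 4 * e * ln (nj j)%:R,
       `|b * q (nj j.+1) - sg * ln (nj j.+1)%:R| <= 4 * e * ln (nj j.+1)%:R &
       ln (nj j.+1)%:R <= (1 + e) * ln (nj j)%:R :> R].
  have n3 : \forall j \near \oo,
      `|b * q (nj j.+1) - sg * ln (nj j.+1)%:R| <= 4 * e * ln (nj j.+1)%:R.
    by have [M _ HM] := n1; exists M => // j /= Mj; apply: HM => /=; rewrite leqW.
  by near=> j; split; near: j.
near=> n.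
have njn : (nj j0 <= n)%N by near: n; exists (nj j0).
have n1' : (1 <= n)%N by rewrite (leq_trans _ njn)// (leq_trans _ (nj_gt j0)).
have nub : exists K, (n < nj K)%N by exists n; exact: nj_gt.
have [j jj /andP[jn nj']] := block_cover nj_homo nub njn.
have [hj1 hj2 hj3] := Hj j jj.
have nj1 : (1 <= nj j)%N by rewrite (leq_trans _ (nj_gt j)).
have q1 : q (nj j) <= q n.+1 by apply: q_homo => //; rewrite leqW.
have q2 : q n.+1 <= q (nj j.+1) by apply: q_homo.
have L1 : ln (nj j)%:R <= ln n%:R :> R by rewrite ler_ln ?posrE ?ltr0n ?ler_nat.
have L2 : ln n%:R <= ln (nj j.+1)%:R :> R.
  rewrite ler_ln ?posrE ?ltr0n ?ler_nat//; first exact: ltnW.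
  exact: leq_ltn_trans nj'.
have Ln : 1 <= ln n%:R :> R by near: n; exact: near_ln_ge.
rewrite distrC -/(q n.+1) -/sg [X in X - _]mulrC.
have -> : q n.+1 * (ln n%:R)^-1 - sg / b = (b * q n.+1 - sg * ln n%:R) / (b * ln n%:R).
  by field; rewrite !gt_eqF// (lt_le_trans _ Ln).
have bL : 0 < b * ln n%:R by rewrite mulr_gt0// (lt_le_trans _ Ln).
rewrite normrM [X in _ * X]gtr0_norm ?invr_gt0// ler_pdivrMr//.
apply: (@le_trans _ _ (9 * e * ln n%:R)); last first.
  by rewrite mulrA ler_wpM2r// (le_trans _ Ln).
have bq1 := ler_wpM2l (ltW b0) q1; have bq2 := ler_wpM2l (ltW b0) q2.
move: hj1 hj2; rewrite !ler_norml => /andP[u1 _] /andP[_ u2].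
have x0 : 0 <= ln (nj j)%:R :> R by rewrite ln_nj mulr_ge0 ?sqr_ge0// ltW.
exact: (interpolation sg0 sg1 e0 e1 x0 L1 L2 hj3 u1 u2 bq1 bq2).
Unshelve. all: by end_near. Qed.

End quadratic_law.

(** * Sharp constants *)

Lemma limn_esup_eq (R : realType) (u : nat -> R) (l : R) :
  (forall e, 0 < e -> \forall n \near \oo, u n <= l + e) ->
  (forall e, 0 < e -> forall N, exists2 n, (N <= n)%N & l - e <= u n) ->
  limn_esup (fun n => (u n)%:E) = l%:E.
Proof.
move=> ul lu; apply/eqP; rewrite eq_le; apply/andP; split.
  apply/lee_addgt0Pr => e e0; rewrite -EFinD.
  apply: ereal_inf_le; exists (ereal_sup [set (u n)%:E | n in [set n | u n <= l + e]]).
    by exists [set n | u n <= l + e] => //; exact: ul.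
  by apply: ge_ereal_sup => _ [n /= un <-]; rewrite lee_fin.
apply: le_ereal_inf_tmp => _ [V [N _ NV] <-].
apply/lee_subgt0Pr => e e0; have [n Nn un] := lu e e0 N.
apply: le_ereal_sup_tmp; exists (u n)%:E; first by exists n => //; exact: NV.
by rewrite -EFinB lee_fin.
Qed.

Section sharp_constants.
Context (R : realType) (d : measure_display) (T : measurableType d)
  (P : probability T R) (X : nat -> {RV P >-> bool}) (a m s g : R).
Hypotheses (a_geN1 : -1 <= a) (g_ge : 2 * a <= g) (g_gt0 : 0 < g) (g_lt1 : g < 1).
Hypothesis m01 : 0 <= m <= 1.
Let pi := succ_pr a m s.
Hypothesis pi01 : forall h, 0 <= pi h <= 1.
Hypothesis law : transition_law X pi.

Let b := 1 - 2 * a.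
Let b0 : 0 < b. Proof. by rewrite /b; have := g_ge; have := g_lt1; lra. Qed.
Let sigma2 := m * (1 - m).
Let sigma20 : 0 <= sigma2.
Proof. by have /andP[m0 m1] := m01; rewrite mulr_ge0// subr_ge0. Qed.

(** With variance 1 every history is good, so nothing need be known about the path. The constant is
    merely one whose square exceeds [1 / b]. *)
Lemma crude_bound : exists2 C, 0 <= C &
  {ae P, forall w, \forall n \near \oo, `|dev m (hist X n w)| <= C * psi R n}.
Proof.
have bi : 0 < b^-1 by rewrite invr_gt0.
exists (b^-1 + 1); first by lra.
have H z : z ^+ 2 = 1 -> {ae P, forall w, \forall n \near \oo,
    z * dev m (hist X n w) <= (b^-1 + 1) * psi R n}.
  move=> z2.
  have := @upper_lil R d T P X a m s g a_geN1 g_ge g_gt0 g_lt1 pi01 law z 1 2^-1 (b^-1 + 1)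
    xpredT z2 ltr01.
  rewrite invr_gt0 ltr0n => /(_ isT).
  have h : forall h l, true -> `|l| <= 2^-1 -> mgf (succ_pr a m s h) l <= expR (l ^+ 2 * 1 / 2).
    by move=> h l _; exact: mgf_le_gauss.
  have h1 : 0 < b^-1 + 1 by lra.
  have h2 : 1 / (1 - 2 * a) < (b^-1 + 1) ^+ 2 by rewrite -/b mul1r; nra.
  move=> /(_ h h1 h2); apply: filterS => w; apply.
  by exists 0%N.
have z1 : 1 ^+ 2 = 1 :> R by rewrite expr1n.
have z2 : (-1) ^+ 2 = 1 :> R by rewrite sqrrN expr1n.
move: (H _ z1) (H _ z2); apply: filterS2 => w; apply: filterS2 => n.
by rewrite mul1r mulN1r ler_norml => h1 h2; apply/andP; split; lra.
Qed.

Lemma dev_small : {ae P, forall w, forall e, 0 < e ->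
  \forall n \near \oo, `|dev m (hist X n w)| <= e * n%:R}.
Proof.
have [C C0] := crude_bound; apply: filterS => w Hw e e0.
pose e1 := e ^+ 2 / (2 * C ^+ 2 + 1).
have C1 : 0 < 2 * C ^+ 2 + 1 by have := sqr_ge0 C; lra.
have e10 : 0 < e1 by rewrite divr_gt0// exprn_gt0.
near=> n.
have n1 : (1 <= n)%N by near: n; exists 1%N.
have n0 : 0 < n%:R :> R by rewrite ltr0n.
have L0 : 0 <= ln (ln n%:R) :> R by near: n; exact: near_lnln_ge.
have L1 : 1 <= ln n%:R :> R by near: n; exact: near_ln_ge.
have : ln n%:R * n%:R `^ 0 <= e1 * n%:R by near: n; exact: near_ln_powR_le.
rewrite powRr0 mulr1 => Ln.
apply: (@le_trans _ _ (C * psi R n)); first by near: n.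
rewrite -(@ler_pXn2r _ 2 isT) ?nnegrE; last 2 first.
- by apply: mulr_ge0 => //; exact: sqrtr_ge0.
- by apply: mulr_ge0 => //; exact: ltW.
rewrite exprMn sqr_sqrtr; last by rewrite mulr_ge0// mulr_ge0.
have lnln : ln (ln n%:R) <= e1 * n%:R :> R.
  by apply: le_trans Ln; apply/ltW/ln_sublinear; lra.
have -> : C ^+ 2 * (2 * n%:R * ln (ln n%:R)) = n%:R * (2 * C ^+ 2 * ln (ln n%:R)) by ring.
have -> : (e * n%:R) ^+ 2 = n%:R * ((2 * C ^+ 2 + 1) * (e1 * n%:R)).
  by rewrite /e1; field; rewrite gt_eqF.
rewrite ler_wpM2l ?(ltW n0)//; apply: (@le_trans _ _ ((2 * C ^+ 2 + 1) * ln (ln n%:R))).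
  by rewrite ler_wpM2r// lerDl.
by rewrite ler_wpM2l// ltW.
Unshelve. all: by end_near. Qed.

(** The empty history is excluded because [pi [::] = s] need not be near [m]. *)
Let good e : pred (seq bool) := fun h => (0 < size h)%N && (`|dev m h| <= e * (size h)%:R).

Let good_hist e : 0 < e -> {ae P, forall w, \forall n \near \oo, good e (hist X n w)}.
Proof.
move=> e0; move: dev_small; apply: filterS => w /(_ e e0) h.
near=> n; rewrite /good size_hist; apply/andP; split; first by near: n; exists 1%N.
by near: n.
Unshelve. all: by end_near. Qed.

Let mgf_good e h l : e <= 2^-1 -> good e h -> `|l| <= e ->
  expR (l ^+ 2 * (sigma2 - 2 * e) / 2) <= mgf (pi h) l <=
  expR (l ^+ 2 * (sigma2 + 2 * e) / 2).
Proof.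
move=> e2 /andP[h0 hd]; apply: mgf_near => //.
have n0 : 0 < (size h)%:R :> R by rewrite ltr0n.
have -> : pi h = m + a * dev m h / (size h)%:R by rewrite /pi; case: (h) h0.
rewrite addrAC subrr add0r !normrM [X in _ * X]gtr0_norm ?invr_gt0//.
rewrite ler_pdivrMr//; apply: le_trans hd.
by rewrite ler_piMl// ler_norml; have := a_geN1; have := g_ge; have := g_lt1; lra.
Qed.

Lemma sharp_upper z : z ^+ 2 = 1 -> {ae P, forall w, forall e, 0 < e ->
  \forall n \near \oo, z * dev m (hist X n w) <= (Num.sqrt (sigma2 / b) + e) * psi R n}.
Proof.
move=> z2; set c := Num.sqrt (sigma2 / b).
have c0 : 0 <= c by exact: sqrtr_ge0.
have cE : c ^+ 2 = sigma2 / b by rewrite sqr_sqrtr// divr_ge0// ltW.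
have H (i : nat) : {ae P, forall w, \forall n \near \oo,
    z * dev m (hist X n w) <= (c + i.+1%:R^-1) * psi R n}.
  have i0 : 0 < i.+1%:R^-1 :> R by rewrite invr_gt0 ltr0n.
  move: (i.+1%:R^-1) i0 => e e0.
  (* [(c + e) ^+ 2] exceeds [c ^+ 2] by at least [e ^+ 2], so the excess variance [2 * e1] is
     affordable even when [c = 0]. *)
  pose e1 := Num.min 2^-1 (b * e ^+ 2 / 4).
  have e10 : 0 < e1.
    by rewrite lt_min invr_gt0 ltr0n/= divr_gt0// mulr_gt0// exprn_gt0.
  have e12 : e1 <= 2^-1 by rewrite ge_min lexx.
  have e14 : 4 * e1 <= b * e ^+ 2 by rewrite mulrC -ler_pdivlMr// ge_min lexx orbT.
  have S20 : 0 < sigma2 + 2 * e1 by have := sigma20; lra.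
  have k0 : 0 < c + e by lra.
  have kS : (sigma2 + 2 * e1) / (1 - 2 * a) < (c + e) ^+ 2.
    rewrite -/b ltr_pdivrMr//.
    have -> : sigma2 = c ^+ 2 * b by rewrite cE divfK// gt_eqF.
    have : 0 <= b * (c * e) by rewrite !mulr_ge0 ?(ltW b0) ?(ltW e0).
    have : 0 < b * e ^+ 2 by rewrite mulr_gt0// exprn_gt0.
    by move: e14; lra.
  have mg h l : good e1 h -> `|l| <= e1 ->
     mgf (succ_pr a m s h) l <= expR (l ^+ 2 * (sigma2 + 2 * e1) / 2).
    by move=> gh le; have /andP[] := mgf_good e12 gh le.
  have := @upper_lil R d T P X a m s g a_geN1 g_ge g_gt0 g_lt1 pi01 law z _ e1 (c + e)
    (good e1) z2 S20 e10 mg k0 kS.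
  by move: (good_hist e10); apply: filterS2 => w gw; apply.
have := ae_foralln H; apply: filterS => w Hw e e0.
have ie : (Num.truncn e^-1).+1%:R^-1 <= e.
  have /truncn_itv/andP[_ /ltW h] : 0 <= e^-1 by rewrite invr_ge0 ltW.
  by rewrite -[leRHS]invrK lef_pV2 ?posrE ?invr_gt0// ltr0n.
have := Hw (Num.truncn e^-1); apply: filterS => n /le_trans; apply.
by rewrite ler_wpM2r ?sqrtr_ge0// lerD2l.
Qed.

Lemma sharp_lower z : z ^+ 2 = 1 -> {ae P, forall w, forall e, 0 < e ->
  forall N, exists2 n, (N <= n)%N &
    (Num.sqrt (sigma2 / b) - e) * psi R n <= z * dev m (hist X n w)}.
Proof.
move=> z2; set c := Num.sqrt (sigma2 / b).
have c0 : 0 <= c by exact: sqrtr_ge0.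
have cE : c ^+ 2 = sigma2 / b by rewrite sqr_sqrtr// divr_ge0// ltW.
(* [lower_lil] needs a positive variance. If it vanishes, then [c = 0] and the upper law for [- z]
   is the claim. *)
have [s0|s0] := eqVneq sigma2 0.
  have z2' : (- z) ^+ 2 = 1 by rewrite sqrrN.
  have := sharp_upper z2'; apply: filterS => w Hw e e0 N.
  have [M _ HM] := Hw e e0; exists (maxn M N); first exact: leq_maxr.
  have := HM _ (leq_maxl M N).
  by rewrite /c s0 mul0r sqrtr0 add0r sub0r !mulNr lerNl.
have sgt : 0 < sigma2 by rewrite lt0r s0 sigma20.
have c00 : 0 < c by rewrite sqrtr_gt0 divr_gt0.
have [C C0 HC] := crude_bound.
have hC : {ae P, forall w, \forall n \near \oo, - (z * dev m (hist X n w)) <= C * psi R n}.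
  move: HC; apply: filterS => w; apply: filterS => n; apply: le_trans.
  rewrite -mulNr; apply: le_trans (ler_norm _) _; rewrite normrM normrN.
  have -> : `|z| = 1.
    by apply/eqP; rewrite -(@eqrXn2 _ 2) ?normr_ge0// real_normK ?num_real// z2 expr1n.
  by rewrite mul1r.
have hG e : 0 < e -> exists (G : pred (seq bool)) (eta : R), [/\ 0 < eta,
   (forall h (l : R), G h -> `|l| <= eta ->
        expR (l ^+ 2 * (sigma2 - e) / 2) <= mgf (succ_pr a m s h) l <=
        expR (l ^+ 2 * (sigma2 + e) / 2)) &
     {ae P, forall w, \forall n \near \oo, G (hist X n w)}].
  move=> e0; pose e1 := Num.min 2^-1 (e / 2).
  have e10 : 0 < e1 by rewrite lt_min invr_gt0 ltr0n/= divr_gt0.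
  have e12 : e1 <= 2^-1 by rewrite ge_min lexx.
  have e14 : 2 * e1 <= e by rewrite mulrC -ler_pdivlMr// ge_min lexx orbT.
  exists (good e1), e1; split => //; last exact: good_hist.
  move=> h l gh le; have /andP[h1 h2] := mgf_good e12 gh le; apply/andP; split.
    apply: le_trans h1; rewrite ler_expR ler_wpM2r// ler_wpM2l ?sqr_ge0//; lra.
  apply: (le_trans h2); rewrite ler_expR ler_wpM2r// ler_wpM2l ?sqr_ge0//; lra.
(* A negative target is raised to 0, as [lower_lil] takes [0 <= kappa]. *)
have H (i : nat) : {ae P, forall w, forall N, exists2 n, (N <= n)%N &
    Num.max 0 (c - i.+1%:R^-1) * psi R n <= z * dev m (hist X n w)}.
  have i0 : 0 < i.+1%:R^-1 :> R by rewrite invr_gt0 ltr0n.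
  move: (i.+1%:R^-1) i0 => e e0.
  have k0 : 0 <= Num.max 0 (c - e) by rewrite le_max lexx.
  have kS : Num.max 0 (c - e) ^+ 2 < sigma2 / (1 - 2 * a).
    rewrite -/b -cE ltrXn2r// gt_max c00/=; lra.
  exact: (@lower_lil R d T P X a m s g a_geN1 g_ge g_gt0 g_lt1 pi01 law z _ _ C
    z2 sgt hG C0 hC k0 kS).
have := ae_foralln H; apply: filterS => w Hw e e0 N.
have ie : (Num.truncn e^-1).+1%:R^-1 <= e.
  have /truncn_itv/andP[_ /ltW h] : 0 <= e^-1 by rewrite invr_ge0 ltW.
  by rewrite -[leRHS]invrK lef_pV2 ?posrE ?invr_gt0// ltr0n.
have [n Nn Hn] := Hw (Num.truncn e^-1) N; exists n => //; apply: le_trans Hn.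
by rewrite ler_wpM2r ?sqrtr_ge0// le_max lerD2l lerN2 ie orbT.
Qed.

End sharp_constants.

Theorem theorem2p1 (R : realType) (d : measure_display) (T : measurableType d)
    (P : probability T R) (p q s : R)
    (X alpha beta : nat -> {RV P >-> bool}) (U : nat -> {RV P >-> nat})
    (hp : 0 <= p <= 1) (hq : 0 <= q <= 1) (hs : 0 <= s <= 1)
    (hX : minimal_random_walk p q s X alpha beta U)
    (ha : p - q < 1 / 2) :
  let a := p - q in
  let S := position X in
  let m := q / (1 - a) in
  let sigma2 := m * (1 - m) in
  let sigma := Num.sqrt sigma2 in
  let lil (w : T) (n : nat) :=
    Num.sqrt (n%:R / (2 * ln (ln n%:R))) * (S n w / n%:R - m) in
  [/\ sigma2 = q * (1 - p) / (1 - a) ^+ 2,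
      {ae P, forall w, S n w / n%:R @[n --> \oo] --> m},
      {ae P, forall w,
        limn_esup (fun n => (lil w n)%:E) = (- limn_einf (fun n => (lil w n)%:E))%E
        /\ (- limn_einf (fun n => (lil w n)%:E))%E = (sigma / Num.sqrt (1 - 2 * a))%:E},
      {ae P, forall w,
        limn_esup (fun n =>
          (n%:R / (2 * ln (ln n%:R)) * (S n w / n%:R - m) ^+ 2)%:E)
        = (sigma2 / (1 - 2 * a))%:E}
    & {ae P, forall w,
        (ln n%:R)^-1 * (\sum_(1 <= k < n.+1) (S k w / k%:R - m) ^+ 2) @[n --> \oo]
          --> sigma2 / (1 - 2 * a)}].
Proof.
move=> a S m sigma2 sigma lil.
have [p0 p1] := andP hp; have [q0 q1] := andP hq.
have a2 : a < 1 / 2 by [].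
have a1 : 0 < 1 - a by lra.
have m1E : 1 - m = (1 - p) / (1 - a) by rewrite /m /a; field; rewrite -/a gt_eqF.
have m01 : 0 <= m <= 1.
  rewrite -(subr_ge0 m 1) m1E !divr_ge0 ?(ltW a1)// subr_ge0//.
have a_geN1 : -1 <= a by rewrite /a; lra.
(* The value 1/2 keeps the exponent positive when [a <= 0]. *)
pose g : R := Num.max (2 * a) 2^-1.
have g_ge : 2 * a <= g by rewrite le_max lexx.
have g_gt0 : 0 < g by rewrite lt_max invr_gt0 ltr0n orbT.
have g_lt1 : g < 1.
  have h1 : 2 * a < 1 by lra.
  have h2 : 2^-1 < 1 :> R by lra.
  by rewrite gt_max h1 h2.
have b0 : 0 < 1 - 2 * a by lra.
have pi01 h : 0 <= succ_pr a m s h <= 1.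
  rewrite /succ_pr; case: h => [//|x h].
  have n0 : 0 < (size (x :: h))%:R :> R by rewrite ltr0n.
  have cn : (count id (x :: h))%:R <= (size (x :: h))%:R :> R by rewrite ler_nat count_size.
  move: n0 cn; rewrite /dev; set n := (size _)%:R; set c := (count _ _)%:R => n0 cn.
  have c0 : 0 <= c by [].
  (* The success probability is a mixture of [p] and [q], whence the bounds 0 and 1. *)
  have -> : m + a * (c - m * n) / n = (p * c + q * (n - c)) / n.
    by rewrite /m /a; field; rewrite -/a !gt_eqF.
  apply/andP; split.
    by rewrite divr_ge0 ?(ltW n0)// addr_ge0// mulr_ge0// subr_ge0.
  rewrite ler_pdivrMr// mul1r; nra.
have law : transition_law X (succ_pr a m s).
  by apply: (mrw_transition_law hp hq hs _ hX); rewrite -/a; lra.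
have devE n w : (1 <= n)%N -> S n w / n%:R - m = dev m (hist X n w) / n%:R.
  move=> n1; rewrite /dev count_hist size_hist -/S mulrBl mulfK// pnatr_eq0 -lt0n//.
have small := dev_small a_geN1 g_ge g_gt0 g_lt1 pi01 law.
have z1 : 1 ^+ 2 = 1 :> R by rewrite expr1n.
have z2 : (-1) ^+ 2 = 1 :> R by rewrite sqrrN expr1n.
have up1 := sharp_upper a_geN1 g_ge g_gt0 g_lt1 m01 pi01 law z1.
have up2 := sharp_upper a_geN1 g_ge g_gt0 g_lt1 m01 pi01 law z2.
have lo1 := sharp_lower a_geN1 g_ge g_gt0 g_lt1 m01 pi01 law z1.
have lo2 := sharp_lower a_geN1 g_ge g_gt0 g_lt1 m01 pi01 law z2.
have sigma20 : 0 <= sigma2.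
  by have /andP[m0 m1] := m01; rewrite mulr_ge0// subr_ge0.
pose c := Num.sqrt (sigma2 / (1 - 2 * a)).
have c0 : 0 <= c by exact: sqrtr_ge0.
have cE : c ^+ 2 = sigma2 / (1 - 2 * a) by rewrite sqr_sqrtr// divr_ge0// ltW.
have csig : sigma / Num.sqrt (1 - 2 * a) = c.
  by rewrite /c sqrtrM// sqrtrV// ltW.
have psiE w : \forall n \near \oo, [/\ 0 < psi R n, dev m (hist X n w) = lil w n * psi R n &
    n%:R / (2 * ln (ln n%:R)) * (S n w / n%:R - m) ^+ 2 = lil w n ^+ 2].
  near=> n.
  have n1 : (1 <= n)%N by near: n; exists 1%N.
  have n0 : 0 < n%:R :> R by rewrite ltr0n.
  have L0 : 1 <= ln (ln n%:R) :> R by near: n; exact: near_lnln_ge.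
  have L2 : 0 < 2 * ln (ln n%:R) :> R by lra.
  split.
  - by rewrite /psi sqrtr_gt0 mulrAC mulr_gt0.
  - rewrite /lil devE// mulrAC -sqrtrM ?divr_ge0 ?(ltW L2)//.
    have -> : n%:R / (2 * ln (ln n%:R)) * (2 * n%:R * ln (ln n%:R)) = n%:R ^+ 2 :> R.
      by field; rewrite gt_eqF//; lra.
    by rewrite sqrtr_sqr gtr0_norm// mulrC divfK// gt_eqF.
  - by rewrite /lil exprMn sqr_sqrtr// divr_ge0// ltW.
have lilP : {ae P, forall w, [/\
   (forall e, 0 < e -> \forall n \near \oo, lil w n <= c + e),
   (forall e, 0 < e -> \forall n \near \oo, - lil w n <= c + e),
   (forall e, 0 < e -> forall N, exists2 n, (N <= n)%N & c - e <= lil w n) &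
   (forall e, 0 < e -> forall N, exists2 n, (N <= n)%N & c - e <= - lil w n)]}.
  have up : {ae P, forall w, (forall e, 0 < e -> \forall n \near \oo, lil w n <= c + e) /\
      (forall e, 0 < e -> \forall n \near \oo, - lil w n <= c + e)}.
    move: up1 up2; apply: filterS2 => w h1 h2; have pw := psiE w; split=> e e0.
      move: (h1 e e0) pw; apply: filterS2 => n hn [ps0 dE _].
      by move: hn; rewrite dE mul1r ler_pM2r.
    move: (h2 e e0) pw; apply: filterS2 => n hn [ps0 dE _].
    by move: hn; rewrite dE mulN1r -mulNr ler_pM2r.
  move: up lo1 lo2; apply: filterS3 => w [u1 u2] h1 h2.
  have [M _ HM] := psiE w.
  split=> // e e0 N.
    have [n + Hn] := h1 e e0 (maxn M N); rewrite geq_max => /andP[Mn Nn].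
    exists n => //; have [ps0 dE _] := HM n Mn.
    by move: Hn; rewrite mul1r dE ler_pM2r.
  have [n + Hn] := h2 e e0 (maxn M N); rewrite geq_max => /andP[Mn Nn].
  exists n => //; have [ps0 dE _] := HM n Mn.
  by move: Hn; rewrite mulN1r dE -[- (lil w n * _)]mulNr ler_pM2r.
split.
- by rewrite /sigma2 m1E /m; field; rewrite gt_eqF.
- move: small; apply: filterS => w Hw; apply/cvgrPdist_le => e e0.
  near=> n; have n1 : (1 <= n)%N by near: n; exists 1%N.
  have n0 : 0 < n%:R :> R by rewrite ltr0n.
  rewrite distrC devE// normrM [X in _ * X]gtr0_norm ?invr_gt0// ler_pdivrMr//.
  by near: n; exact: Hw.
- move: lilP; apply: filterS => w [u1 u2 l1 l2].
  have E1 : limn_esup (fun n => (lil w n)%:E) = c%:E by exact: limn_esup_eq.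
  have E2 : (- limn_einf (fun n => (lil w n)%:E))%E = c%:E.
    by rewrite /limn_einf oppeK; exact: limn_esup_eq.
  by rewrite E1 E2 csig.
- move: lilP; apply: filterS => w [u1 u2 l1 l2]; rewrite -cE.
  apply: limn_esup_eq => e e0.
    (* For [e1 <= 1], [(c + e1) ^+ 2] is at most [c ^+ 2 + e1 * (2 * c + 1)]. Both one-sided bounds
       enter, as [lil w n] has either sign. *)
    pose e1 := Num.min 1 (e / (2 * c + 1)).
    have c1 : 0 < 2 * c + 1 by lra.
    have e10 : 0 < e1 by rewrite lt_min ltr01 divr_gt0.
    have e11 : e1 <= 1 by rewrite ge_min lexx.
    have e12 : e1 * (2 * c + 1) <= e by rewrite -ler_pdivlMr// ge_min lexx orbT.
    move: (u1 _ e10) (u2 _ e10) (psiE w); apply: filterS3 => n h1 h2 [_ _ ->].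
    by nra.
  move=> N; have c1 : 0 < 2 * c + 1 by lra.
  have e10 : 0 < e / (2 * c + 1) by rewrite divr_gt0.
  have [M _ HM] := psiE w.
  have [n + Hn] := l1 _ e10 (maxn M N); rewrite geq_max => /andP[Mn Nn].
  exists n => //; have [_ _ ->] := HM n Mn.
  have h : 2 * c * (e / (2 * c + 1)) <= e.
    rewrite mulrA ler_pdivrMr// mulrC ler_wpM2l ?(ltW e0)//; lra.
  (* The tangent bound [u ^+ 2 >= 2 * c * u - c ^+ 2] asks nothing of the sign of [u]. *)
  have := sqr_ge0 (lil w n - c); have := ler_wpM2l c0 Hn.
  by move: h; set k := e / _; move: (lil w n) => u; nra.
- have [C C0 HC] := crude_bound a_geN1 g_ge g_gt0 g_lt1 pi01 law.
  have := quadratic_strong_law a_geN1 g_ge g_gt0 g_lt1 m01 pi01 law HC small.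
  apply: filterS => w; rewrite -/sigma2; under eq_cvg do rewrite -/sigma2; apply: cvg_trans.
  apply: near_eq_cvg; near=> n; congr (_ * _); apply: eq_big_nat => k /andP[k1 _].
  by rewrite devE.
Unshelve. all: by end_near. Qed.
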